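(* Let $n\ge 3$, $M>0$, $1<p\le p_G(n)=\frac{n+1}{n-1}$, and let $D,V\in C(2M,\infty)$ satisfy $$0\le D(r)\le \mu_1 r^{-\beta},\qquad 0\le V(r)\le \mu_2 r^{-\gamma},\qquad r>2M,$$ for some constants $\mu_1,\mu_2\ge 0$, $\beta>1$, $\gamma>2$. Let $u_0,u_1$ be nonnegative, nontrivial radial functions on $\Omega$ with $$\operatorname{supp}u_0(r(s)),\ \operatorname{supp}u_1(r(s))\subset\{s\in\mathbb{R}: |s|\le R\}\times\mathbb{S}^{n-1}$$ for some constant $R>0$, and suppose that for some fixed $\lambda_0>\frac{4}{M(p-1)p}$, $$\int_{\mathbb{R}}\phi_{\lambda_0}(s)\Big(u_1(r(s))\,r(s)^{\frac{n-1}{2}}+\big(\lambda_0DF+\lambda_0^2-Q\big)u_0(r(s))\,r(s)^{\frac{n-1}{2}}\Big)ds>0 ,$$ where $D,F,Q$ are evaluated at $r=r(s)$. Consider the Cauchy problem $$\square_{g_S}u+D(r)u_t+V(r)u=|u_t|^p\ \text{ in }(0,T)\times\Omega,\qquad u(0,x)=\varepsilon u_0(x),\quad u_t(0,x)=\varepsilon u_1(x),\ x\in\Omega.$$ Then any weak radial solution $u$ of this problem satisfying $$\operatorname{supp}u(t,\cdot)\subset\{|s|\le t+R\}\times\mathbb{S}^{n-1}\quad\text{for all }t\in(0,T_\varepsilon)$$ blows up in finite time. In addition, there exist positive constants $C,\varepsilon_0$ (independent of $\varepsilon$) such that the lifespan $T_\varepsilon$ satisfies, for any $0<\varepsilon\le\varepsilon_0$,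 $$T_\varepsilon\le\begin{cases} C\varepsilon^{-\left(\frac{1}{p-1}-\frac{n-1}{2}\right)^{-1}}, & 1<p<p_G(n),\\[4pt] \exp\big(C\varepsilon^{-(p-1)}\big), & p=p_G(n).\end{cases}$$
   Context: Let $F(r)=1-\frac{2M}{r}$ and $\Omega=\{(r,\omega): r>2M,\ \omega\in\mathbb{S}^{n-1}\}=(2M,\infty)\times\mathbb{S}^{n-1}$, with points of $\Omega$ denoted $x$, $|x|=r$. The operator is $$\square_{g_S}u=\frac1F\partial_t^2u-\Delta_{g_S}u,\qquad \Delta_{g_S}u=\frac{1}{r^{n-1}}\partial_r\big(r^{n-1}F\,\partial_r u\big)+\frac{1}{r^2}\Delta_{\mathbb{S}^{n-1}}u,$$ where $\Delta_{\mathbb{S}^{n-1}}$ is the standard Laplace-Beltrami operator on $\mathbb{S}^{n-1}$. The tortoise coordinate is $s=r+2M\ln(r-2M)$; $r\mapsto s$ is a bijection $(2M,\infty)\to\mathbb{R}$, with inverse $r(s)$. The set $\{|s|\le\rho\}\times\mathbb{S}^{n-1}$ is the set of $(r,\omega)\in\Omega$ whose tortoise coordinate $s$ has $|s|\le\rho$. ''Radial'' means depending on $x$ only through $r$. The function $Q$ is $$Q=F(r(s))V(r(s))+\frac{(n^2-4n+3)F(r(s))^2}{4r(s)^2}+\frac{(n-1)MF(r(s))}{r(s)^3}.$$ For $\lambda>0$, $\phi_\lambda\in C^2(\mathbb{R})$ denotes a solution of $$\partial_s^2\phi_\lambda=Q\phi_\lambda+\lambda DF\phi_\lambda+\lambda^2\phi_\lambda,\quad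 s\in\mathbb{R},$$ with $\phi_\lambda\simeq e^{\lambda s}$, i.e. $c_1e^{\lambda s}\le\phi_\lambda(s)\le c_2e^{\lambda s}$ for all $s\in\mathbb{R}$ with constants $0<c_1\le c_2$ (such a solution exists). Weak solution on $(0,T)$, in the usual sense: $u\in L^1_{loc}([0,T)\times\Omega)$ with weak derivative $u_t\in L^p_{loc}([0,T)\times\Omega)$ such that for all compactly supported $C^2$ functions $\varphi$ on $[0,T)\times\Omega$ $$\int_0^T\!\!\int_\Omega |u_t|^p\varphi\, r^{n-1}dr\,d\omega\, dt+\varepsilon\int_\Omega\Big(\frac{u_1\varphi(0)-u_0\varphi_t(0)}{F}+Du_0\varphi(0)\Big)r^{n-1}dr\,d\omega=\int_0^T\!\!\int_\Omega u\Big(\frac{\varphi_{tt}}{F}-\Delta_{g_S}\varphi-D\varphi_t+V\varphi\Big)r^{n-1}dr\,d\omega\, dt ,$$ where $u_0,u_1$ are (at least) locally integrable. The size of the data is $\varepsilon>0$, and $T_\varepsilon$ denotes the lifespan, i.e. the supremum of the times $T$ for which such a radial solution, satisfying the stated support condition, exists on $(0,T)$; ''blows up in finite time'' means $T_\varepsilon<\infty$. *)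

(* Defs.v *)
From HB Require Import structures.
From mathcomp Require Import all_boot all_order all_algebra.
From mathcomp Require Import all_classical all_reals all_analysis.
From mathcomp Require Import measurable_realfun.

Set Implicit Arguments.
Unset Strict Implicit.
Unset Printing Implicit Defensive.

Import Order.TTheory GRing.Theory Num.Theory.
Import numFieldNormedType.Exports.

Local Open Scope classical_set_scope.
Local Open Scope ring_scope.

(* The sigma-algebra on R^n generated by the coordinates, i.e. the Borel one. *)
Section rV_measurable.
Context {R : realType} {n : nat}.

Definition rV_coord (i : 'I_n) (x : 'rV[R]_n) : measurableTypeR R := x ord0 i.

Let rV_set0 : g_sigma_preimage rV_coord set0.
Proof. exact: sigma_algebra0. Qed.

Let rV_setC A : g_sigma_preimage rV_coord A -> g_sigma_preimage rV_coord (~` A).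
Proof. exact: sigma_algebraC. Qed.

Let rV_bigcup (F : _^nat) : (forall i, g_sigma_preimage rV_coord (F i)) ->
  g_sigma_preimage rV_coord (\bigcup_i (F i)).
Proof. exact: sigma_algebra_bigcup. Qed.

HB.instance Definition _ := @isMeasurable.Build default_measure_display
  'rV[R]_n (g_sigma_preimage rV_coord) rV_set0 rV_setC rV_bigcup.

Lemma measurable_rV_coord (i : 'I_n) : measurable_fun setT (rV_coord i).
Proof.
move=> _ Y mY; rewrite setTI; apply: sub_sigma_algebra.
rewrite -bigcup_seq/=; exists i => /=; first by rewrite mem_index_enum.
by exists Y; rewrite ?setTI.
Qed.

Lemma measurable_fun_rVP d (T : measurableType d) (f : T -> 'rV[R]_n) :
  (forall i, measurable_fun setT (rV_coord i \o f)) -> measurable_fun setT f.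
Proof.
move=> mf _ A mA.
suff : preimage_set_system setT f (@measurable _ 'rV[R]_n) `<=` measurable.
  by apply; exists A.
rewrite [X in preimage_set_system _ _ X](_ : _ = g_sigma_preimage rV_coord)//.
rewrite -g_sigma_preimage_comp.
apply: smallest_sub; first exact: sigma_algebra_measurable.
rewrite -bigcup_seq; apply: bigcup_sub => i _ B [C mC <-].
exact: mf.
Qed.

End rV_measurable.

Section rV_cons.
Context {R : realType} {m : nat}.
Implicit Types z : measurableTypeR R * 'rV[R]_m.

Definition rV_cons z : 'rV[R]_m.+1 := row_mx (z.1%:M : 'M[R]_1) z.2.

Definition rV_uncons (v : 'rV[R]_m.+1) : measurableTypeR R * 'rV[R]_m :=
  (v ord0 ord0, @rsubmx R 1 1 m v).

Lemma rV_cons0 z : rV_cons z ord0 ord0 = z.1.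
Proof.
have -> : ord0 = lshift m (ord0 : 'I_1) :> 'I_(1 + m) by apply/val_inj.
by rewrite [LHS](@row_mxEl R 1 1 m) mxE eqxx.
Qed.

Lemma rV_consS z (j : 'I_m) : rV_cons z ord0 (rshift 1 j) = z.2 ord0 j.
Proof. by rewrite [LHS](@row_mxEr R 1 1 m). Qed.

Lemma rV_consK : cancel rV_cons rV_uncons.
Proof.
move=> [x v]; rewrite /rV_uncons rV_cons0; congr pair.
by apply/rowP => j; rewrite mxE rV_consS.
Qed.

Lemma measurable_rV_cons : measurable_fun setT rV_cons.
Proof.
apply: measurable_fun_rVP => i; have [j|j] := @splitP 1 m i => ij.
  have -> : i = ord0 by apply/val_inj; rewrite /= ij ord1.
  by rewrite (_ : _ \o _ = fst)//; apply/funext => z; exact: rV_cons0.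
have -> : i = rshift 1 j by exact/val_inj.
rewrite (_ : _ \o _ = rV_coord j \o snd).
  by apply: measurableT_comp => //; exact: measurable_rV_coord.
by apply/funext => z; exact: rV_consS.
Qed.

Lemma measurable_rV_uncons : measurable_fun setT rV_uncons.
Proof.
apply/measurable_fun_pairP; split.
  exact: (@measurable_rV_coord R m.+1 ord0).
apply: measurable_fun_rVP => i.
rewrite (_ : _ \o _ = rV_coord (rshift 1 i : 'I_m.+1)).
  exact: measurable_rV_coord.
by apply/funext => v; rewrite /= /rV_coord mxE.
Qed.

Variable nu : {sigma_finite_measure set 'rV[R]_m -> \bar R}.
Local Notation mu := (@lebesgue_measure R).

(* The product measure dx_0 * nu, transported to R^(m + 1). *)
Definition measure_cons : set 'rV[R]_m.+1 -> \bar R :=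
  pushforward (mu \x nu)%E rV_cons.

Let pf := measure_function_pushforward__canonical__measure_function_Measure
  (mu \x nu)%E measurable_rV_cons.

HB.instance Definition _ := isMeasure.Build _ _ _ measure_cons
  (measure0 pf) (measure_ge0 pf) (@measure_semi_sigma_additive _ _ _ pf).

Let measure_cons_sigma_finite : sigma_finite setT measure_cons.
Proof.
have /sigma_finiteP[F [TF ndF Foo]] := sigma_finiteT mu.
have /sigma_finiteP[G [TG ndG Goo]] := sigma_finiteT nu.
exists (fun k => rV_uncons @^-1` (F k `*` G k)).
  apply/seteqP; split=> // v _.
  have [i _ Fi] : (\bigcup_k F k) (rV_uncons v).1 by rewrite -TF.
  have [j _ Gj] : (\bigcup_k G k) (rV_uncons v).2 by rewrite -TG.
  exists (maxn i j) => //; split.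
    by move: Fi; apply/subsetPset/ndF/leq_maxl.
  by move: Gj; apply/subsetPset/ndG/leq_maxr.
move=> k; have [mF Fk] := Foo k; have [mG Gk] := Goo k; split.
  rewrite -[X in measurable X]setTI; apply: measurable_rV_uncons => //.
  exact: measurableX.
rewrite /measure_cons /pushforward (_ : _ @^-1` _ = F k `*` G k).
  by rewrite product_measure1E// lte_mul_pinfty// ge0_fin_numE.
by rewrite -comp_preimage (_ : _ \o _ = id)//; apply/funext; exact: rV_consK.
Qed.

HB.instance Definition _ := Measure_isSigmaFinite.Build _ _ _ measure_cons
  measure_cons_sigma_finite.

End rV_cons.

(* Lebesgue measure on R^n. *)
Fixpoint lebesgue_rV (R : realType) (n : nat) :
    {sigma_finite_measure set 'rV[R]_n -> \bar R} :=
  match n with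
  | 0 => dirac (0 : 'rV[R]_0)
  | m.+1 => measure_cons (lebesgue_rV R m)
  end.

Section sphere.
Context {R : realType} {n : nat}.
Implicit Types x : 'rV[R]_n.

(* The library's norm on matrices is the sup norm. *)
Definition enorm x : R := Num.sqrt (\sum_(i < n) x ord0 i ^+ 2).

Definition sphere : set 'rV[R]_n := [set x | enorm x = 1].

Definition direction x : 'rV[R]_n := (enorm x)^-1 *: x.

Definition cone (A : set 'rV[R]_n) : set 'rV[R]_n :=
  [set x | enorm x <= 1 /\ A (direction x)].

(* Surface measure of S^(n-1): sigma(A) = n * vol{ r w : 0 < r <= 1, w in A }. *)
Definition sphere_measure (A : set 'rV[R]_n) : \bar R :=
  (n%:R%:E * lebesgue_rV R n (cone A))%E.

Lemma measurable_enorm :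
  measurable_fun setT (enorm : _ -> measurableTypeR R).
Proof.
apply: (@measurableT_comp _ _ _ _ _ _ (Num.sqrt : R -> R)) => //.
  by apply: continuous_measurable_fun; exact: sqrt_continuous.
apply: measurable_sum => i; apply: measurable_funX.
exact: measurable_rV_coord.
Qed.

Lemma measurable_direction : measurable_fun setT direction.
Proof.
apply: measurable_fun_rVP => i.
rewrite (_ : _ \o _ = (fun x => (enorm x) `^ (-1) * x ord0 i) :> (_ -> R)).
  apply: measurable_funM; last exact: measurable_rV_coord.
  exact: (measurableT_comp (measurable_powR _) measurable_enorm).
by apply/funext => x; rewrite /rV_coord /= mxE powR_inv1// sqrtr_ge0.
Qed.

Let coneE A : cone A = (enorm @^-1` `]-oo, 1]) `&` (direction @^-1` A).
Proof. by apply/seteqP; split=> x; rewrite /cone /= in_itv/=. Qed.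

Lemma measurable_cone A : measurable A -> measurable (cone A).
Proof.
move=> mA; rewrite coneE; apply: measurableI.
  by rewrite -[X in measurable X]setTI; exact: measurable_enorm.
by rewrite -[X in measurable X]setTI; exact: measurable_direction.
Qed.

Let sphere_measure0 : sphere_measure set0 = 0%E.
Proof.
rewrite /sphere_measure (_ : cone set0 = set0) ?measure0 ?mule0//.
by rewrite -subset0 => x [].
Qed.

Let sphere_measure_ge0 A : (0 <= sphere_measure A)%E.
Proof. by rewrite mule_ge0. Qed.

Let sphere_measure_sigma_additive : semi_sigma_additive sphere_measure.
Proof.
move=> F mF tF mUF.
have cU : cone (\bigcup_k F k) = \bigcup_k cone (F k).
  apply/seteqP; split=> x; first by move=> [x1 [k _ Fk]]; exists k.
  by move=> [k _ [x1 Fk]]; split=> //; exists k.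
have -> : (fun m => \sum_(0 <= i < m) sphere_measure (F i))%E =
    (fun m => n%:R%:E * \sum_(0 <= i < m) lebesgue_rV R n (cone (F i)))%E.
  by apply/funext => m; rewrite ge0_sume_distrr.
rewrite /sphere_measure cU; apply: cvgeZl => //.
apply: measure_semi_sigma_additive.
- by move=> i; exact: measurable_cone.
- by move=> i j _ _ [x [[_ xi] [_ xj]]]; apply: tF => //; exists (direction x).
- by rewrite -cU; exact: measurable_cone.
Qed.

HB.instance Definition _ := isMeasure.Build _ _ _ sphere_measure
  sphere_measure0 sphere_measure_ge0 sphere_measure_sigma_additive.

End sphere.

Section calculus.
Context {R : realType}.

(* Class C^2 on an open set U of a finite-dimensional space. *)
Definition C2_on (V : normedModType R) (U : set V) (f : V -> R) : Prop :=
  forall x, U x ->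
    {for x, continuous f} /\
    forall v, [/\ derivable f x v, {for x, continuous ('D_v f)} &
      forall w, derivable ('D_v f) x w /\ {for x, continuous ('D_w ('D_v f))}].

(* Laplace-Beltrami operator of S^(n-1), computed as the Euclidean Laplacian of
   the extension of f that is homogeneous of degree 0. *)
Definition laplace_sphere (n : nat) (f : 'rV[R]_n -> R) (w : 'rV[R]_n) : R :=
  let g : 'rV[R]_n -> R := f \o direction in
  \sum_(i < n) 'D_(delta_mx ord0 i) ('D_(delta_mx ord0 i) g) w.

End calculus.

(* Omega = (2M, +oo) * S^(n-1); a function of (r, w) in Omega is represented by
   f : R -> 'rV[R]_n -> R, and only its values on Omega matter. *)
Section schwarzschild.
Context {R : realType} (n : nat) (M : R).
Local Notation mu := (@lebesgue_measure R).

Definition F_S (r : R) : R := 1 - 2 * M / r.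

Definition tortoise (r : R) : R := r + 2 * M * ln (r - 2 * M).

(* The inverse s |-> r(s) of the tortoise coordinate. *)
Definition radius_of (s : R) : R := get [set r | 2 * M < r /\ tortoise r = s].

Definition laplace_gS (f : R -> 'rV[R]_n -> R) (r : R) (w : 'rV[R]_n) : R :=
  (r ^+ n.-1)^-1 *
    derive1 (fun x => x ^+ n.-1 * F_S x * derive1 (f ^~ w) x) r +
  (r ^+ 2)^-1 * laplace_sphere (f r) w.

Definition integral_Omega (f : R -> 'rV[R]_n -> R) : \bar R :=
  (\int[mu]_(r in `](2 * M)%R, +oo[) \int[sphere_measure]_(w in sphere)
     (f r w * r ^+ n.-1)%:E)%E.

Definition integral_time_Omega (T : R) (f : R -> R -> 'rV[R]_n -> R) : \bar R :=
  (\int[mu]_(t in `[0%R, T[) integral_Omega (f t))%E.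

(* f belongs to L^q_loc([0, T) * Omega); every compact subset of [0, T) * Omega
   lies in some [0, T'] * [a, b] * S^(n-1). *)
Definition Lq_loc (q T : R) (f : R -> R -> 'rV[R]_n -> R) : Prop :=
  measurable_fun
    [set z : measurableTypeR R * measurableTypeR R * 'rV[R]_n |
      [/\ 0 <= z.1.1 < T, 2 * M < z.1.2 & sphere z.2]]
    (fun z => f z.1.1 z.1.2 z.2 : measurableTypeR R) /\
  forall T' a b : R, 0 < T' < T -> 2 * M < a -> a < b ->
    (\int[mu]_(t in `[0%R, T']) \int[mu]_(r in `[a, b])
       \int[sphere_measure]_(w in sphere) (`|f t r w| `^ q)%:E < +oo)%E.

(* Compactly supported C^2 functions on [0, T) * Omega: C^2 up to t = 0 means
   that there is a C^2 extension to some (-d, +oo) * Omega, and C^2 in the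
   variable w of the sphere is tested on the extension homogeneous of degree 0
   to nonzero vectors. *)
Definition test_function (T : R) (phi : R -> R -> 'rV[R]_n -> R) : Prop :=
  (exists2 d : R, 0 < d &
    C2_on [set z : R * R * 'rV[R]_n |
            [/\ - d < z.1.1, 2 * M < z.1.2 & z.2 != 0]]
      (fun z => phi z.1.1 z.1.2 (direction z.2))) /\
  exists T' a b : R, [/\ 0 < T' < T, 2 * M < a &
    forall t r w, 0 <= t -> 2 * M < r -> sphere w ->
      phi t r w != 0 -> t <= T' /\ a <= r <= b].

(* Compactly supported C^2 functions on (0, T) * Omega. *)
Definition test_function_int (T : R) (phi : R -> R -> 'rV[R]_n -> R) : Prop :=
  test_function T phi /\
  exists2 t0 : R, 0 < t0 &
    forall t r w, t < t0 -> 2 * M < r -> sphere w -> phi t r w = 0.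

(* v is the weak time derivative of u on (0, T) * Omega. *)
Definition weak_dt (T : R) (u v : R -> R -> 'rV[R]_n -> R) : Prop :=
  forall phi, test_function_int T phi ->
    integral_time_Omega T
      (fun t r w => u t r w * derive1 (fun x => phi x r w) t) =
    (- integral_time_Omega T (fun t r w => v t r w * phi t r w)%R)%E.

(* u is a weak solution on (0, T) of (1/F) u_tt - Delta_gS u + D u_t + V u =
   |u_t|^p with data (eps u0, eps u1). *)
Definition weak_solution (p : R) (D V : R -> R) (u0 u1 : R -> 'rV[R]_n -> R)
    (eps T : R) (u : R -> R -> 'rV[R]_n -> R) : Prop :=
  Lq_loc 1 T u /\
  exists ut : R -> R -> 'rV[R]_n -> R, [/\ Lq_loc p T ut, weak_dt T u ut &
    forall phi, test_function T phi ->
      (integral_time_Omega T (fun t r w => `|ut t r w| `^ p * phi t r w)%R +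
       eps%:E * integral_Omega (fun r w =>
         (u1 r w * phi 0 r w - u0 r w * derive1 (fun t => phi t r w) 0) / F_S r
         + D r * u0 r w * phi 0 r w)%R =
       integral_time_Omega T (fun t r w => u t r w *
         (derive1n 2 (fun x => phi x r w) t / F_S r - laplace_gS (phi t) r w
          - D r * derive1 (fun x => phi x r w) t + V r * phi t r w))%R)%E].

(* The weak solution on (0, T) is radial, u(t, x) = U(t, |x|), with
   supp u(t, .) included in {|s| <= t + R0} for 0 < t < T. *)
Definition radial_solution (p : R) (D V u0 u1 : R -> R) (R0 eps T : R)
    (U : R -> R -> R) : Prop :=
  weak_solution p D V (fun r _ => u0 r) (fun r _ => u1 r) eps T
    (fun t r _ => U t r) /\
  forall t r, 0 < t < T -> 2 * M < r -> U t r != 0 ->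
    `|tortoise r| <= t + R0.

Definition lifespan (p : R) (D V u0 u1 : R -> R) (R0 eps : R) : \bar R :=
  ereal_sup [set T%:E | T in
    [set T | 0 < T /\ exists U, radial_solution p D V u0 u1 R0 eps T U]].

(* The potential Q, as a function of the tortoise coordinate. *)
Definition Qpot (V : R -> R) (s : R) : R :=
  let r := radius_of s in
  F_S r * V r
  + (n%:R ^+ 2 - 4 * n%:R + 3) * F_S r ^+ 2 / (4 * r ^+ 2)
  + (n%:R - 1) * M * F_S r / r ^+ 3.

Definition eigenfunction (D V : R -> R) (lam : R) (phi : R -> R) : Prop :=
  [/\ (forall s, derivable phi s 1 /\ derivable (derive1 phi) s 1),
      continuous (derive1n 2 phi),
      forall s, let r := radius_of s in
        derive1n 2 phi s = Qpot V s * phi s + lam * D r * F_S r * phi s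
                     + lam ^+ 2 * phi s &
      exists c1 c2 : R, [/\ 0 < c1, c1 <= c2 &
        forall s, c1 * expR (lam * s) <= phi s <= c2 * expR (lam * s)]].

Definition data_integral (D V u0 u1 : R -> R) (lam : R) (phi : R -> R) : \bar R :=
  (\int[mu]_s (let r := radius_of s in
    phi s * (u1 r * r `^ ((n%:R - 1) / 2)
      + (lam * D r * F_S r + lam ^+ 2 - Qpot V s)
        * (u0 r * r `^ ((n%:R - 1) / 2))))%:E)%E.

(* Hypotheses on the profile f of radial data; a radial function on Omega is
   locally integrable, or a.e. zero, iff its profile is so on (2M, +oo). *)
Definition radial_datum (R0 : R) (f : R -> R) : Prop :=
  [/\ locally_integrable [set` `]2 * M, +oo[%R] f,
      forall r, 2 * M < r -> 0 <= f r,
      ~ {ae mu, forall r, 2 * M < r -> f r = 0} &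
      forall r, 2 * M < r -> f r != 0 -> `|tortoise r| <= R0].

End schwarzschild.

(* Main.v *)
Require Import Defs.
From HB Require Import structures.
From mathcomp Require Import all_boot all_order all_algebra.
From mathcomp Require Import all_classical all_reals all_analysis.
From mathcomp Require Import measurable_realfun ring lra.

Set Implicit Arguments.
Unset Strict Implicit.
Unset Printing Implicit Defensive.

Import Order.TTheory GRing.Theory Num.Theory.
Import numFieldNormedType.Exports.

Local Open Scope classical_set_scope.
Local Open Scope ring_scope.


(** The solution is tested against an explicit solution of the adjoint linear
    problem, and the nonlinearity forces a contradiction unless time is bounded.

    Write k = (n-1)/2, s for the tortoise coordinate, and
    b(r) = r^(-k) phi(s) ([profile]). The ordinary differential equation for
    phi says exactly that
      Delta b = b (V + lam D + lam^2 / F)      ([radial_laplacian_profile]),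
    where lam = lam0. The weak formulation is applied to eta(t) b(r), with
    eta = e^(-lam t) chi(t) and chi a decreasing convex cutoff with chi(0) = 1
    that vanishes from a time T' < T on. As u lives in the cone |s| <= t + R0,
    this function may be localized near the cone ([lightcut]) and becomes
    admissible. With th = e^(-lam t) chi' the coefficient of u is
    (th' - lam th) b / F - D th b. Let Th be the primitive of th that vanishes
    at T'. All three coefficients are time derivatives, and integration by
    parts in time turns the integral of u into one of u_t ([energy_identity]):
      int |u_t|^p eta b + eps (data)
        = int u_t (- th + lam Th + Th D F) b / F.
    The data term contains chi(0) int u_1 b / F > 0, and its remaining part, which
    involves u_0, is nonnegative. Convexity of chi gives 0 <= lam Th <= - th, so
    the right side is at most a constant times int |u_t| |th| b / F.

    Integration by parts in time is the delicate point, for the weak formulation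
    only mentions u_t as a distribution on the open time interval; the initial
    value of u is recovered from the equation by testing with functions
    concentrated near t = 0 ([trace_identity]).

    It remains to choose chi. Put kap = k (p - 1), which is at most 1 precisely
    when p <= p_G, let ell' = (1 + t)^(-kap) with ell(0) = 0, and
    L = ell(T'). For chi a high power of 1 - ell / L ([cutoff]), Young's
    inequality ([weighted_young]) absorbs the right side into the nonlinear
    term, up to
      C int_0^T' (ell' / L)^(p/(p-1)) e^(-lam t)
          int b F^(-p/(p-1)) r^(n-1) dr dt,
    the inner integral being over the cone. The factor e^(-lam t) phi(s) is
    concentrated near s = t, so the inner integral, with its exponential
    factor, is at most C (1 + t)^k; near the horizon the singularity of
    F^(-p/(p-1)) is compensated by the decay of e^(lam s), since lam0 is large
    ([spatial_bound], [integral_majorant]). By the choice of kap one has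
    (ell')^(p/(p-1)) (1 + t)^k = ell', and the remainder is at most
    C L^(-1/(p-1)). Thus
      ell(T') <= C eps^(-(p-1))      for all T' < T    ([core_estimate]).
    For kap < 1 the function ell is a power of 1 + t and for kap = 1 it is
    ln (1 + t); these give the two bounds on the lifespan. *)

(** * Functions of class C^k *)

Section Ck.
Context {R : realType}.

(** The shape of [C2_on], with all iterated directional derivatives and an
    arbitrary order: in this form closure under sums, products and composition
    is an induction on k, and membership is proved from closed formulas. *)
Fixpoint Ck (V : normedModType R) (k : nat) (U : set V) (f : V -> R) : Prop :=
  (forall x, U x -> {for x, continuous f}) /\
  if k is k'.+1 then
    forall v, (forall x, U x -> derivable f x v) /\ Ck k' U ('D_v f)
  else True.

Section general.
Context {V : normedModType R}.
Implicit Types (U W : set V) (f g : V -> R).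

Lemma Ck_continuous k U f x : Ck k U f -> U x -> {for x, continuous f}.
Proof. by case: k => [|k] [cf _]; exact: cf. Qed.

Lemma Ck_sub k U W f : U `<=` W -> Ck k W f -> Ck k U f.
Proof.
move=> UW; elim: k f => [|k IH] f [cf df]; split=> //; try by move=> x /UW/cf.
by move=> v; have [dfv Df] := df v; split; [move=> x /UW/dfv | exact: IH].
Qed.

Lemma Ck_le j k U f : (j <= k)%N -> Ck k U f -> Ck j U f.
Proof.
elim: j k f => [|j IH] [|k] f //; first by move=> _ [cf _].
rewrite ltnS => jk [cf df]; split=> // v; have [dfv Df] := df v; split=> //.
exact: IH Df.
Qed.

Lemma Ck_eq k U f g : open U -> (forall x, U x -> f x = g x) ->
  Ck k U f -> Ck k U g.
Proof.
move=> oU; elim: k f g => [|k IH] f g fg [cf df].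
  split=> // x Ux; have := cf x Ux.
  rewrite /prop_for /continuous_at -(fg _ Ux); apply: cvg_trans.
  apply: near_eq_cvg; near=> y; apply/fg; near: y.
  exact: open_nbhs_nbhs.
have nfg x : U x -> \near x, f x = g x.
  by move=> Ux; near=> y; apply: fg; near: y; exact: open_nbhs_nbhs.
split=> [x Ux|v].
  have := cf x Ux.
  rewrite /prop_for /continuous_at -(fg _ Ux); apply: cvg_trans.
  apply: near_eq_cvg; exact: nfg.
have [dfv Df] := df v; split=> [x Ux|].
  exact: near_eq_derivable (nfg _ Ux) (dfv _ Ux).
by apply: (IH ('D_v f)) => // x Ux; exact/near_eq_derive/nfg.
Unshelve. all: by end_near. Qed.

Lemma Ck_cst k U (c : R) : Ck k U (cst c).
Proof.
elim: k c => [|k IH] c; split=> //; try by move=> x _; exact: cvg_cst.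
move=> v; split=> [x _|]; first exact: derivable_cst.
rewrite (_ : 'D_v (cst c) = cst 0); first exact: IH.
by apply/funext => x; rewrite derive_cst.
Qed.

Lemma CkD k U f g : open U -> Ck k U f -> Ck k U g ->
  Ck k U (fun x => f x + g x).
Proof.
move=> oU; elim: k f g => [|k IH] f g [cf df] [cg dg].
  by split=> // x Ux; apply: continuousD; [exact: cf|exact: cg].
split=> [x Ux|v]; first by apply: continuousD; [exact: cf|exact: cg].
have [dfv Df] := df v; have [dgv Dg] := dg v; split=> [x Ux|].
  by apply: derivableD; [exact: dfv|exact: dgv].
apply: (Ck_eq oU _ (IH _ _ Df Dg)) => x Ux.
by rewrite -deriveD//; [exact: dfv|exact: dgv].
Qed.

Lemma CkM k U f g : open U -> Ck k U f -> Ck k U g ->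
  Ck k U (fun x => f x * g x).
Proof.
move=> oU; elim: k f g => [|k IH] f g Hf Hg.
  case: Hf Hg => cf _ [cg _].
  by split=> // x Ux; apply: continuousM; [exact: cf|exact: cg].
have f' := Ck_le (leqnSn k) Hf; have g' := Ck_le (leqnSn k) Hg.
case: Hf Hg => cf df [cg dg].
split=> [x Ux|v]; first by apply: continuousM; [exact: cf|exact: cg].
have [dfv Df] := df v; have [dgv Dg] := dg v; split=> [x Ux|].
  by apply: derivableM; [exact: dfv|exact: dgv].
have := CkD oU (IH _ _ f' Dg) (IH _ _ g' Df).
apply: Ck_eq => // x Ux.
by rewrite deriveM//; [exact: dfv|exact: dgv].
Qed.

Lemma CkN k U f : open U -> Ck k U f -> Ck k U (fun x => - f x).
Proof.
move=> oU Hf; have := CkM oU (Ck_cst k U (-1)) Hf.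
by apply: Ck_eq => // x _; rewrite mulN1r.
Qed.

(** A directional derivative is the derivative at 0 of the restriction to a
    line, which reduces the chain rule below to the one-variable one. *)
Lemma is_derive_line f x v df :
  is_derive x v f df <-> is_derive (0 : R) 1 (fun h : R => f (h *: v + x)) df.
Proof.
have eqD : 'D_v f x = 'D_1 (fun h : R => f (h *: v + x)) 0.
  rewrite /derive; set g1 := fun h => h^-1 *: _; set g2 := fun h => h^-1 *: _.
  suff -> : g1 = g2 by [].
  by apply/funext => h; rewrite /g1 /g2 /= addr0 scale0r add0r [_%:A]mulr1.
split=> -[H <-]; apply: DeriveDef; rewrite ?eqD//. 
  exact: ((derivable1P f x v).1 H).
exact: ((derivable1P f x v).2 H).
Qed.

Lemma is_derive_comp1 (G : R -> R) f x v dG df :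
  is_derive (f x) 1 G dG -> is_derive x v f df ->
  is_derive x v (fun y => G (f y)) (dG * df).
Proof.
move=> HG /is_derive_line Hf; apply/is_derive_line.
pose f1 (h : R) := f (h *: v + x).
change (is_derive (0 : R) 1 (G \o f1) (dG * df)).
apply: is_derive1_comp.
by rewrite /f1 scale0r add0r.
Qed.

Lemma Ck_comp k U (W : set R) (G : R -> R) f : open U -> open W ->
  (forall x, U x -> W (f x)) -> Ck k W G -> Ck k U f ->
  Ck k U (fun x => G (f x)).
Proof.
move=> oU oW UW; elim: k f G UW => [|k IH] f G UW HG Hf.
  case: HG Hf => cG _ [cf _]; split=> // x Ux.
  by apply: continuous_comp; [exact: cf|exact/cG/UW].
have f' := Ck_le (leqnSn k) Hf.
case: HG Hf => cG dG [cf df].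
have dGf x v : U x -> is_derive x v (fun y => G (f y)) ('D_1 G (f x) * 'D_v f x).
  move=> Ux; apply: is_derive_comp1.
    by apply/derivableP/(dG 1).1/UW.
  by apply/derivableP/(df v).1.
split=> [x Ux|v].
  by apply: continuous_comp; [exact: cf|exact/cG/UW].
split=> [x Ux|]; first by have [] := dGf x v Ux.
have := CkM oU (IH f _ UW (dG 1).2 f') (df v).2.
apply: Ck_eq => // x Ux.
by have [_ <-] := dGf x v Ux.
Qed.

End general.

(** On the line a single derivative determines all directional ones, so C^k
    regularity propagates from a derivative to its primitive. *)
Lemma Ck_deriv k (U : set R) (f g : R -> R) : open U ->
  (forall x, U x -> is_derive x 1 f (g x)) -> Ck k U g -> Ck k.+1 U f.
Proof.
move=> oU fg Hg; split=> [x Ux|v].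
  apply: differentiable_continuous; apply/derivable1_diffP.
  by have [] := fg x Ux.
have dfv x : U x -> is_derive x v f (v * g x).
  move=> Ux; apply/is_derive_line.
  pose f1 (h : R) := h *: v + x.
  change (is_derive (0 : R) 1 (f \o f1) (v * g x)).
  rewrite mulrC; apply: is_derive1_comp.
    by rewrite /f1 scale0r add0r; exact: fg.
  rewrite /f1; apply: is_derive_eq; rewrite addr0 /cst scaler0 add0r.
  by rewrite [_%:A]mulr1.
split=> [x /dfv[]//|].
have := CkM oU (Ck_cst k U v) Hg; apply: Ck_eq => // x /dfv[_ <-//].
Qed.

Lemma Ck_is_derive k (U : set R) (f : R -> R) x : Ck k.+1 U f -> U x ->
  is_derive x 1 f ('D_1 f x).
Proof. by move=> [_ /(_ 1)[df _]] Ux; exact/derivableP/df. Qed.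

Lemma Ck_D1 k (U : set R) (f : R -> R) : Ck k.+1 U f -> Ck k U ('D_1 f).
Proof. by move=> [_ /(_ 1)[]]. Qed.

Lemma Ck_id k (U : set R) : open U -> Ck k U id.
Proof.
case: k => [|k] oU; first by split=> // x _; exact: cvg_id.
by apply: (@Ck_deriv k U id (cst 1)) => //; exact: Ck_cst.
Qed.

Lemma Ck_expR k (U : set R) : open U -> Ck k U expR.
Proof.
move=> oU; elim: k => [|k IH]; first by split=> // x _; exact: continuous_expR.
exact: Ck_deriv IH.
Qed.

Lemma Ck_powR k (a : R) : Ck k [set x : R | 0 < x] (fun x : R => x `^ a).
Proof.
have o0 : open [set x : R | 0 < x] by exact: open_gt.
elim: k a => [|k IH] a.
  split=> // x /= x0; apply: differentiable_continuous; apply/derivable1_diffP.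
  by have [] : is_derive x 1 (fun x : R => x `^ a) (a * x `^ (a - 1)) by exact: is_derive1_powR.
apply: (@Ck_deriv k _ _ (fun x => a * x `^ (a - 1))) => //.
  by apply: CkM => //; exact: Ck_cst.
Qed.

Lemma Ck_inv k : Ck k [set x : R | 0 < x] GRing.inv.
Proof.
have := @Ck_powR k (-1); apply: Ck_eq; first exact: open_gt.
by move=> x /= x0; rewrite powR_inv1// ltW.
Qed.

Lemma Ck_ln k : Ck k [set x : R | 0 < x] (@ln R).
Proof.
have o0 : open [set x : R | 0 < x] by exact: open_gt.
case: k => [|k].
  split=> // x /= x0; exact: continuous_ln.
by apply: (@Ck_deriv k _ _ (fun x => x^-1)) => //; exact: Ck_inv.
Qed.

Lemma CkX k (V : normedModType R) (U : set V) (f : V -> R) j : open U ->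
  Ck k U f -> Ck k U (fun x => f x ^+ j).
Proof.
move=> oU Hf; elim: j => [|j IH]; first exact: Ck_cst.
have := CkM oU Hf IH; apply: Ck_eq => // x _; by rewrite exprS.
Qed.

(** The positive part of x to the power j, of class C^(j-1): a flat function
    which is enough for all cutoffs, since only finitely many derivatives
    matter. *)
Definition tpow (j : nat) (x : R) : R := Num.max x 0 ^+ j.

Lemma tpow_ge0 j x : 0 <= tpow j x.
Proof. by rewrite exprn_ge0// le_max lexx orbT. Qed.

Lemma tpow_gt0 j x : 0 < x -> 0 < tpow j x.
Proof. by move=> x0; rewrite exprn_gt0// lt_max x0. Qed.

Lemma tpow_le0 j x : x <= 0 -> tpow j.+1 x = 0.
Proof. by move=> x0; rewrite /tpow max_r// expr0n. Qed.

Lemma tpowE j x : 0 <= x -> tpow j x = x ^+ j.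
Proof. by move=> x0; rewrite /tpow max_l. Qed.

Lemma is_derive_tpow j (x : R) :
  is_derive x 1 (tpow j.+2) (j.+2%:R * tpow j.+1 x).
Proof.
have [x0|x0|->] := ltgtP x 0.
- apply: (@near_eq_is_derive _ _ _ (cst 0)).
    near=> y; rewrite tpow_le0//; apply/ltW; near: y; exact: lt_nbhsl.
  by rewrite tpow_le0 ?ltW// mulr0; exact: is_derive_cst.
- have D : is_derive x 1 ((id : R -> R) ^+ j.+2) (j.+2%:R * tpow j.+1 x).
    apply: is_derive_eq; rewrite tpowE ?ltW//= [_ *: 1]mulr1.
    by rewrite -mulr_natl.
  apply: near_eq_is_derive D.
  near=> y; have y0 : 0 < y by near: y; exact: lt_nbhsr.
  by rewrite tpowE ?(ltW y0)// exprfctE.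
- rewrite tpow_le0// mulr0.
  have H : (fun h => h^-1 *: ((tpow j.+2 \o shift 0) (h *: 1) - tpow j.+2 0)) @ 0^'
      --> (0 : R).
    apply/cvgrPdist_lt => e e0; near=> h.
    rewrite /= addr0 [h *: 1]mulr1 (tpow_le0 _ (lexx 0)) subr0 sub0r normrN.
    have h1 : `|h| <= 1.
      near: h; apply: dnbhs0_le; exact: ltr01.
    have h0 : h != 0 by near: h; exact: nbhs_dnbhs_neq.
    have he : `|h| < e by near: h; exact: dnbhs0_lt.
    rewrite normrM normfV ltr_pdivrMl ?normr_gt0//.
    have [hle|hge] := leP h 0.
      by rewrite tpow_le0// normr0 mulr_gt0// normr_gt0.
    rewrite tpowE ?ltW// normrX !exprS.
    rewrite ltr_pM2l ?normr_gt0//; apply: le_lt_trans he.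
    by rewrite ler_piMr// exprn_ile1.
  split; first by apply/cvg_ex; exists 0.
  by apply/cvg_lim.
Unshelve. all: by end_near. Qed.

Lemma Ck_tpow k j (U : set R) : open U -> Ck k U (tpow (k + j).+1).
Proof.
move=> oU; elim: k => [|k IH].
  apply: CkX => //; split=> // x _.
  by apply: continuous_max; [exact: cvg_id|exact: cvg_cst].
rewrite addSn; apply: (Ck_deriv oU (fun x _ => is_derive_tpow _ x)).
by apply: CkM => //; exact: Ck_cst.
Qed.

Lemma Ck_linear (V : normedModType R) k (U : set V) (f : V -> R) : open U ->
  continuous f -> (forall (h : R) v x, f (h *: v + x) = h * f v + f x) ->
  Ck k U f.
Proof.
move=> oU cf lf; case: k => [|k]; first by split=> // x _; exact: cf.
have df x v : is_derive x v f (f v).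
  apply/is_derive_line.
  rewrite (_ : (fun h => _) = (fun h : R => h * f v + f x)); last first.
    by apply/funext => h; rewrite lf.
  by apply: is_derive_eq; rewrite /= scaler0 !add0r addr0 [_ *: 1]mulr1.
split=> [x _|v]; first exact: cf.
split=> [x _|]; first by have [] := df x v.
have := Ck_cst k U (f v); apply: Ck_eq => // x _.
by have [_ <-] := df x v.
Qed.

Lemma Ck_C2_on (V : normedModType R) (U : set V) (f : V -> R) :
  Ck 2 U f -> C2_on U f.
Proof.
move=> [cf df] x Ux; split=> [|v]; first exact: cf.
have [dfv [cDf dDf]] := df v; split=> [||w]; [exact: dfv|exact: cDf|].
have [dDfw [cDDf _]] := dDf w; split; [exact: dDfw|exact: cDDf].
Qed.

Lemma Ck0_continuous (f : R -> R) (U : set R) : continuous f -> Ck 0 U f.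
Proof. by move=> cf; split=> // x _; exact: cf. Qed.

End Ck.

Global Opaque Ck.

Section derivation_rules.
Context {R : realType}.
Implicit Types (f g : R -> R) (x c : R).

Lemma derC x c : is_derive x 1 (fun _ : R => c) 0.
Proof. exact: is_derive_cst. Qed.

Lemma derI x : is_derive x 1 (fun y : R => y) 1.
Proof. exact: is_derive_id. Qed.

Lemma derD x f g df dg : is_derive x 1 f df -> is_derive x 1 g dg ->
  is_derive x 1 (fun y => f y + g y) (df + dg).
Proof. exact: is_deriveD. Qed.

Lemma derN x f df : is_derive x 1 f df -> is_derive x 1 (fun y => - f y) (- df).
Proof. exact: is_deriveN. Qed.

Lemma derM x f g df dg : is_derive x 1 f df -> is_derive x 1 g dg ->
  is_derive x 1 (fun y => f y * g y) (df * g x + f x * dg).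
Proof.
move=> Df Dg; apply: is_derive_eq (is_deriveM Df Dg) _.
by rewrite /GRing.scale/= addrC; congr (_ + _); exact: mulrC.
Qed.

Lemma derComp x f g df dg : is_derive (g x) 1 f df -> is_derive x 1 g dg ->
  is_derive x 1 (fun y => f (g y)) (df * dg).
Proof. exact: is_derive_comp1. Qed.

Lemma derE x f df : is_derive x 1 f df -> f^`()%classic x = df.
Proof. by move=> [_ <-]; rewrite derive1E. Qed.

Lemma derD1 x f df : is_derive x 1 f df -> 'D_1 f x = df.
Proof. by case. Qed.

Lemma der_near x f g df : (\near x, f x = g x) -> is_derive x 1 g df ->
  is_derive x 1 f df.
Proof.
move=> fg; apply: near_eq_is_derive.
by near=> y; apply/esym; near: y.
Unshelve. all: by end_near. Qed.

Lemma der_continuous x f df : is_derive x 1 f df -> {for x, continuous f}.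
Proof.
by move=> [d _]; apply: differentiable_continuous; exact/derivable1_diffP.
Qed.

End derivation_rules.

Section Ck_product.
Context {R : realType} {n : nat}.
Local Notation X := (R * R * 'rV[R]_n)%type.

Lemma Ck_time k (U : set X) : open U -> Ck k U (fun z : X => z.1.1).
Proof.
move=> oU; apply: Ck_linear => // z.
by apply: continuous_comp; exact: cvg_fst.
Qed.

Lemma Ck_radius k (U : set X) : open U -> Ck k U (fun z : X => z.1.2).
Proof.
move=> oU; apply: Ck_linear => // z.
by apply: continuous_comp; [exact: cvg_fst|exact: cvg_snd].
Qed.

End Ck_product.

(** * Cutoffs and antiderivatives *)

Section cutoff.
Context {R : realType}.

(** [step] is 1 on x <= 1, 0 on x >= 2, and of class C^3: the quotient
    a / (a + b) of two truncated powers that never vanish together. *)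
Definition step_den (x : R) : R := tpow 4 (x - 1) + tpow 4 (2 - x).
Definition step (x : R) : R := tpow 4 (2 - x) / step_den x.

Let den_gt0 x : 0 < step_den x.
Proof.
rewrite /step_den; have [x1|x1] := ltP 1 x.
  by rewrite ltr_pwDl ?tpow_ge0// tpow_gt0 ?subr_gt0.
rewrite ltr_wpDl ?tpow_ge0// tpow_gt0// subr_gt0; lra.
Qed.

Lemma step_le1 x : x <= 1 -> step x = 1.
Proof.
move=> x1; rewrite /step; have := den_gt0 x.
rewrite /step_den [X in X + _]tpow_le0 ?subr_le0// add0r => H.
by rewrite divff// gt_eqF.
Qed.

Lemma step_ge2 x : 2 <= x -> step x = 0.
Proof. by move=> x2; rewrite /step tpow_le0 ?subr_le0// mul0r. Qed.

Lemma step_ge0 x : 0 <= step x.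
Proof. by rewrite divr_ge0 ?tpow_ge0// ltW. Qed.

Lemma step_le x : step x <= 1.
Proof. by rewrite ler_pdivrMr// mul1r lerDr tpow_ge0. Qed.

Lemma Ck_step : Ck 3 [set: R] step.
Proof.
have oT : open [set: R] by exact: openT.
have o0 : open [set x : R | 0 < x] by exact: open_gt.
have T4 : Ck 3 [set: R] (tpow 4) := Ck_tpow 3 0 oT.
have cst_id (c : R) : Ck 3 [set: R] (fun x : R => c - x).
  exact: (CkD oT (Ck_cst 3 setT c) (CkN oT (Ck_id 3 oT))).
have id_cst (c : R) : Ck 3 [set: R] (fun x : R => x - c).
  exact: (CkD oT (Ck_id 3 oT) (Ck_cst 3 setT (- c))).
have A := Ck_comp oT oT (fun _ _ => I) T4 (cst_id 2).
have B := Ck_comp oT oT (fun _ _ => I) T4 (id_cst 1).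
exact: (CkM oT A (Ck_comp oT o0 (fun x _ => den_gt0 x) (Ck_inv 3) (CkD oT B A))).
Qed.

End cutoff.

Section antiderivative.
Context {R : realType}.
Local Notation mu := (@lebesgue_measure R).

Lemma antiderivative (g : R -> R) (a : R) : continuous g ->
  forall x, a < x ->
    is_derive x 1 (fun y => \int[mu]_(t in `[a, y]) g t)%R (g x).
Proof.
move=> cg x ax.
have ig : mu.-integrable `[a, x + 1] (EFin \o g).
  apply: continuous_compact_integrable; first exact: segment_compact.
  exact: continuous_subspaceT.
have [] := @continuous_FTC1 R g (BLeft a) x (x + 1) _ ig _ (cg x).
- by rewrite ltrDl.
- exact: ax.
- by move=> d; rewrite derive1E => <-; exact/derivableP.
Qed.

End antiderivative.

(** * The tortoise coordinate *)

Section tortoise.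
Context {R : realType} (M : R).
Hypothesis M0 : 0 < M.

Lemma radius_gt0 (r : R) : 2 * M < r -> 0 < r.
Proof. by apply: lt_trans; rewrite mulr_gt0. Qed.

Lemma F_S_gt0 (r : R) : 2 * M < r -> 0 < F_S M r.
Proof.
by move=> r2; rewrite /F_S subr_gt0 ltr_pdivrMr ?mul1r ?radius_gt0.
Qed.

Lemma F_S_le1 (r : R) : 2 * M < r -> F_S M r <= 1.
Proof.
move=> r2; rewrite /F_S lerBlDr lerDl divr_ge0 ?mulr_ge0 ?ltW//.
exact: radius_gt0.
Qed.

Lemma F_SE (r : R) : 2 * M < r -> F_S M r = (r - 2 * M) / r.
Proof.
by move=> r2; rewrite /F_S mulrBl divff// gt_eqF// radius_gt0.
Qed.

Let oM : open [set r : R | 2 * M < r]. Proof. exact: open_gt. Qed.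
Let o0 : open [set r : R | 0 < r]. Proof. exact: open_gt. Qed.

Lemma Ck_r_pow k a : Ck k [set r : R | 2 * M < r] (fun r => r `^ a).
Proof. exact: (Ck_sub radius_gt0 (Ck_powR k a)). Qed.

Lemma Ck_F_S k : Ck k [set r : R | 2 * M < r] (F_S M).
Proof.
exact: (CkD oM (Ck_cst k _ 1) (CkN oM (CkM oM (Ck_cst k _ (2 * M))
  (Ck_sub radius_gt0 (Ck_inv k))))).
Qed.

Lemma Ck_F_S_inv k : Ck k [set r : R | 2 * M < r] (fun r => (F_S M r)^-1).
Proof.
have := @Ck_comp R R k _ _ _ (F_S M) oM o0 F_S_gt0 (Ck_inv k) (Ck_F_S k). exact.
Qed.

Lemma Ck_tortoise k : Ck k [set r : R | 2 * M < r] (tortoise M).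
Proof.
have pos (r : R) : 2 * M < r -> 0 < r - 2 * M by rewrite subr_gt0.
have shift : Ck k [set r : R | 2 * M < r] (fun r => r - 2 * M).
  exact: (CkD oM (Ck_id k oM) (Ck_cst k _ (- (2 * M)))).
exact: (CkD oM (Ck_id k oM) (CkM oM (Ck_cst k _ (2 * M))
  (Ck_comp oM o0 pos (Ck_ln k) shift))).
Qed.

Lemma is_derive_tortoise (r : R) : 2 * M < r ->
  is_derive r 1 (tortoise M) (F_S M r)^-1.
Proof.
move=> r2; have r2' : 0 < r - 2 * M by rewrite subr_gt0.
have r0 := radius_gt0 r2.
have L := @derComp R r (@ln R) (fun r => r - 2 * M) _ _
  (is_derive1_ln r2') (derD (derI r) (derC r (- (2 * M)))).
apply: is_derive_eq (derD (derI r) (derM (derC r (2 * M)) L)) _.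
rewrite F_SE//; by field; rewrite !gt_eqF.
Qed.

Lemma tortoise_lt (r r' : R) : 2 * M < r -> r < r' ->
  tortoise M r < tortoise M r'.
Proof.
move=> r2 rr'; rewrite /tortoise ltrD// ltr_pM2l ?mulr_gt0//.
by rewrite ltr_ln ?posrE ?subr_gt0 ?ltrD2r//; apply: lt_trans rr'.
Qed.

Lemma radius_ofK (r : R) : 2 * M < r -> radius_of M (tortoise M r) = r.
Proof.
move=> r2; rewrite /radius_of; set A := [set _ | _].
have : A (get A) by apply: (@getI _ _ r); split.
move=> [g2 ge]; have [gr|gr|//] := ltgtP (get A) r.
- by have := tortoise_lt g2 gr; rewrite ge ltxx.
- by have := tortoise_lt r2 gr; rewrite ge ltxx.
Qed.

(** Boundedness of the tortoise coordinate keeps r away from the horizon and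
    from infinity, so the light cone up to a finite time is compact in
    space. *)
Lemma tortoise_window (S : R) : exists a b, [/\ 2 * M < a, a < b &
  forall r, 2 * M < r -> `|tortoise M r| <= S -> a <= r <= b].
Proof.
have M2 : 0 < 2 * M by rewrite mulr_gt0.
pose b := Num.max S (2 * M + 2).
pose e := expR ((- S - b) / (2 * M)).
exists (Num.min (2 * M + e) (2 * M + 1)), b; split.
- by rewrite lt_min !ltrDl expR_gt0 ltr01.
- by rewrite gt_min; apply/orP; right; rewrite lt_max; apply/orP; right; lra.
- move=> r r2; rewrite ler_norml => /andP[sl sr].
  have r2' : 0 < r - 2 * M by rewrite subr_gt0.
  have rb : r <= b.
    rewrite /b le_max; apply/orP.
    have [rM|rM] := leP r (2 * M + 2); [by right|left].
    apply: (le_trans _ sr); rewrite /tortoise lerDl mulr_ge0 ?(ltW M2)//.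
    rewrite ln_ge0//; lra.
  rewrite rb andbT ge_min; apply/orP; left.
  rewrite -lerBrDl /e -[leRHS]lnK ?posrE// ler_expR.
  rewrite ler_pdivrMr// lerBlDr mulrC; move: sl; rewrite /tortoise; lra.
Qed.

End tortoise.

Section derivative_sign.
Context {R : realType}.

Lemma derive_le0_le (f df : R -> R) (x y : R) : x <= y ->
  (forall z, x <= z <= y -> is_derive z 1 f (df z)) ->
  (forall z, x < z < y -> df z <= 0) -> f y <= f x.
Proof.
rewrite le_eqVlt => /predU1P[->//|xy] dff df0.
have [||c] := @MVT R f df x y xy.
- move=> z; rewrite in_itv/= => /andP[? ?]; apply: dff; rewrite !ltW//.
- apply: derivable_within_continuous => z; rewrite in_itv/= => /dff.
  by case.
rewrite in_itv/= => xcy H; rewrite -subr_le0 H.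
by rewrite mulr_le0_ge0 ?df0// subr_ge0 ltW.
Qed.

End derivative_sign.

(** * Test functions adapted to the light cone *)

Section test_functions.
Context {R : realType} (n : nat) (M R0 : R).
Hypothesis M0 : 0 < M.
Local Notation X := (R * R * 'rV[R]_n)%type.

(** Equal to 1 on a neighbourhood of the region |s| <= t + R0 that contains
    the support of u, and 0 once |s| >= t + R0 + 2. Multiplication by it makes
    a test function compactly supported in space without changing, where u is
    nonzero, its value or any of its derivatives. *)
Definition lightcut (t r : R) : R :=
  step (tortoise M r - t - R0) * step (- tortoise M r - t - R0).

Lemma lightcut_ge0 t r : 0 <= lightcut t r.
Proof. by rewrite mulr_ge0 ?step_ge0. Qed.

Lemma lightcut_le1 t r : lightcut t r <= 1.
Proof. by rewrite mulr_ile1 ?step_ge0 ?step_le. Qed.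

Lemma lightcut_supp t r : lightcut t r != 0 -> `|tortoise M r| <= t + R0 + 2.
Proof.
move=> H; rewrite ler_norml; apply/andP; split.
  rewrite leNgt; apply: contra H => H.
  by rewrite /lightcut [X in _ * X]step_ge2 ?mulr0//; lra.
rewrite leNgt; apply: contra H => H.
by rewrite /lightcut step_ge2 ?mul0r//; lra.
Qed.

Lemma lightcut1 t r : `|tortoise M r| <= t + R0 + 1 -> lightcut t r = 1.
Proof.
by rewrite ler_norml => /andP[? ?]; rewrite /lightcut !step_le1 ?mulr1//; lra.
Qed.

Lemma lightcut1_near_time t r : `|tortoise M r| <= t + R0 ->
  \forall t' \near t, lightcut t' r = 1.
Proof.
move=> H; near=> t'; apply: lightcut1.
have : t - 1 < t' by near: t'; apply: lt_nbhsr; rewrite ltrBlDr ltrDl.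
by move=> ?; apply: (le_trans H); lra.
Unshelve. all: by end_near. Qed.

Lemma lightcut1_near_radius t r : 2 * M < r -> `|tortoise M r| <= t + R0 ->
  \forall r' \near r, lightcut t r' = 1.
Proof.
move=> r2 H; have := der_continuous (is_derive_tortoise M0 r2).
move=> /cvgrPdist_le/(_ 1 ltr01) C; near=> r'; apply: lightcut1.
have C' : `|tortoise M r - tortoise M r'| <= 1 by near: r'; exact: C.
move: H C'; rewrite !ler_norml => /andP[? ?] /andP[? ?]; apply/andP; split; lra.
Unshelve. all: by end_near. Qed.

Let ogt (a : R) : open [set x : R | a < x]. Proof. exact: open_gt. Qed.

Let O2 : set X := [set z | 2 * M < z.1.2].

Let oO2 : open O2.
Proof.
have c2 : continuous (fun z : X => z.1.2).
  by move=> z; apply: continuous_comp; [exact: cvg_fst|exact: cvg_snd].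
apply: (@open_comp X R (fun z => z.1.2) [set r | 2 * M < r]) => [z _|].
  exact: c2.
exact: open_gt.
Qed.

Lemma Ck_lightcut : Ck 3 O2 (fun z => lightcut z.1.1 z.1.2).
Proof.
have T := Ck_time 3 oO2.
have S : Ck 3 O2 (fun z => tortoise M z.1.2).
  have := @Ck_comp R X 3 O2 [set r | 2 * M < r] (tortoise M) (fun z => z.1.2)
    oO2 (@ogt _) (fun z h => h) (Ck_tortoise M 3) (Ck_radius 3 oO2).
  exact.
have R0c := Ck_cst 3 O2 (- R0).
have St := @Ck_step R.
have A := CkD oO2 (CkD oO2 S (CkN oO2 T)) R0c.
have B := CkD oO2 (CkD oO2 (CkN oO2 S) (CkN oO2 T)) R0c.
exact: (CkM oO2 (Ck_comp oO2 openT (fun _ _ => I) St A)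
  (Ck_comp oO2 openT (fun _ _ => I) St B)).
Qed.

Definition cone_test (eta c : R -> R) (t r : R) (_ : 'rV[R]_n) : R :=
  eta t * c r * lightcut t r.

Lemma cone_test_function (T T' d : R) (eta c : R -> R) :
  0 < T' < T -> 0 < d ->
  Ck 2 [set t | - d < t] eta -> Ck 2 [set r | 2 * M < r] c ->
  (forall t, T' <= t -> eta t = 0) ->
  test_function M T (cone_test eta c).
Proof.
move=> T'T d0 Heta Hc eta0; split; last first.
  have [a [b [a2 ab Hab]]] := tortoise_window M0 (T' + R0 + 2).
  exists T', a, b; split=> // t r w t0 r2 _; rewrite /cone_test => H.
  have tT' : t <= T'.
    by rewrite leNgt; apply: contra H => /ltW/eta0 ->; rewrite !mul0r.
  split=> //; apply: Hab => //.
  have /lightcut_supp : lightcut t r != 0.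
    by apply: contra H => /eqP ->; rewrite mulr0.
  by move/le_trans; apply; rewrite !lerD2r.
exists d => //.
pose O := [set z : X | - d < z.1.1 /\ 2 * M < z.1.2].
have oO : open O.
  have -> : O = [set z : X | - d < z.1.1] `&` O2 by [].
  apply: openI => //.
  have c1 : continuous (fun z : X => z.1.1).
    by move=> z; apply: continuous_comp; exact: cvg_fst.
  apply: (@open_comp X R (fun z => z.1.1) [set t | - d < t]) => [z _|].
    exact: c1.
  exact: open_gt.
have OO2 : O `<=` O2 by move=> z [].
have H1 : Ck 2 O (fun z => eta z.1.1).
  exact: (Ck_comp oO (@ogt _) (fun z (h : O z) => proj1 h) Heta (Ck_time 2 oO)).
have H2 : Ck 2 O (fun z => c z.1.2).
  exact: (Ck_comp oO (@ogt _) (fun z (h : O z) => proj2 h) Hc (Ck_radius 2 oO)).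
have H3 : Ck 2 O (fun z => lightcut z.1.1 z.1.2).
  exact: (Ck_sub OO2 (Ck_le (leqnSn 2) Ck_lightcut)).
apply: (@Ck_C2_on _ _ _ _ (Ck_sub _ (CkM oO (CkM oO H1 H2) H3))).
by move=> z [? ? _].
Qed.

Lemma cone_test_derive1 (d : R) (eta c : R -> R) t r w : - d < t ->
  Ck 2 [set t | - d < t] eta -> `|tortoise M r| <= t + R0 ->
  derive1 (fun x => cone_test eta c x r w) t = 'D_1 eta t * c r.
Proof.
move=> td Heta H; apply: derE.
apply: (@der_near R t _ (fun x => eta x * c r)).
  have := lightcut1_near_time H; apply: filterS => x Hx.
  by rewrite /cone_test Hx mulr1.
apply: is_derive_eq (derM (Ck_is_derive Heta td) (derC t (c r))) _.
by rewrite mulr0 addr0.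
Qed.

Lemma cone_test_derive2 (d : R) (eta c : R -> R) t r w : - d < t ->
  Ck 2 [set t | - d < t] eta -> `|tortoise M r| <= t + R0 ->
  derive1n 2 (fun x => cone_test eta c x r w) t = 'D_1 ('D_1 eta) t * c r.
Proof.
move=> td Heta H; apply: derE.
apply: (@der_near R t _ (fun x => 'D_1 eta x * c r)).
  have N1 := near_join (lightcut1_near_time H).
  near=> x; rewrite /=; apply: derE.
  have xd : - d < x by near: x; exact: lt_nbhsr.
  apply: (@der_near R x _ (fun x => eta x * c r)).
    have : \forall t' \near x, lightcut t' r = 1.
      by near: x; exact: N1.
    by apply: filterS => y Hy; rewrite /cone_test Hy mulr1.
  apply: is_derive_eq (derM (Ck_is_derive Heta xd) (derC x (c r))) _.
  by rewrite mulr0 addr0.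
apply: is_derive_eq (derM (Ck_is_derive (Ck_D1 Heta) td) (derC t (c r))) _.
by rewrite mulr0 addr0.
Unshelve. all: by end_near. Qed.

(** [laplace_gS] on functions of r alone. *)
Definition radial_laplacian (c : R -> R) (r : R) : R :=
  (r ^+ n.-1)^-1 * 'D_1 (fun x : R => x ^+ n.-1 * F_S M x * 'D_1 c x) r.

Lemma laplace_sphere_cst (a : R) (w : 'rV[R]_n) : laplace_sphere (fun _ => a) w = 0.
Proof.
rewrite /laplace_sphere big1// => i _.
rewrite (_ : (fun _ : 'rV[R]_n => a) \o direction = cst a)//.
rewrite (_ : 'D__ (cst a) = cst 0) ?derive_cst//.
by apply/funext => x; rewrite derive_cst.
Qed.

Lemma cone_test_laplacian (eta c : R -> R) t r w : 2 * M < r ->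
  Ck 2 [set r | 2 * M < r] c -> `|tortoise M r| <= t + R0 ->
  laplace_gS M (cone_test eta c t) r w = eta t * radial_laplacian c r.
Proof.
move=> r2 Hc H; rewrite /laplace_gS laplace_sphere_cst mulr0 addr0.
rewrite /radial_laplacian mulrCA; congr (_ * _).
have o2 : open [set r : R | 2 * M < r] by exact: open_gt.
have C1 : Ck 1 [set r | 2 * M < r] (fun x : R => x ^+ n.-1 * F_S M x * 'D_1 c x).
  exact: (CkM o2 (CkM o2 (CkX n.-1 o2 (Ck_id 1 o2)) (Ck_F_S M0 1)) (Ck_D1 Hc)).
apply: derE.
apply: (@der_near R r _ (fun x => eta t * (x ^+ n.-1 * F_S M x * 'D_1 c x))).
  have N1 := near_join (lightcut1_near_radius r2 H).
  near=> x; rewrite (mulrCA (eta t)); congr (_ * _).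
  have x2 : 2 * M < x by near: x; exact: lt_nbhsr.
  apply: derE; apply: (@der_near R x _ (fun x => eta t * c x)).
    have : \forall r' \near x, lightcut t r' = 1.
      by near: x; exact: N1.
    by apply: filterS => y Hy; rewrite /cone_test Hy mulr1.
  apply: is_derive_eq (derM (derC x (eta t)) (Ck_is_derive Hc x2)) _.
  by rewrite mul0r add0r.
apply: is_derive_eq (derM (derC r (eta t)) (Ck_is_derive C1 r2)) _.
by rewrite mul0r add0r.
Unshelve. all: by end_near. Qed.

End test_functions.

(** * The surface measure of the sphere is finite and nonzero *)

Section sphere_measure_finite.
Context {R : realType}.

Definition box n (a b : R) : set 'rV[R]_n := [set x | forall i, a <= x ord0 i <= b].

Lemma measurable_box n a b : measurable (@box n a b).
Proof.
have -> : @box n a b = \bigcap_(i in [set: 'I_n]) (@rV_coord R n i @^-1` `[a, b]).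
  apply/seteqP; split=> [x xb i _|x xb i]; rewrite /= ?in_itv/=; first exact: xb.
  by have := xb i I; rewrite /= in_itv.
apply: fin_bigcap_measurable => // i _.
rewrite -[X in measurable X]setTI; exact: measurable_rV_coord.
Qed.

Lemma lebesgue_box n (a b : R) : a <= b ->
  lebesgue_rV R n (@box n a b) = ((b - a) ^+ n)%:E.
Proof.
move=> ab; elim: n => [|n IH] /=.
  by rewrite diracE mem_set ?expr0// => -[].
rewrite /measure_cons /pushforward.
have -> : rV_cons @^-1` @box n.+1 a b = `[a, b] `*` @box n a b.
  apply/seteqP; split=> [[x v] /= H|[x v] /= [H1 H2] i].
    split; first by rewrite in_itv/=; have := H ord0; rewrite rV_cons0.
    by move=> j; have := H (rshift 1 j); rewrite rV_consS.
  have [j|j] := @splitP 1 n i => ij.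
    have -> : i = ord0 by apply/val_inj; rewrite /= ij ord1.
    by rewrite rV_cons0/=; move: H1; rewrite in_itv.
  have -> : i = rshift 1 j by exact/val_inj.
  by rewrite rV_consS/=; exact: H2.
rewrite product_measure1E ?IH//; last exact: measurable_box.
rewrite [X in (X * _)%E](lebesgue_measure_itv `[a, b])/= lte_fin.
move: ab; rewrite le_eqVlt => /predU1P[->|ab].
  by rewrite ltxx subrr exprS mul0r mul0e.
by rewrite ab -EFinB -EFinM -exprS.
Qed.

Lemma enorm_ge0 n (x : 'rV[R]_n) : 0 <= enorm x.
Proof. exact: sqrtr_ge0. Qed.

Lemma enorm_direction n (x : 'rV[R]_n) : enorm x != 0 -> enorm (direction x) = 1.
Proof.
move=> x0; rewrite /enorm /direction.
under eq_bigr do rewrite mxE exprMn.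
rewrite -mulr_sumr sqrtrM ?sqr_ge0// sqrtr_sqr normfV ger0_norm ?enorm_ge0//.
by rewrite mulVf.
Qed.

Lemma coord_le_enorm n (x : 'rV[R]_n) i : `|x ord0 i| <= enorm x.
Proof.
rewrite -sqrtr_sqr ler_wsqrtr// (bigD1 i)//= lerDl sumr_ge0// => j _.
exact: sqr_ge0.
Qed.

(** Every cone over a part of the sphere lies in the cube [-1, 1]^n. *)
Lemma sphere_measure_fin n (A : set 'rV[R]_n) : measurable A ->
  (sphere_measure A < +oo)%E.
Proof.
move=> mA; rewrite /sphere_measure lte_mul_pinfty ?lee_fin//.
apply: (@le_lt_trans _ _ (lebesgue_rV R n (@box n (-1) 1))).
  apply: le_measure; rewrite ?inE.
  - exact: measurable_cone.
  - exact: measurable_box.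
  - by move=> x [x1 _] i; rewrite -ler_norml (le_trans (coord_le_enorm x i)).
by rewrite lebesgue_box ?ltry//; lra.
Qed.

Lemma measurable_sphere n : measurable (@sphere R n).
Proof.
have -> : @sphere R n = enorm @^-1` [set 1] by [].
rewrite -[X in measurable X]setTI; apply: measurable_enorm => //.
Qed.

(** The unit ball contains a nondegenerate cube: all coordinates between
    1/(2n) and 1/n. *)
Lemma sphere_measure_sphere_gt0 n : (0 < n)%N ->
  (0 < sphere_measure (@sphere R n))%E.
Proof.
move=> n0; rewrite /sphere_measure mule_gt0 ?lte_fin ?ltr0n//.
have n0' : 0 < n%:R :> R by rewrite ltr0n.
have n1 : 1 <= n%:R :> R by rewrite ler1n.
apply: (@lt_le_trans _ _ (lebesgue_rV R n (@box n (n%:R^-1 / 2) n%:R^-1))).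
  rewrite lebesgue_box; last by rewrite ler_pdivrMr// ler_peMr ?invr_ge0 ?ltW//; lra.
  rewrite lte_fin exprn_gt0// [X in _ < X - _](splitr n%:R^-1) addrK.
  by rewrite divr_gt0// invr_gt0.
apply: le_measure; rewrite ?inE.
- exact: measurable_box.
- by apply: measurable_cone; exact: measurable_sphere.
move=> x xb; split.
  rewrite -[leRHS]sqrtr1 ler_wsqrtr//.
  apply: (@le_trans _ _ (\sum_(i < n) n%:R^-1)).
    apply: ler_sum => i _; have /andP[H1 H2] := xb i.
    have x0 : 0 <= x ord0 i by rewrite (le_trans _ H1)// divr_ge0// invr_ge0 ltW.
    rewrite expr2 (le_trans _ H2)// ler_piMr// (le_trans H2)//.
    by rewrite invf_le1.
  by rewrite sumr_const card_ord -[leLHS]mulr_natl divff// gt_eqF.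
apply: enorm_direction; rewrite gt_eqF//.
have i : 'I_n := Ordinal n0.
apply: lt_le_trans (coord_le_enorm x i).
have /andP[H1 _] := xb i; rewrite normr_gt0 gt_eqF// (lt_le_trans _ H1)//.
by rewrite divr_gt0// invr_gt0.
Qed.

Section instance.
Variable n : nat.

Let fin : fin_num_fun (@sphere_measure R n).
Proof.
move=> A mA; rewrite ge0_fin_numE//; exact: sphere_measure_fin.
Qed.

HB.instance Definition _ := @Measure_isFinite.Build _ _ R (@sphere_measure R n) fin.

End instance.
End sphere_measure_finite.

(** * Integrals over space-time slabs *)

Section product_sigma_finite.
Context d1 d2 (T1 : measurableType d1) (T2 : measurableType d2) (R : realType).
Variable m1 : {sigma_finite_measure set T1 -> \bar R}.
Variable m2 : {sigma_finite_measure set T2 -> \bar R}.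

(** The product of two sigma-finite measures, to be multiplied by a third. *)
Definition product_sf : set (T1 * T2) -> \bar R := (m1 \x m2)%E.

HB.instance Definition _ := Measure.on product_sf.

Let sf : sigma_finite setT product_sf.
Proof.
have /sigma_finiteP[F [TF ndF Foo]] := sigma_finiteT m1.
have /sigma_finiteP[G [TG ndG Goo]] := sigma_finiteT m2.
exists (fun k => F k `*` G k).
  apply/seteqP; split=> // -[x y] _.
  have [i _ Fi] : (\bigcup_k F k) x by rewrite -TF.
  have [j _ Gj] : (\bigcup_k G k) y by rewrite -TG.
  exists (maxn i j) => //; split.
    by move: Fi; apply/subsetPset/ndF/leq_maxl.
  by move: Gj; apply/subsetPset/ndG/leq_maxr.
move=> k; have [mF Fk] := Foo k; have [mG Gk] := Goo k; split.
  exact: measurableX.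
by rewrite /product_sf product_measure1E// lte_mul_pinfty// ge0_fin_numE.
Qed.

HB.instance Definition _ := Measure_isSigmaFinite.Build _ _ _ product_sf sf.

End product_sigma_finite.

Section triple_integral.
Context d1 d2 d3 (T1 : measurableType d1) (T2 : measurableType d2)
  (T3 : measurableType d3) (R : realType).
Variable m1 : {sigma_finite_measure set T1 -> \bar R}.
Variable m2 : {sigma_finite_measure set T2 -> \bar R}.
Variable m3 : {sigma_finite_measure set T3 -> \bar R}.
Variable g : T1 * T2 * T3 -> \bar R.
Local Notation m := (product_sf m1 m2 \x m3)%E.

Let G := fubini_F m3 g.

Lemma measurable_triple_integral : m.-integrable setT g ->
  measurable_fun setT (fun x => \int[m2]_y \int[m3]_z g (x, y, z))%E.
Proof. by move=> ig; exact: (measurable_fubini_F (integrable_fubini_F ig)). Qed.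

Lemma triple_integral : m.-integrable setT g ->
  (\int[m1]_x \int[m2]_y \int[m3]_z g (x, y, z) = \int[m]_z g z)%E.
Proof.
move=> ig; rewrite -(integral12_prod_meas1 ig).
by rewrite -(integral12_prod_meas1 (integrable_fubini_F ig)).
Qed.

Lemma ge0_triple_integral : measurable_fun setT g -> (forall z, 0 <= g z)%E ->
  (\int[m1]_x \int[m2]_y \int[m3]_z g (x, y, z) = \int[m]_z g z)%E.
Proof.
move=> mg g0; have mG : measurable_fun setT G.
  exact: (measurable_fun_fubini_tonelli_F _ mg g0).
rewrite (fubini_tonelli1 _ mg g0) [RHS](fubini_tonelli1 G mG)// => tr.
exact: integral_ge0.
Qed.

End triple_integral.

Section spacetime.
Context {R : realType} (n : nat).
Local Notation TR := (measurableTypeR R).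
Local Notation X := (TR * TR * 'rV[R]_n)%type.
Local Notation mu := (@lebesgue_measure R).

Local Notation m := (product_sf mu mu \x @sphere_measure R n)%E.

(** All integrals are taken over one such set of finite measure; it contains
    the part of the light cone above ]0, T'] as soon as [a, b] is large. *)
Definition slab (T' a b : R) : set X := `]0, T'] `*` `[a, b] `*` @sphere R n.

Lemma slabP T' a b t r w : slab T' a b (t, r, w) <->
  [/\ 0 < t <= T', a <= r <= b & sphere w].
Proof.
by rewrite /slab /setX /= !in_itv/=; split=> [[[]]|[]].
Qed.

Lemma measurable_slab T' a b : measurable (slab T' a b).
Proof.
apply: measurableX; first exact: measurableX.
exact: measurable_sphere.
Qed.

Lemma slab_fin T' a b : (m (slab T' a b) < +oo)%E.
Proof.
rewrite /slab product_measure1E;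
  [|exact: measurableX|exact: (@measurable_sphere R n)].
rewrite lte_mul_pinfty//; last exact: (@sphere_measure_fin R n _ (@measurable_sphere R n)).
rewrite [X in X \is a fin_num](_ : _ = mu `]0%R, T'] * mu `[a, b])%E; last first.
  exact: product_measure1E.
have fin1 : mu `]0%R, T'] \is a fin_num.
  rewrite ge0_fin_numE// lebesgue_measure_itv/=; case: ifP => // _.
  by rewrite -EFinB ltry.
have fin2 : mu `[a, b] \is a fin_num.
  rewrite ge0_fin_numE// lebesgue_measure_itv/=; case: ifP => // _.
  by rewrite -EFinB ltry.
exact: (fin_numM fin1 fin2).
Qed.

End spacetime.

Section slab_integrals.
Context {R : realType} (n : nat) (M T T' a b : R).
Local Notation TR := (measurableTypeR R).
Local Notation X := (TR * TR * 'rV[R]_n)%type.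
Local Notation mu := (@lebesgue_measure R).
Local Notation m := (product_sf mu mu \x @sphere_measure R n)%E.
Hypothesis T'T : 0 < T' < T.
Hypothesis a2M : 2 * M < a.

Local Notation K := (@slab R n T' a b).

Let T'0 : 0 < T'. Proof. by have /andP[] := T'T. Qed.
Let T'ltT : T' < T. Proof. by have /andP[] := T'T. Qed.

(** The iterated integrals of the weak formulation become a single Lebesgue
    integral, to which linearity and dominated convergence apply. *)
Lemma integral_time_Omega_slab (f : R -> R -> 'rV[R]_n -> R) :
  (forall t r w, 0 < t < T -> 2 * M < r -> sphere w ->
     ~ K (t, r, w) -> f t r w = 0) ->
  m.-integrable K (EFin \o (fun z => f z.1.1 z.1.2 z.2 * z.1.2 ^+ n.-1)) ->
  integral_time_Omega M T f =
    (\int[m]_(z in K) (f z.1.1 z.1.2 z.2 * z.1.2 ^+ n.-1))%R%:E.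
Proof.
move=> f0 fi; have mK := @measurable_slab R n T' a b.
rewrite /Rintegral fineK; last exact: integrable_fin_num.
pose f1 := EFin \o (fun z : X => f z.1.1 z.1.2 z.2 * z.1.2 ^+ n.-1).
pose g := f1 \_ K.
have gi : m.-integrable setT g by exact/(integrable_mkcond _ mK).1.
rewrite integral_mkcond -/f1 -/g.
have mG := measurable_triple_integral gi; rewrite -(triple_integral gi).
pose G t := (\int[mu]_r \int[@sphere_measure R n]_w g (t, r, w))%E.
have E t : 0 < t < T -> integral_Omega M (f t) = G t.
  move=> tT; rewrite /integral_Omega integral_mkcond; apply: eq_integral => r _.
  rewrite patchE; case: ifPn => [|/negP]; rewrite inE/= in_itv/= andbT => r2.
    rewrite integral_mkcond; apply: eq_integral => w _.
    rewrite patchE /g patchE; case: ifPn => [|/negP]; rewrite inE => ws.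
      case: ifPn => [//|/negP]; rewrite inE => nK.
      by rewrite (f0 t r w)// mul0r.
    by case: ifPn => //; rewrite inE => /slabP[].
  rewrite integral0_eq// => w _; rewrite /g patchE; case: ifPn => //.
  by rewrite inE => /slabP[_ /andP[ar _] _]; case: r2; exact: lt_le_trans ar.
have G0 t : ~ (0 < t <= T') -> G t = 0%E.
  move=> nt; rewrite /G integral0_eq// => r _; rewrite integral0_eq// => w _.
  by rewrite /g patchE; case: ifPn => //; rewrite inE => /slabP[].
rewrite /integral_time_Omega -integral_itv_obnd_cbnd; last first.
  apply: (@eq_measurable_fun _ _ _ _ _ G).
    by move=> t; rewrite inE/= in_itv/= => /E.
  exact: measurable_funTS.
rewrite integral_mkcond; apply: eq_integral => t _; rewrite patchE.
case: ifPn => [|/negP]; rewrite inE/= in_itv/=; first by move=> /E.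
move=> H; rewrite -/(G t) G0// => /andP[t0 tT]; apply: H.
by rewrite t0 (le_lt_trans tT).
Qed.

(** The iterated integral of |f|^q is finite by assumption; by Tonelli it is
    the integral over the product, which gives integrability there. *)
Lemma Lq_loc_integrable (q : R) (f : R -> R -> 'rV[R]_n -> R) : a < b ->
  Lq_loc M q T f ->
  measurable_fun K (fun z => f z.1.1 z.1.2 z.2 : TR) /\
  m.-integrable K (EFin \o (fun z => `|f z.1.1 z.1.2 z.2| `^ q)).
Proof.
move=> ab [mf fi].
have mK := @measurable_slab R n T' a b.
pose K0 : set X := `[0, T'] `*` `[a, b] `*` @sphere R n.
have mK0 : measurable K0.
  by apply: measurableX; [exact: measurableX|exact: (@measurable_sphere R n)].
have KK0 : K `<=` K0.
  move=> [[t r] w] /slabP[/andP[t0 tT'] /andP[ar rb] ws].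
  by rewrite /K0 /setX /= !in_itv/= (ltW t0) tT' ar rb.
have mf0 : measurable_fun K0 (fun z => f z.1.1 z.1.2 z.2 : TR).
  have mD : measurable [set z : X | [/\ 0 <= z.1.1 < T, 2 * M < z.1.2 & sphere z.2]].
    have -> : [set z : X | [/\ 0 <= z.1.1 < T, 2 * M < z.1.2 & sphere z.2]] =
        `[0, T[ `*` `]2 * M, +oo[ `*` @sphere R n.
      apply/seteqP; split=> -[[t r] w] /=; rewrite /setX /= !in_itv/= ?andbT.
        by move=> [? ? ?].
      by move=> [[? ?] ?].
    by apply: measurableX; [exact: measurableX|exact: (@measurable_sphere R n)].
  apply: measurable_funS mf => // -[[t r] w].
  rewrite /K0 /setX /= !in_itv/= => -[[/andP[t0 tT'] /andP[ar rb]] ws].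
  by rewrite t0 (le_lt_trans tT')// (lt_le_trans a2M).
split; first exact: measurable_funS mf0.
apply: (integrableS mK0 mK KK0).
have mq : measurable_fun K0 (fun z => `|f z.1.1 z.1.2 z.2| `^ q).
  apply: (measurableT_comp (measurable_powR q)).
  exact: measurableT_comp.
have mE : measurable_fun K0 (EFin \o (fun z => `|f z.1.1 z.1.2 z.2| `^ q)).
  exact/measurable_EFinP.
pose g := (fun z : X => `|(`|f z.1.1 z.1.2 z.2| `^ q)%:E|%E) \_ K0.
have mg : measurable_fun setT g.
  by apply: (measurable_restrictT _ mK0).1; exact: measurableT_comp.
have g0 z : (0 <= g z)%E by rewrite /g patchE; case: ifP.
apply/integrableP; split => //.
apply: le_lt_trans (fi T' a b T'T a2M ab).
rewrite integral_mkcond -[leLHS](@ge0_triple_integral _ _ _ _ _ _ R mu mu _ g mg g0).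
rewrite le_eqVlt; apply/orP; left; apply/eqP.
rewrite [RHS]integral_mkcond; apply: eq_integral => t _; rewrite [RHS]patchE.
have pE r w : g (t, r, w) = if [&& (0 <= t <= T'), (a <= r <= b) & (w \in @sphere R n)]
      then (`|f t r w| `^ q)%:E else 0%E.
  rewrite /g patchE; case: ifPn => [|/negP] /=; rewrite inE /K0 /setX /= !in_itv/=.
    by move=> [[-> ->]] ws; rewrite mem_set//= ger0_norm// powR_ge0.
  by move=> H; case: ifPn => // /and3P[? ?]; rewrite inE => ws; case: H.
case: ifPn => [|/negP]; rewrite inE/= in_itv/= => tT'.
  rewrite [RHS]integral_mkcond; apply: eq_integral => r _; rewrite [RHS]patchE.
  case: ifPn => [|/negP]; rewrite inE/= in_itv/= => rab.
    rewrite [RHS]integral_mkcond; apply: eq_integral => w _.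
    by rewrite pE tT' rab/= patchE.
  rewrite integral0_eq// => w _; rewrite pE; case: ifPn => // /and3P[_ + _].
  by move=> ?; case: rab.
rewrite integral0_eq// => r _; rewrite integral0_eq// => w _; rewrite pE.
by case: ifPn => // /and3P[? _ _]; case: tT'.
Qed.

End slab_integrals.

(** * Integrable functions against bounded coefficients *)

Section finite_domain.
Context d (S : measurableType d) {R : realType}.
Variables (m : {measure set S -> \bar R}) (K : set S).
Hypotheses (mK : measurable K) (Kfin : (m K < +oo)%E).
Implicit Types (f g q : S -> R).

Definition integrable_on f : Prop := m.-integrable K (EFin \o f).

(** The coefficients that may multiply an integrable function; they form an
    algebra, so that integrability is checked term by term. *)
Definition bmeas q : Prop :=
  measurable_fun K q /\ exists C, forall z, K z -> `|q z| <= C.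

Lemma bmeas_cst c : bmeas (fun=> c).
Proof. by split => //; exists `|c|. Qed.

Lemma bmeasD q q' : bmeas q -> bmeas q' -> bmeas (fun z => q z + q' z).
Proof.
move=> [mq [C Cq]] [mq' [C' Cq']]; split; first exact: measurable_funD.
by exists (C + C') => z Kz; rewrite (le_trans (ler_normD _ _))// lerD ?Cq ?Cq'.
Qed.

Lemma bmeasN q : bmeas q -> bmeas (fun z => - q z).
Proof.
move=> [mq [C Cq]]; split; first exact: measurableT_comp.
by exists C => z Kz; rewrite normrN Cq.
Qed.

Lemma bmeasM q q' : bmeas q -> bmeas q' -> bmeas (fun z => q z * q' z).
Proof.
move=> [mq [C Cq]] [mq' [C' Cq']]; split; first exact: measurable_funM.
by exists (C * C') => z Kz; rewrite normrM ler_pM ?Cq ?Cq'.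
Qed.

Lemma bmeas_integrable q : bmeas q -> integrable_on q.
Proof.
move=> [mq [C Cq]]; apply: measurable_bounded_integrable => //.
exists C; split; first exact: num_real.
by move=> x Cx z Kz; rewrite /= (le_trans (Cq _ Kz))// ltW.
Qed.

Lemma integrable_onM f q : integrable_on f -> bmeas q ->
  integrable_on (fun z => f z * q z).
Proof.
move=> fi [mq [C Cq]].
suff : m.-integrable K ((EFin \o f) \* (EFin \o q))%E.
  by apply: eq_integrable => // z _ /=; rewrite EFinM.
apply: integrableMl => //; exists C; split; first exact: num_real.
by move=> x Cx z Kz; rewrite /= (le_trans (Cq _ Kz))// ltW.
Qed.

Lemma integrable_onD f g : integrable_on f -> integrable_on g ->
  integrable_on (fun z => f z + g z).
Proof. by move=> fi gi; have := integrableD mK fi gi. Qed.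

Lemma integrable_onZ c f : integrable_on f -> integrable_on (fun z => c * f z).
Proof. by move=> fi; have := integrableZl mK c fi. Qed.

Lemma integrable_on_le f g : measurable_fun K f -> integrable_on g ->
  (forall z, K z -> `|f z| <= `|g z|) -> integrable_on f.
Proof.
move=> mf gi fg; apply: le_integrable gi => //; first exact/measurable_EFinP.
Qed.

Lemma integrable_on_eq f g : (forall z, K z -> f z = g z) ->
  integrable_on f -> integrable_on g.
Proof.
by move=> fg; apply: eq_integrable => // z; rewrite inE => Kz /=; rewrite fg.
Qed.

Lemma measurable_integrable_on f : integrable_on f -> measurable_fun K f.
Proof. by move=> /measurable_int/measurable_EFinP. Qed.

Lemma Rintegral_lin (c c' : R) f g : integrable_on f -> integrable_on g ->
  (\int[m]_(z in K) (c * f z + c' * g z) =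
   c * \int[m]_(z in K) f z + c' * \int[m]_(z in K) g z)%R.
Proof.
move=> fi gi; rewrite RintegralD//; try exact: integrable_onZ.
by rewrite !RintegralZl.
Qed.

Lemma Rintegral_eq f g : (forall z, K z -> f z = g z) ->
  (\int[m]_(z in K) f z = \int[m]_(z in K) g z)%R.
Proof. by move=> fg; apply: eq_Rintegral => z; rewrite inE => /fg. Qed.

(** Dominated convergence with majorant C |f|. *)
Lemma Rintegral_bounded_cvg f (q_ : nat -> S -> R) q (C : R) : integrable_on f ->
  (forall j, measurable_fun K (q_ j)) -> measurable_fun K q ->
  (forall j z, K z -> `|q_ j z| <= C) ->
  (forall z, K z -> q_ ^~ z @ \oo --> q z) ->
  (fun j => \int[m]_(z in K) (f z * q_ j z))%R @ \oo -->
  (\int[m]_(z in K) (f z * q z))%R.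
Proof.
move=> fi mq_ mq bq cq; have mf := measurable_integrable_on fi.
have H := @dominated_convergence _ _ _ m K mK
  (fun j z => (f z * q_ j z)%:E) (fun z => (f z * q z)%:E)
  (fun z => (`|f z| * `|C|)%:E) _ _ _ _ _.
have [] := H.
- by move=> j; apply/measurable_EFinP; exact: measurable_funM.
- by apply/measurable_EFinP; exact: measurable_funM.
- apply: aeW => z Kz; apply: cvg_EFin; first by near=> x.
  by apply: cvgM; [exact: cvg_cst|exact: cq].
- have fi' : integrable_on (fun z => `|f z|) by exact: integrable_norm.
  exact: (integrable_onM fi' (bmeas_cst _)).
- apply: aeW => z j Kz; rewrite /= lee_fin normrM ler_wpM2l//.
  by rewrite (le_trans (bq j z Kz))// ler_norm.
move=> iq _ cv; apply: fine_cvg; rewrite fineK//; exact: integrable_fin_num.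
Unshelve. all: by end_near. Qed.

End finite_domain.

Section continuous_coefficients.
Context {R : realType}.
Local Notation TR := (measurableTypeR R).

Lemma continuous_bounded (f : R -> R) (x y : R) :
  (forall z, x <= z <= y -> {for z, continuous f}) ->
  exists C, forall z, x <= z <= y -> `|f z| <= C.
Proof.
move=> cf.
have cf' : {within `[x, y], continuous f}.
  by apply: continuous_in_subspaceT => z; rewrite inE/= in_itv/=; exact: cf.
have /compact_bounded[C [_ HC]] := continuous_compact cf' (@segment_compact R x y).
exists (`|C| + 1) => z xz; apply: HC; first by rewrite ltr_pwDr// ler_norm.
by exists z => //=; rewrite in_itv.
Qed.

(** A function continuous on an open set is bounded on every segment in it;
    this covers coefficients that blow up at the horizon. *)
Lemma bmeas_comp d (S : measurableType d) (K : set S) (g : S -> TR) (f : R -> R)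
    (U : set R) (x y : R) : measurable K -> measurable_fun K g -> open U ->
  (forall z, U z -> {for z, continuous f}) ->
  (forall z, K z -> x <= g z <= y) -> (forall z, x <= z <= y -> U z) ->
  bmeas K (f \o g).
Proof.
move=> mK mg oU cf Kxy xyU; split.
  apply: (@measurable_comp _ _ _ _ _ _ U) => //.
  - exact: open_measurable.
  - by move=> _ [z Kz <-]; exact/xyU/Kxy.
  - by apply: open_continuous_measurable_fun => // z; rewrite inE; exact: cf.
have [|C HC] := @continuous_bounded f x y; first by move=> z /xyU/cf.
by exists C => z Kz; exact/HC/Kxy.
Qed.

End continuous_coefficients.

Section slab_coefficients.
Context {R : realType} (n : nat) (M R0 T' a b : R).
Local Notation TR := (measurableTypeR R).
Local Notation X := (TR * TR * 'rV[R]_n)%type.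
Hypotheses (M0 : 0 < M) (a2M : 2 * M < a).
Local Notation K := (@slab R n T' a b).

Let mK : measurable K. Proof. exact: measurable_slab. Qed.

Let mtime : measurable_fun K (fun z : X => z.1.1).
Proof. by apply: measurable_funTS; exact: measurableT_comp. Qed.

Let mradius : measurable_fun K (fun z : X => z.1.2).
Proof. by apply: measurable_funTS; exact: measurableT_comp. Qed.

Lemma bmeas_time (d : R) (th : R -> R) : 0 < d ->
  (forall t, - d < t -> {for t, continuous th}) ->
  bmeas K (fun z => th z.1.1).
Proof.
move=> d0 cth; apply: (bmeas_comp (U := [set t | - d < t]) (x := 0) (y := T') mK mtime).
- exact: open_gt.
- by move=> z; exact: cth.
- by move=> [[t r] w] /slabP[/andP[t0 ->] _ _]; rewrite /= ltW.
- by move=> z /andP[z0 _] /=; rewrite (lt_le_trans _ z0)// oppr_lt0.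
Qed.

Lemma bmeas_radius (c : R -> R) : (forall r, 2 * M < r -> {for r, continuous c}) ->
  bmeas K (fun z => c z.1.2).
Proof.
move=> cc; apply: (bmeas_comp (U := [set r | 2 * M < r]) (x := a) (y := b) mK mradius).
- exact: open_gt.
- by move=> z; exact: cc.
- by move=> [[t r] w] /slabP[].
- by move=> z /andP[z0 _] /=; rewrite (lt_le_trans _ z0)// oppr_lt0.
Qed.

Lemma bmeas_lightcut : bmeas K (fun z => lightcut M R0 z.1.1 z.1.2).
Proof.
have ct r : 2 * M < r -> {for r, continuous (tortoise M)}.
  by move=> r2; exact: der_continuous (is_derive_tortoise M0 r2).
have [mt _] := bmeas_radius ct.
have ms : measurable_fun setT (@step R : TR -> TR).
  apply: continuous_measurable_fun => x; exact: (Ck_continuous (@Ck_step R) I).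
split; last first.
  exists 1 => z _; rewrite ger0_norm ?lightcut_le1//; exact: lightcut_ge0.
apply: measurable_funM; apply: measurableT_comp ms _.
  by apply: measurable_funB => //; exact: measurable_funB.
apply: measurable_funB => //; apply: measurable_funB => //.
exact: measurableT_comp.
Qed.

End slab_coefficients.

Section radial_integral.
Context {R : realType} (n : nat) (M a b : R).
Local Notation mu := (@lebesgue_measure R).
Hypotheses (a2M : 2 * M < a).

Definition sphere_area : R := fine (sphere_measure (@sphere R n)).

Lemma sphere_areaE : sphere_measure (@sphere R n) = sphere_area%:E.
Proof.
rewrite /sphere_area fineK// ge0_fin_numE//.
exact: sphere_measure_fin (@measurable_sphere R n).
Qed.

Lemma sphere_area_gt0 : (0 < n)%N -> 0 < sphere_area.
Proof.
move=> n0; have := @sphere_measure_sphere_gt0 R n n0.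
by rewrite sphere_areaE lte_fin.
Qed.

Lemma integral_Omega_radial (f : R -> R) :
  (forall r, 2 * M < r -> ~ (a <= r <= b) -> f r = 0) ->
  integrable_on mu `[a, b] (fun r => f r * r ^+ n.-1) ->
  integral_Omega M (fun r (_ : 'rV[R]_n) => f r) =
    (sphere_area * \int[mu]_(r in `[a, b]) (f r * r ^+ n.-1))%R%:E.
Proof.
move=> f0 fi; rewrite -RintegralZl// /Rintegral fineK; last first.
  apply: integrable_fin_num => //.
  have mab : measurable (`[a, b] : set (measurableTypeR R)) by [].
  have H := integrable_onZ mab sphere_area fi; exact: H.
rewrite [RHS]integral_mkcond /integral_Omega [LHS]integral_mkcond.
apply: eq_integral => r _; rewrite [LHS]patchE [RHS]patchE.
have E : (\int[@sphere_measure R n]_(w in @sphere R n) (f r * r ^+ n.-1)%:E =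
    (sphere_area * (f r * r ^+ n.-1))%:E)%E.
  rewrite integral_cst; last exact: measurable_sphere.
  by rewrite [X in (_ * X)%E]sphere_areaE -EFinM mulrC.
case: ifPn => [|/negP]; rewrite inE/= in_itv/= andbT => r2.
  rewrite E; case: ifPn => [//|/negP]; rewrite inE/= in_itv/= => rab.
  by rewrite f0// mul0r mulr0.
case: ifPn => //; rewrite inE/= in_itv/= => /andP[ar _].
by case: r2; exact: lt_le_trans ar.
Qed.

Lemma bmeas_segment (c : R -> R) : (forall r, 2 * M < r -> {for r, continuous c}) ->
  bmeas (`[a, b] : set (measurableTypeR R)) c.
Proof.
move=> cc; apply: (@bmeas_comp R _ _ _ id c [set r | 2 * M < r] a b) => //.
by move=> z /andP[z0 _] /=; exact: lt_le_trans z0.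
Qed.

Lemma locally_integrable_segment (f : R -> R) :
  locally_integrable [set` `]2 * M, +oo[%R] f ->
  integrable_on mu `[a, b] f.
Proof.
move=> [mf _ fi]; have sub : `[a, b]%classic `<=` [set` `]2 * M, +oo[%R].
  by move=> r; rewrite /= !in_itv/= andbT => /andP[ar _]; exact: lt_le_trans ar.
apply/integrableP; split.
  by apply/measurable_EFinP; apply: measurable_funS sub _.
exact: fi sub (@segment_compact R a b).
Qed.

End radial_integral.

(** * Initial layers *)

Section initial_layer.
Context {R : realType}.

(** Cutoffs that shrink to the initial time: [layer j] is 1 near t = 0 and
    vanishes for t >= 2/(j+1). Multiplying a test function by 1 - [layer j]
    makes it vanish near t = 0. *)
Definition layer (j : nat) (t : R) : R := step (t * j.+1%:R).

(** The primitive of - [layer j] that vanishes for t >= 2/(j+1): it is of size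
    1/j, but its derivative at t = 0 is -1. A test function that contains it
    feels only the initial displacement in the limit. *)
Definition layer_primitive (j : nat) (t : R) : R :=
  (\int[@lebesgue_measure R]_(x in `[-1, 2]) step x
   - \int[@lebesgue_measure R]_(x in `[-1, t * j.+1%:R]) step x) / j.+1%:R.

Let jpos j : 0 < j.+1%:R :> R. Proof. by rewrite ltr0n. Qed.

Let dom j (t : R) : - j.+1%:R^-1 < t -> -1 < t * j.+1%:R.
Proof.
move=> H; have := jpos j => j0.
by rewrite -ltr_pdivrMr// mulN1r.
Qed.

Lemma Ck_layer j : Ck 3 [set: R] (layer j).
Proof.
have oT : open [set: R] := openT.
have A := CkM oT (Ck_id 3 oT) (Ck_cst 3 setT (j.+1%:R : R)).
exact: (Ck_comp oT oT (fun _ _ => I) (@Ck_step R) A).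
Qed.

Lemma is_derive_layer_primitive j (t : R) : - j.+1%:R^-1 < t ->
  is_derive t 1 (layer_primitive j) (- layer j t).
Proof.
move=> tj; have cs : continuous (@step R).
  by move=> x; exact: (Ck_continuous (@Ck_step R) I).
have H := @antiderivative R step (-1) cs (t * j.+1%:R) (dom tj).
have T := derM (derI t) (derC t (j.+1%:R : R)).
have HT := @derComp R t (fun y => \int[@lebesgue_measure R]_(x in `[-1, y]) step x)
  (fun t => t * j.+1%:R) _ _ H T.
apply: is_derive_eq (derM (derD (derC t _) (derN HT)) (derC t (j.+1%:R^-1))) _.
rewrite /layer mulr0 addr0 add0r mul1r mulr0 addr0.
by rewrite mulNr mulfK// gt_eqF.
Qed.

Lemma Ck_layer_primitive j :
  Ck 3 [set t : R | - j.+1%:R^-1 < t] (layer_primitive j).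
Proof.
have oj : open [set t : R | - j.+1%:R^-1 < t] by exact: open_gt.
have C2 := Ck_le (leqnSn 2) (Ck_layer j).
have C2' := CkN openT C2.
apply: (Ck_deriv oj (g := fun t => - layer j t)).
  by move=> t; exact: is_derive_layer_primitive.
exact: (Ck_sub (@subsetT _ _) C2').
Qed.

Lemma layer_near0 j (t : R) : t <= j.+1%:R^-1 -> layer j t = 1.
Proof.
by move=> tj; apply: step_le1; rewrite -ler_pdivlMr// div1r.
Qed.

Lemma layer_norm j (t : R) : `|layer j t| <= 1.
Proof. by rewrite ger0_norm ?step_ge0 ?step_le. Qed.

Lemma layer_far j (t : R) : 2 <= t * j.+1%:R -> layer j t = 0.
Proof. exact: step_ge2. Qed.

Let prim_far j (t : R) : 2 <= t * j.+1%:R -> layer_primitive j t = 0.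
Proof.
move=> tj; rewrite /layer_primitive.
pose G := fun y : R => \int[@lebesgue_measure R]_(x in `[-1, y]) step x.
have cs : continuous (@step R).
  by move=> x; exact: (Ck_continuous (@Ck_step R) I).
suff : G 2 = G (t * j.+1%:R) by rewrite /G => ->; rewrite subrr mul0r.
have dG (x : R) : -1 < x -> is_derive x 1 G (step x).
  by move=> x1; exact: antiderivative.
have [||c] := @MVT_segment R G step 2 (t * j.+1%:R) tj.
- move=> z; rewrite in_itv/= => /andP[z2 _]; apply: dG; lra.
- apply: derivable_within_continuous => z; rewrite in_itv/= => /andP[z2 _].
  by have [] : is_derive z 1 G (step z) by apply: dG; lra.
rewrite in_itv/= => /andP[c2 _]; rewrite step_ge2// mul0r => /eqP.
by rewrite subr_eq0 => /eqP.
Qed.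

Lemma layer_primitive_norm j (t : R) : 0 <= t -> `|layer_primitive j t| <= 2 / j.+1%:R.
Proof.
move=> t0; have [tj|tj] := leP 2 (t * j.+1%:R).
  by rewrite prim_far// normr0 divr_ge0.
rewrite /layer_primitive normrM normfV (gtr0_norm (jpos j)).
rewrite ler_wpM2r ?invr_ge0//.
have cs : continuous (@step R).
  by move=> x; exact: (Ck_continuous (@Ck_step R) I).
pose G := fun y : R => \int[@lebesgue_measure R]_(x in `[-1, y]) step x.
have dG (x : R) : -1 < x -> is_derive x 1 G (step x).
  by move=> x1; exact: antiderivative.
have tj0 : 0 <= t * j.+1%:R by rewrite mulr_ge0.
have [||c] := @MVT_segment R G step (t * j.+1%:R) 2 (ltW tj).
- move=> z; rewrite in_itv/= => /andP[z2 _]; apply: dG; lra.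
- apply: derivable_within_continuous => z; rewrite in_itv/= => /andP[z2 _].
  by have [] : is_derive z 1 G (step z) by apply: dG; lra.
rewrite in_itv/= => /andP[c1 c2]; rewrite /G => ->.
rewrite normrM [X in X * _]ger0_norm ?step_ge0// ger0_norm; last lra.
rewrite -[leRHS]mul1r ler_pM ?step_ge0 ?step_le//; lra.
Qed.

Lemma layer_cvg (t : R) : 0 < t -> layer ^~ t @ \oo --> (0 : R).
Proof.
move=> t0; apply: cvg_near_cst; near=> j; apply: layer_far.
rewrite -ler_pdivrMl// (@le_trans _ _ (j%:R))// ?ler_nat//.
near: j; exact: nbhs_infty_ger.
Unshelve. all: by end_near. Qed.

Lemma layer_primitive_cvg (t : R) : 0 <= t -> layer_primitive ^~ t @ \oo --> (0 : R).
Proof.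
move=> t0; apply/cvgr0Pnorm_le => e e0; near=> j.
rewrite (le_trans (layer_primitive_norm j t0))//.
rewrite ler_pdivrMr// -ler_pdivrMl// (@le_trans _ _ (j%:R))// ?ler_nat//.
near: j; exact: nbhs_infty_ger.
Unshelve. all: by end_near. Qed.

End initial_layer.

(** * C^2 approximation of continuous coefficients *)

Section smooth_approximation.
Context {R : realType} (M a b : R) (c : R -> R).
Hypotheses (M0 : 0 < M) (a2M : 2 * M < a) (ab : a < b).
Hypothesis cc : forall r, 2 * M < r -> {for r, continuous c}.

(* c is continuous only beyond the horizon; outside [a, b] it is replaced by its
   boundary values. *)
Let clamp (x : R) : R := Num.min (Num.max x a) b.
Let cx (x : R) : R := c (clamp x).

Let clamp_in x : a <= clamp x <= b.
Proof. by rewrite /clamp ge_min lexx orbT le_min le_max lexx orbT ltW. Qed.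

Let clamp_id x : a <= x <= b -> clamp x = x.
Proof. by move=> /andP[ax xb]; rewrite /clamp max_l// min_l. Qed.

Let ccx : continuous cx.
Proof.
move=> x.
have c1 : {for x, continuous (fun y : R => Num.max y a)}.
  by apply: continuous_max; [exact: cvg_id|exact: cvg_cst].
have c2 : {for x, continuous clamp}.
  by apply: continuous_min; [exact: c1|exact: cvg_cst].
apply: (continuous_comp c2); apply: cc.
by have /andP[+ _] := clamp_in x; exact: lt_le_trans.
Qed.

Let G1 (x : R) : R := (\int[@lebesgue_measure R]_(t in `[0, x]) cx t)%R.

Let dG1 (x : R) : 0 < x -> is_derive x 1 G1 (cx x).
Proof. by move=> x0; exact: antiderivative. Qed.

Let G1m (x : R) : R := G1 (Num.max x M).

Let cG1m : continuous G1m.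
Proof.
move=> x.
have c1 : {for x, continuous (fun y : R => Num.max y M)}.
  by apply: continuous_max; [exact: cvg_id|exact: cvg_cst].
by apply: (continuous_comp c1); apply: der_continuous (dG1 _); rewrite lt_max M0 orbT.
Qed.

Let G2 (x : R) : R := (\int[@lebesgue_measure R]_(t in `[0, x]) G1m t)%R.

Let dG2 (x : R) : M < x -> is_derive x 1 G2 (G1 x).
Proof.
move=> x0; have := antiderivative cG1m (lt_trans M0 x0).
by rewrite {2}/G1m max_l// ltW.
Qed.

(* Second difference quotient, with step 1/(j+1), of the second antiderivative
   of c: it is of class C^2, and by the mean value theorem its values are values
   of c at nearby points. *)
Let approx (j : nat) (x : R) : R :=
  (G2 (x + 2 / j.+1%:R) - 2 * G2 (x + j.+1%:R^-1) + G2 x) * j.+1%:R ^+ 2.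

Let jpos j : 0 < j.+1%:R :> R. Proof. by rewrite ltr0n. Qed.

Let mean_value (f df : R -> R) (x e : R) : M < x -> 0 < e ->
  (forall y, M < y -> is_derive y 1 f (df y)) ->
  exists2 y, x <= y <= x + e & f (x + e) - f x = df y * e.
Proof.
move=> xM e0 dff.
have xe : x <= x + e by rewrite lerDl ltW.
have [||y] := @MVT_segment R f df x (x + e) xe.
- move=> z; rewrite in_itv/= => /andP[z2 _]; apply: dff; exact: lt_trans z2.
- apply: derivable_within_continuous => z; rewrite in_itv/= => /andP[z2 _].
  by have [] := dff z (lt_le_trans xM z2).
rewrite in_itv/= => xy ->; exists y => //; congr (_ * _); ring.
Qed.

Let approx_mean j (x : R) : M < x -> exists2 y,
  x <= y <= x + 2 / j.+1%:R & approx j x = cx y.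
Proof.
move=> xM; set e : R := j.+1%:R^-1; have e0 : 0 < e by rewrite invr_gt0.
have dd (y : R) : M < y -> is_derive y 1 (fun x => G2 (x + e) - G2 x) (G1 (y + e) - G1 y).
  move=> yM; have ye : M < y + e by rewrite (lt_trans yM)// ltrDl.
  have T := derD (derI y) (derC y e).
  have H := @derComp R y G2 (fun x => x + e) _ _ (dG2 ye) T.
  apply: is_derive_eq (derD H (derN (dG2 yM))) _; ring.
have [y /andP[xy yx] Ey] := mean_value xM e0 dd.
have yM : M < y by exact: lt_le_trans xy.
have dG1' (w : R) : M < w -> is_derive w 1 G1 (cx w).
  by move=> ?; apply: dG1; exact: lt_trans M0 _.
have [z /andP[yz zy] Ez] := mean_value yM e0 dG1'.
exists z; first (apply/andP; split; [exact: le_trans yz|]; rewrite -/e; lra).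
have e2 : (2 / j.+1%:R : R) = e + e by rewrite /e; ring.
rewrite /approx -/e e2 addrA.
have -> : G2 (x + e + e) - 2 * G2 (x + e) + G2 x =
  G2 (x + e + e) - G2 (x + e) - (G2 (x + e) - G2 x) by ring.
rewrite Ey Ez /e; field; by rewrite gt_eqF.
Qed.

(** Uniform boundedness comes with the pointwise convergence, as dominated
    convergence demands. *)
Lemma smooth_approximation : exists (c_ : nat -> R -> R) (C : R),
  [/\ forall j, Ck 2 [set r | 2 * M < r] (c_ j),
      forall j r, 2 * M < r -> `|c_ j r| <= C &
      forall r, a <= r <= b -> c_ ^~ r @ \oo --> c r].
Proof.
have [|C HC] := @continuous_bounded R c a b.
  by move=> z /andP[az _]; apply: cc; exact: lt_le_trans az.
have M2 : M < 2 * M by rewrite ltr_pMl// ltr1n.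
exists approx, C; split.
- move=> j; have oM : open [set r : R | M < r] by exact: open_gt.
  have o2 : open [set r : R | 2 * M < r] by exact: open_gt.
  have C1 : Ck 1 [set r : R | M < r] G1.
    apply: (Ck_deriv oM (g := cx)); last by apply: Ck0_continuous.
    by move=> x /= xM; apply: dG1; exact: lt_trans xM.
  have C2 : Ck 2 [set r : R | M < r] G2 by exact: (Ck_deriv oM dG2).
  have sh (e : R) : 0 <= e -> Ck 2 [set r : R | 2 * M < r] (fun x => G2 (x + e)).
    move=> e0; apply: (Ck_comp o2 oM _ C2 (CkD o2 (Ck_id 2 o2) (Ck_cst 2 _ e))).
    by move=> x /= x2; rewrite (lt_le_trans (lt_trans M2 x2))// lerDl.
  have S1 := sh (2 / j.+1%:R) (divr_ge0 (ler0n _ _) (ler0n _ _)).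
  have S2 : Ck 2 [set r : R | 2 * M < r] (fun x => G2 (x + j.+1%:R^-1)).
    by apply: sh; rewrite invr_ge0.
  have S3 : Ck 2 [set r : R | 2 * M < r] G2.
    by apply: Ck_sub C2 => x /= x2; exact: lt_trans x2.
  exact: (CkM o2 (CkD o2 (CkD o2 S1 (CkN o2 (CkM o2 (Ck_cst 2 _ 2) S2))) S3)
    (Ck_cst 2 _ (j.+1%:R ^+ 2))).
- move=> j r r2; have [y _ ->] := approx_mean j (lt_trans M2 r2).
  exact/HC/clamp_in.
- move=> r rab; have r2 : M < r.
    by have /andP[ar _] := rab; rewrite (lt_trans M2)// (lt_le_trans a2M).
  apply/cvgrPdist_le => e e0.
  have := @ccx r; move=> /cvgrPdist_le/(_ e e0)/nbhs_ballP[g /= g0 Hg].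
  near=> j; have [y /andP[ry yr] ->] := approx_mean j r2.
  rewrite -[c r](congr1 c (clamp_id rab)); apply: Hg; rewrite /ball/=.
  rewrite distrC ger0_norm ?subr_ge0// ltrBlDl (le_lt_trans yr)// ltrD2l.
  rewrite ltr_pdivrMr// -ltr_pdivrMl// (@lt_le_trans _ _ (j%:R))// ?ler_nat//.
  by near: j; exact: nbhs_infty_gtr.
Unshelve. all: by end_near. Qed.

End smooth_approximation.

(** * The radial profile of the test function *)

Section radial_profile.
Context {R : realType} (n : nat) (M lam : R) (D V phi : R -> R).
Hypotheses (M0 : 0 < M) (n0 : (0 < n)%N).
Hypothesis hphi : eigenfunction n M D V lam phi.
Local Notation k := ((n%:R - 1) / 2 : R).

(** The factor r^(-(n-1)/2) removes the first-order term of the Laplacian in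
    the tortoise coordinate, at the price of the potential Q. *)
Definition profile (r : R) : R := phi (tortoise M r) * r `^ (- k).

Let o2 : open [set r : R | 2 * M < r]. Proof. exact: open_gt. Qed.

Let Ck_phi : Ck 2 [set: R] phi.
Proof.
have [dphi cphi _ _] := hphi.
have oT : open [set: R] := openT.
apply: (Ck_deriv oT (g := derive1 phi)).
  by move=> x _; rewrite derive1E; apply/derivableP; have [] := dphi x.
apply: (Ck_deriv oT (g := derive1n 2 phi)).
  by move=> x _; rewrite /= derive1E; apply/derivableP; have [] := dphi x.
exact: Ck0_continuous.
Qed.

Lemma Ck_profile : Ck 2 [set r | 2 * M < r] profile.
Proof.
exact: (CkM o2 (Ck_comp o2 openT (fun _ _ => I) Ck_phi (Ck_tortoise M 2))
  (Ck_r_pow M0 2 (- k))).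
Qed.

Lemma profile_gt0 r : 2 * M < r -> 0 < profile r.
Proof.
move=> r2; have [_ _ _ [c1 [c2 [c10 _ H]]]] := hphi.
have /andP[H1 _] := H (tortoise M r).
apply: mulr_gt0; last by apply: powR_gt0; exact: radius_gt0 r2.
by apply: lt_le_trans H1; apply: mulr_gt0 => //; exact: expR_gt0.
Qed.

Let dphi1 (x : R) : is_derive x 1 phi (derive1 phi x).
Proof.
have [dphi _ _ _] := hphi.
by rewrite derive1E; apply/derivableP; have [] := dphi x.
Qed.

Let dphi2 (x : R) : is_derive x 1 (derive1 phi) (derive1n 2 phi x).
Proof.
have [dphi _ _ _] := hphi.
by rewrite /= derive1E; apply/derivableP; have [] := dphi x.
Qed.

(** Consequently e^(-lam t) [profile] solves the homogeneous adjoint equation: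
    this is the function with which u is tested. *)
Lemma radial_laplacian_profile r : 2 * M < r ->
  radial_laplacian n M profile r =
  profile r * (V r + lam * D r + lam ^+ 2 / F_S M r).
Proof.
have kE : n.-1%:R = 2 * k :> R.
  by rewrite -[in RHS](prednK n0) -natr1; field.
have powE (x : R) : 2 * M < x -> x ^+ n.-1 = (x `^ k) ^+ 2.
  move=> x2; have x0 := radius_gt0 M0 x2.
  rewrite -[in RHS]powR_mulrn ?powR_ge0// -powRrM -powR_mulrn ?ltW// kE.
  by congr (_ `^ _); field.
have pow1 (x : R) : 2 * M < x -> x `^ (- k) = (x `^ k)^-1.
  by move=> _; rewrite powRN.
have pow2 (a x : R) : 2 * M < x -> x `^ (a - 1) = x `^ a / x.
  move=> x2; have x0 := radius_gt0 M0 x2.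
  rewrite powRB; last by apply/implyP => _; rewrite gt_eqF.
  by rewrite powRr1// ltW.
have dprof (x : R) : 2 * M < x -> is_derive x 1 profile
    ((derive1 phi (tortoise M x) / F_S M x - k * phi (tortoise M x) / x) / x `^ k).
  move=> x2; have x0 := radius_gt0 M0 x2.
  have T := derComp (dphi1 (tortoise M x)) (is_derive_tortoise M0 x2).
  have P : is_derive x 1 (fun x => x `^ (- k)) (- k * x `^ (- k - 1)).
    exact: is_derive1_powR.
  apply: is_derive_eq (derM T P) _; rewrite pow2// pow1//.
  have := F_S_gt0 M0 x2; have : 0 < x `^ k by exact: powR_gt0.
  by move=> *; field; rewrite !gt_eqF.
(* r^(n-1) F profile', after the powers of r have been combined. *)
pose W (x : R) := x `^ k * derive1 phi (tortoise M x)
  - k * (F_S M x * (x `^ k / x) * phi (tortoise M x)).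
move=> r2; have r0 := radius_gt0 M0 r2.
have F0 := F_S_gt0 M0 r2; have P0 : 0 < r `^ k by exact: powR_gt0.
have dP : is_derive r 1 (fun x => x `^ k) (k * (r `^ k / r)).
  by rewrite -pow2//; exact: is_derive1_powR.
have dI : is_derive r 1 (fun x : R => x^-1) (- (r ^- 2)).
  apply: is_derive_eq (is_deriveV _ (derI r)) _; first by rewrite gt_eqF.
  by rewrite /GRing.scale/= mulr1.
have dF : is_derive r 1 (F_S M) (2 * M / r ^+ 2).
  apply: is_derive_eq (derD (derC r 1) (derN (derM (derC r (2 * M)) dI))) _.
  by field; rewrite gt_eqF.
have dT1 := derComp (dphi1 (tortoise M r)) (is_derive_tortoise M0 r2).
have dT2 := derComp (dphi2 (tortoise M r)) (is_derive_tortoise M0 r2).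
have dW := derD (derM dP dT2)
  (derN (derM (derC r k) (derM (derM dF (derM dP dI)) dT1))).
rewrite /radial_laplacian (derD1 (df := _) (der_near _ dW)); last first.
  near=> x; have x2 : 2 * M < x by near: x; exact: lt_nbhsr.
  rewrite (derD1 (dprof x x2)) powE//.
  have := F_S_gt0 M0 x2; have : 0 < x `^ k by rewrite powR_gt0// (radius_gt0 M0).
  have := radius_gt0 M0 x2.
  by move=> *; field; rewrite !gt_eqF.
have [_ _ /(_ (tortoise M r)) + _] := hphi.
rewrite /Qpot radius_ofK// => ->.
rewrite powE// /profile pow1//.
by field; rewrite !gt_eqF.
Unshelve. all: by end_near. Qed.

End radial_profile.

(** * Identities satisfied by a weak solution *)

Section weak_identities.
Context {R : realType} (n : nat) (M p : R) (D V u0 u1 : R -> R)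
  (R0 eps T T' a b : R) (U : R -> R -> R) (ut : R -> R -> 'rV[R]_n -> R).
Local Notation TR := (measurableTypeR R).
Local Notation X := (TR * TR * 'rV[R]_n)%type.
Local Notation mu := (@lebesgue_measure R).
Local Notation m := (product_sf mu mu \x @sphere_measure R n)%E.
Local Notation K := (@slab R n T' a b).
Local Notation h := (lightcut M R0).
Hypotheses (M0 : 0 < M) (p1 : 1 < p).
Hypotheses (T'T : 0 < T' < T) (a2M : 2 * M < a) (ab : a < b).
Hypothesis window : forall r, 2 * M < r -> `|tortoise M r| <= T' + R0 + 2 ->
  a <= r <= b.
Hypotheses (cD : forall r, 2 * M < r -> {for r, continuous D})
  (cV : forall r, 2 * M < r -> {for r, continuous V}).
Hypotheses (lU : Lq_loc M 1 T (fun t r (_ : 'rV[R]_n) => U t r))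
  (lut : Lq_loc M p T ut)
  (Udt : weak_dt M T (fun t r (_ : 'rV[R]_n) => U t r) ut).
Hypothesis Uweak : forall phi, test_function M T phi ->
  (integral_time_Omega M T (fun t r w => `|ut t r w| `^ p * phi t r w)%R +
   eps%:E * integral_Omega M (fun r (w : 'rV[R]_n) =>
     (u1 r * phi 0 r w - u0 r * derive1 (fun t => phi t r w) 0) / F_S M r
     + D r * u0 r * phi 0 r w)%R =
   integral_time_Omega M T (fun t r w => U t r *
     (derive1n 2 (fun x => phi x r w) t / F_S M r - laplace_gS M (phi t) r w
      - D r * derive1 (fun x => phi x r w) t + V r * phi t r w))%R)%E.
Hypothesis Usupp : forall t r, 0 < t < T -> 2 * M < r -> U t r != 0 ->
  `|tortoise M r| <= t + R0.
Hypotheses (lu0 : locally_integrable [set` `]2 * M, +oo[%R] u0)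
  (lu1 : locally_integrable [set` `]2 * M, +oo[%R] u1)
  (su0 : forall r, 2 * M < r -> u0 r != 0 -> `|tortoise M r| <= R0)
  (su1 : forall r, 2 * M < r -> u1 r != 0 -> `|tortoise M r| <= R0).

Let mK : measurable K. Proof. exact: measurable_slab. Qed.
Let Kfin : (m K < +oo)%E. Proof. exact: slab_fin. Qed.
Let T'0 : 0 < T'. Proof. by have /andP[] := T'T. Qed.
Let T'ltT : T' < T. Proof. by have /andP[] := T'T. Qed.

Definition fieldU (z : X) : R := U z.1.1 z.1.2.
Definition fieldut (z : X) : R := ut z.1.1 z.1.2 z.2.
Definition source (z : X) : R := `|ut z.1.1 z.1.2 z.2| `^ p.

Definition bmeas2 (q : R -> R -> R) : Prop := bmeas K (fun z => q z.1.1 z.1.2).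

Definition pairing (f : X -> R) (q : R -> R -> R) : R :=
  (\int[m]_(z in K) (f z * (q z.1.1 z.1.2 * z.1.2 ^+ n.-1)))%R.

Definition trace (f : R -> R) : R :=
  (\int[mu]_(r in `[a, b]) (f r * r ^+ n.-1))%R.

Lemma bmeas2_time (d : R) (th : R -> R) : 0 < d ->
  (forall t, - d < t -> {for t, continuous th}) -> bmeas2 (fun t _ => th t).
Proof. move=> d0 cth; by apply: bmeas_time d0 cth. Qed.

Lemma bmeas2_radius (c : R -> R) :
  (forall r, 2 * M < r -> {for r, continuous c}) -> bmeas2 (fun _ r => c r).
Proof. move=> cc; by apply: (bmeas_radius n T' b a2M cc). Qed.

Lemma bmeas2_lightcut : bmeas2 h.
Proof. exact: bmeas_lightcut. Qed.

Lemma bmeas2M q q' : bmeas2 q -> bmeas2 q' -> bmeas2 (fun t r => q t r * q' t r).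
Proof. by move=> cq cq'; exact: (bmeasM cq cq'). Qed.

Lemma bmeas2D q q' : bmeas2 q -> bmeas2 q' -> bmeas2 (fun t r => q t r + q' t r).
Proof. by move=> cq cq'; exact: (bmeasD cq cq'). Qed.

Lemma bmeas2N q : bmeas2 q -> bmeas2 (fun t r => - q t r).
Proof. by move=> cq; exact: (bmeasN cq). Qed.

Lemma bmeas2_weight q : bmeas2 q -> bmeas K (fun z => q z.1.1 z.1.2 * z.1.2 ^+ n.-1).
Proof.
move=> cq; apply: bmeasM cq _; apply: (@bmeas_radius R n M T' a b a2M (fun r => r ^+ n.-1)) => r r2.
exact: (Ck_continuous (CkX n.-1 openT (Ck_id 0 openT)) I).
Qed.

Lemma integrable_U : integrable_on m K fieldU.
Proof.
have [mU iU] := Lq_loc_integrable T'T a2M ab lU.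
apply: (integrable_on_le mK mU iU) => z Kz.
by rewrite powRr1// normr_id.
Qed.

Lemma integrable_source : integrable_on m K source.
Proof. by have [_] := Lq_loc_integrable T'T a2M ab lut. Qed.

(** |x| <= 1 + |x|^p. *)
Lemma integrable_ut : integrable_on m K fieldut.
Proof.
have [mut _] := Lq_loc_integrable T'T a2M ab lut.
have i1 := bmeas_integrable mK Kfin (bmeas_cst K 1).
have i2 := integrable_onD mK i1 integrable_source.
apply: (integrable_on_le mK mut i2) => z Kz.
rewrite [leRHS]ger0_norm ?addr_ge0 ?powR_ge0// /source /fieldut.
have [x1|x1] := leP `|ut z.1.1 z.1.2 z.2| 1.
  by rewrite (le_trans x1)// lerDl powR_ge0.
rewrite (@le_trans _ _ (`|ut z.1.1 z.1.2 z.2| `^ p))//; last by rewrite lerDr.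
by rewrite -[leLHS]powRr1// ler_powR// ltW.
Qed.

Lemma pairing_lin f (k k' : R) q q' : integrable_on m K f -> bmeas2 q -> bmeas2 q' ->
  pairing f (fun t r => k * q t r + k' * q' t r) =
  k * pairing f q + k' * pairing f q'.
Proof.
move=> fi /bmeas2_weight cq /bmeas2_weight cq'.
rewrite /pairing -(Rintegral_lin mK); [|exact: (integrable_onM mK)..].
by apply: Rintegral_eq => z _; ring.
Qed.

Lemma pairing_eq f q q' :
  (forall t r w, 0 < t <= T' -> a <= r <= b -> f (t, r, w) * q t r = f (t, r, w) * q' t r) ->
  pairing f q = pairing f q'.
Proof.
move=> H; apply: Rintegral_eq => -[[t r] w] /slabP[tT rb ws].
by rewrite !mulrA /= H.
Qed.

(** Coefficients of U matter only in the light cone, where [lightcut] is 1. *)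
Lemma pairing_eqU q q' :
  (forall t r, 0 < t <= T' -> a <= r <= b -> `|tortoise M r| <= t + R0 ->
     q t r = q' t r) -> pairing fieldU q = pairing fieldU q'.
Proof.
move=> H; apply: pairing_eq => t r w tT rb; rewrite /fieldU/=.
have [->|U0] := eqVneq (U t r) 0; first by rewrite !mul0r.
rewrite H//; apply: Usupp => //.
  by have /andP[-> /le_lt_trans->] := tT.
by have /andP[/(lt_le_trans a2M)] := rb.
Qed.

Lemma cone_test_slab (eta c : R -> R) (t r : R) (w : 'rV[R]_n) :
  (forall t, T' <= t -> eta t = 0) -> 0 < t < T -> 2 * M < r -> sphere w ->
  ~ K (t, r, w) -> cone_test M R0 eta c t r w = 0.
Proof.
move=> eta0 /andP[t0 tT] r2 ws nK; rewrite /cone_test.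
have [tT'|tT'] := leP T' t; first by rewrite eta0// !mul0r.
have [->|h0] := eqVneq (h t r) 0; first by rewrite mulr0.
case: nK; apply/slabP; split=> //; first by rewrite t0 ltW.
apply: window => //; rewrite (le_trans (lightcut_supp h0))// !lerD2r ltW//.
Qed.

Lemma pairing_iterated (g : R -> R -> 'rV[R]_n -> R) (f : X -> R)
    (q : R -> R -> R) : integrable_on m K f -> bmeas2 q ->
  (forall t r w, 0 < t < T -> 2 * M < r -> sphere w ->
    g t r w = f (t, r, w) * q t r) ->
  (forall t r w, 0 < t < T -> 2 * M < r -> sphere w -> ~ K (t, r, w) ->
    g t r w = 0) ->
  integral_time_Omega M T g = (pairing f q)%:E.
Proof.
move=> fi cq gfq g0.
have E z : K z -> f z * (q z.1.1 z.1.2 * z.1.2 ^+ n.-1) =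
    g z.1.1 z.1.2 z.2 * z.1.2 ^+ n.-1.
  move: z => [[t r] w] /slabP[/andP[t0 tT'] /andP[ar rb] ws] /=.
  by rewrite mulrA gfq// ?t0 ?(le_lt_trans tT')// (lt_le_trans a2M).
rewrite (integral_time_Omega_slab T'T a2M g0).
  by congr EFin; apply: Rintegral_eq => z /E.
exact: (integrable_on_eq mK E (integrable_onM mK fi (bmeas2_weight cq))).
Qed.

Lemma continuous_radial_laplacian (c : R -> R) r : 2 * M < r ->
  Ck 2 [set r | 2 * M < r] c -> {for r, continuous (radial_laplacian n M c)}.
Proof.
move=> r2 Hc; have o2 : open [set r : R | 2 * M < r] by exact: open_gt.
have C1 : Ck 1 [set r | 2 * M < r]
    (fun x : R => x ^+ n.-1 * F_S M x * 'D_1 c x).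
  exact: (CkM o2 (CkM o2 (CkX n.-1 o2 (Ck_id 1 o2)) (Ck_F_S M0 1)) (Ck_D1 Hc)).
have pos (x : R) : 2 * M < x -> 0 < x ^+ n.-1.
  by move=> x2; rewrite exprn_gt0// (radius_gt0 M0).
have C2 : Ck 0 [set r | 2 * M < r] (fun x : R => (x ^+ n.-1)^-1).
  exact: (Ck_comp o2 (@open_gt R 0) pos (Ck_inv 0) (CkX n.-1 o2 (Ck_id 0 o2))).
exact: (Ck_continuous (CkM o2 C2 (Ck_D1 C1)) r2).
Qed.

Lemma lightcut_data r : 2 * M < r -> `|tortoise M r| <= R0 -> h 0 r = 1.
Proof. by move=> r2 H; apply: lightcut1; rewrite add0r (le_trans H)// lerDl. Qed.

Lemma integrable_data (f c : R -> R) :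
  locally_integrable [set` `]2 * M, +oo[%R] f ->
  (forall r, 2 * M < r -> {for r, continuous c}) ->
  integrable_on mu `[a, b] (fun r => f r * c r).
Proof.
move=> lf cc; have fi := locally_integrable_segment b a2M lf.
have mab : measurable (`[a, b] : set TR) by [].
exact: (integrable_onM mab fi (bmeas_segment b a2M cc)).
Qed.

Lemma data_window r : 2 * M < r -> `|tortoise M r| <= R0 -> a <= r <= b.
Proof. by move=> r2 H; apply: window => //; rewrite (le_trans H)//; have := T'0; lra. Qed.

(** The weak formulation on a localized test function; the cutoff stays in the
    term with |u_t|^p, since the support condition bears on u. *)
Lemma weak_identity (d : R) (eta c : R -> R) : 0 < d ->
  Ck 2 [set t | - d < t] eta -> Ck 2 [set r | 2 * M < r] c ->
  (forall t, T' <= t -> eta t = 0) ->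
  pairing source (fun t r => eta t * c r * h t r) +
  eps * (sphere_area n * trace (fun r =>
    (u1 r * (eta 0 * c r) - u0 r * ('D_1 eta 0 * c r)) / F_S M r
    + D r * u0 r * (eta 0 * c r))) =
  pairing fieldU (fun t r => 'D_1 ('D_1 eta) t * c r / F_S M r
    - eta t * radial_laplacian n M c r - D r * ('D_1 eta t * c r)
    + V r * (eta t * c r)).
Proof.
move=> d0 Heta Hc eta0.
have d0' : - d < 0 by rewrite oppr_lt0.
have ceta : bmeas2 (fun t _ => eta t).
  by apply: bmeas2_time d0 _ => t td; exact: Ck_continuous Heta td.
have cD1 : bmeas2 (fun t _ => 'D_1 eta t).
  by apply: bmeas2_time d0 _ => t td; exact: Ck_continuous (Ck_D1 Heta) td.
have cD2 : bmeas2 (fun t _ => 'D_1 ('D_1 eta) t).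
  by apply: bmeas2_time d0 _ => t td; exact: Ck_continuous (Ck_D1 (Ck_D1 Heta)) td.
have cont_c r : 2 * M < r -> {for r, continuous c}.
  by move=> r2; exact: Ck_continuous Hc r2.
have cont_F r : 2 * M < r -> {for r, continuous (fun r => (F_S M r)^-1)}.
  by move=> r2; exact: Ck_continuous (Ck_F_S_inv M0 0) r2.
have cont_n r : 2 * M < r -> {for r, continuous (fun r : R => r ^+ n.-1)}.
  by move=> r2; exact: (Ck_continuous (CkX n.-1 openT (Ck_id 0 openT)) I).
have cc : bmeas2 (fun _ r => c r) by exact: bmeas2_radius.
have cF : bmeas2 (fun _ r => (F_S M r)^-1) by exact: bmeas2_radius.
have cL : bmeas2 (fun _ r => radial_laplacian n M c r).
  by apply: bmeas2_radius => r r2; exact: continuous_radial_laplacian.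
have cDD : bmeas2 (fun _ r => D r) by exact: bmeas2_radius.
have cVV : bmeas2 (fun _ r => V r) by exact: bmeas2_radius.
have := Uweak (cone_test_function n R0 M0 T'T d0 Heta Hc eta0).
rewrite (pairing_iterated integrable_source
  (bmeas2M (bmeas2M ceta cc) bmeas2_lightcut)); last 2 first.
- by [].
- by move=> t r w tT r2 ws nK; rewrite (cone_test_slab c eta0)// mulr0.
pose Q t r := 'D_1 ('D_1 eta) t * c r / F_S M r
    - eta t * radial_laplacian n M c r - D r * ('D_1 eta t * c r)
    + V r * (eta t * c r).
have cQ : bmeas2 Q.
  apply: bmeas2D (bmeas2M cVV (bmeas2M ceta cc)).
  apply: bmeas2D (bmeas2N (bmeas2M cDD (bmeas2M cD1 cc))).
  apply: bmeas2D (bmeas2N (bmeas2M ceta cL)).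
  exact: bmeas2M (bmeas2M cD2 cc) cF.
have EQ t r (w : 'rV[R]_n) : 0 < t < T -> 2 * M < r -> U t r != 0 ->
    derive1n 2 (fun x => cone_test M R0 eta c x r w) t / F_S M r
      - laplace_gS M (cone_test M R0 eta c t) r w
      - D r * derive1 (fun x => cone_test M R0 eta c x r w) t
      + V r * cone_test M R0 eta c t r w = Q t r.
  move=> /andP[t0 tT] r2 U0; have H : `|tortoise M r| <= t + R0.
    by apply: Usupp => //; rewrite t0.
  have td : - d < t by rewrite (lt_trans d0').
  rewrite (cone_test_derive2 _ _ td Heta H) (cone_test_derive1 _ _ td Heta H).
  have h1 : h t r = 1 by apply: lightcut1; rewrite (le_trans H)// lerDl.
  by rewrite (cone_test_laplacian M0 _ _ r2 Hc H) /Q /cone_test h1 mulr1.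
rewrite (pairing_iterated integrable_U cQ); last 2 first.
- move=> t r w tT r2 ws; rewrite /fieldU/=.
  by have [->|U0] := eqVneq (U t r) 0; rewrite ?mul0r// EQ.
- move=> t r w tT r2 ws nK; have [->|U0] := eqVneq (U t r) 0; first by rewrite mul0r.
  rewrite EQ//; have H : `|tortoise M r| <= t + R0 by exact: Usupp.
  have [tT'|tT'] := leP t T'.
    case: nK; apply/slabP; split=> //; first by have /andP[-> _] := tT; rewrite tT'.
    by apply: window => //; rewrite (le_trans H)//; lra.
  have D1z x : T' < x -> 'D_1 eta x = 0.
    move=> xT; apply: derD1; apply: (der_near _ (derC x 0)).
    near=> y; apply: eta0; apply: ltW; near: y; exact: lt_nbhsr.
  have D2z : 'D_1 ('D_1 eta) t = 0.
    apply: derD1; apply: (der_near _ (derC t 0)).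
    near=> y; apply: D1z; near: y; exact: lt_nbhsr.
  by rewrite /Q D1z// D2z eta0 ?ltW// !(mul0r, mulr0, subr0, addr0).
pose g r := (u1 r * (eta 0 * c r) - u0 r * ('D_1 eta 0 * c r)) / F_S M r
    + D r * u0 r * (eta 0 * c r).
have Eg : integral_Omega M (fun r (w : 'rV[R]_n) =>
     (u1 r * cone_test M R0 eta c 0 r w
      - u0 r * derive1 (fun t => cone_test M R0 eta c t r w) 0) / F_S M r
     + D r * u0 r * cone_test M R0 eta c 0 r w) =
    integral_Omega M (fun r (_ : 'rV[R]_n) => g r).
  apply: eq_integral => r; rewrite inE/= in_itv/= andbT => r2.
  apply: eq_integral => w _; congr ((_ * _)%:E); rewrite /g.
  have E1 : u1 r * cone_test M R0 eta c 0 r w = u1 r * (eta 0 * c r).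
    have [->|U1] := eqVneq (u1 r) 0; first by rewrite !mul0r.
    by rewrite /cone_test lightcut_data ?mulr1//; exact: su1.
  have E2 : u0 r * derive1 (fun t => cone_test M R0 eta c t r w) 0 =
      u0 r * ('D_1 eta 0 * c r).
    have [->|U0] := eqVneq (u0 r) 0; first by rewrite !mul0r.
    by rewrite (cone_test_derive1 _ _ d0' Heta)// add0r; exact: su0.
  have E3 : u0 r * cone_test M R0 eta c 0 r w = u0 r * (eta 0 * c r).
    have [->|U0] := eqVneq (u0 r) 0; first by rewrite !mul0r.
    by rewrite /cone_test lightcut_data ?mulr1//; exact: su0.
  by rewrite E1 E2 -!(mulrA (D r)) E3.
rewrite Eg (@integral_Omega_radial R n M a b a2M g); last 2 first.
- move=> r r2 rab.
  have u00 : u0 r = 0.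
    by apply/eqP; apply: contrapT => /negP U0; apply/rab/data_window/su0.
  have u10 : u1 r = 0.
    by apply/eqP; apply: contrapT => /negP U0; apply/rab/data_window/su1.
  by rewrite /g u00 u10 !(mul0r, mulr0, subr0, addr0).
- have i1 := @integrable_data u1 (fun r => eta 0 * c r / F_S M r * r ^+ n.-1) lu1 _.
  have i2 := @integrable_data u0 (fun r =>
    (D r * (eta 0 * c r) - 'D_1 eta 0 * c r / F_S M r) * r ^+ n.-1) lu0 _.
  have mab : measurable (`[a, b] : set TR) by [].
  apply: (integrable_on_eq mab _ (integrable_onD mab (i1 _) (i2 _))).
  + by move=> r _; rewrite /g; ring.
  + move=> r r2; apply: continuousM; last exact: cont_n.
    apply: continuousM; last exact: cont_F.
    by apply: continuousM; [exact: cvg_cst|exact: cont_c].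
  + move=> r r2; apply: continuousM; last exact: cont_n.
    apply: continuousB.
      apply: continuousM; first exact: cD.
      by apply: continuousM; [exact: cvg_cst|exact: cont_c].
    apply: continuousM; last exact: cont_F.
    by apply: continuousM; [exact: cvg_cst|exact: cont_c].
by rewrite -EFinM -EFinD => -[].
Unshelve. all: by end_near. Qed.

(** The definition of the weak time derivative gives integration by parts in t
    for weights that vanish near t = 0. *)
Lemma dt_identity (d t0 : R) (th c : R -> R) : 0 < d -> 0 < t0 ->
  Ck 2 [set t | - d < t] th -> Ck 2 [set r | 2 * M < r] c ->
  (forall t, T' <= t -> th t = 0) -> (forall t, t < t0 -> th t = 0) ->
  pairing fieldU (fun t r => 'D_1 th t * c r) =
  - pairing fieldut (fun t r => th t * c r * h t r).
Proof.
move=> d0 t00 Hth Hc th0 th0'.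
have d0' : - d < 0 by rewrite oppr_lt0.
have cth : bmeas2 (fun t _ => th t).
  by apply: bmeas2_time d0 _ => t td; exact: Ck_continuous Hth td.
have cD1 : bmeas2 (fun t _ => 'D_1 th t).
  by apply: bmeas2_time d0 _ => t td; exact: Ck_continuous (Ck_D1 Hth) td.
have cc : bmeas2 (fun _ r => c r).
  by apply: bmeas2_radius => r r2; exact: Ck_continuous Hc r2.
have test : test_function_int M T (@cone_test R n M R0 th c).
  split; first exact: (cone_test_function n R0 M0 T'T d0 Hth Hc th0).
  by exists t0 => // t r w tt0 _ _; rewrite /cone_test th0'// !mul0r.
have := Udt test.
rewrite [X in (- X)%E](pairing_iterated integrable_ut
  (bmeas2M (bmeas2M cth cc) bmeas2_lightcut)); last 2 first.
- by [].
- by move=> t r w tT r2 ws nK; rewrite (cone_test_slab c th0)// mulr0.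
have E t r (w : 'rV[R]_n) : 0 < t < T -> 2 * M < r -> U t r != 0 ->
    derive1 (fun x => cone_test M R0 th c x r w) t = 'D_1 th t * c r.
  move=> /andP[t0' tT] r2 U0; have H : `|tortoise M r| <= t + R0.
    by apply: Usupp => //; rewrite t0'.
  by rewrite (cone_test_derive1 _ _ _ Hth H)// (lt_trans d0').
rewrite (pairing_iterated integrable_U (bmeas2M cD1 cc)); last 2 first.
- move=> t r w tT r2 ws; rewrite /fieldU/=.
  by have [->|U0] := eqVneq (U t r) 0; rewrite ?mul0r// E.
- move=> t r w tT r2 ws nK; have [->|U0] := eqVneq (U t r) 0; first by rewrite mul0r.
  rewrite E//; have H : `|tortoise M r| <= t + R0 by exact: Usupp.
  have [tT'|tT'] := leP t T'.
    case: nK; apply/slabP; split=> //; first by have /andP[-> _] := tT; rewrite tT'.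
    by apply: window => //; rewrite (le_trans H)//; lra.
  have -> : 'D_1 th t = 0.
    apply: derD1; apply: (der_near _ (derC t 0)).
    near=> y; apply: th0; apply: ltW; near: y; exact: lt_nbhsr.
  by rewrite mul0r mulr0.
by rewrite -EFinN => -[].
Unshelve. all: by end_near. Qed.

Lemma pairing_layer_cvg f (a_ : nat -> R -> R) q (C : R) :
  integrable_on m K f -> bmeas2 q ->
  (forall j, bmeas2 (fun t _ => a_ j t)) ->
  (forall j t, 0 < t -> `|a_ j t| <= C) ->
  (forall t, 0 < t -> a_ ^~ t @ \oo --> (0 : R)) ->
  (fun j => pairing f (fun t r => a_ j t * q t r)) @ \oo --> (0 : R).
Proof.
move=> fi cq ca ba a0.
have fq := integrable_onM mK fi (bmeas2_weight cq).
have mc : measurable_fun K (fun _ : X => 0 : R) by exact: measurable_cst.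
have ma j : measurable_fun K (fun z : X => a_ j z.1.1) by exact: (ca j).1.
have := Rintegral_bounded_cvg mK fq ma mc (C := C).
rewrite (_ : (\int[m]_(z in K) _)%R = 0); last first.
  by under eq_Rintegral do rewrite mulr0; rewrite Rintegral_cst// mul0r.
rewrite (_ : (fun j => pairing f _) = (fun j => \int[m]_(z in K)
    (f z * (q z.1.1 z.1.2 * z.1.2 ^+ n.-1) * a_ j z.1.1))%R); last first.
  by apply/funext => j; apply: Rintegral_eq => z _; ring.
apply.
- by move=> j [[t r] w] /slabP[/andP[t0 _] _ _]; exact: ba.
- by move=> [[t r] w] /slabP[/andP[t0 _] _ _]; exact: a0.
Qed.

Lemma trace_lin (k k' : R) (f g : R -> R) :
  integrable_on mu `[a, b] (fun r => f r * r ^+ n.-1) ->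
  integrable_on mu `[a, b] (fun r => g r * r ^+ n.-1) ->
  trace (fun r => k * f r + k' * g r) = k * trace f + k' * trace g.
Proof.
move=> fi gi; have mab : measurable (`[a, b] : set TR) by [].
rewrite /trace -(Rintegral_lin mab)//.
by apply: Rintegral_eq => r _; ring.
Qed.

Lemma integrable_trace (f c : R -> R) :
  locally_integrable [set` `]2 * M, +oo[%R] f ->
  (forall r, 2 * M < r -> {for r, continuous c}) ->
  integrable_on mu `[a, b] (fun r => f r * c r * r ^+ n.-1).
Proof.
move=> lf cc; have mab : measurable (`[a, b] : set TR) by [].
have H := @integrable_data f (fun r => c r * r ^+ n.-1) lf _.
apply: (integrable_on_eq mab _ (H _)) => [r _|r r2]; first by rewrite mulrA.
apply: continuousM; first exact: cc.
exact: (Ck_continuous (CkX n.-1 openT (Ck_id 0 openT)) I).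
Qed.

(** Integration by parts in t with the boundary term at t = 0. The weak time
    derivative is only tested away from t = 0, so the initial value has to be
    extracted from the equation itself. Two test functions are used: th times
    1 - layer in the definition of the weak derivative, and th times the
    primitive of the layer, times c F, in the equation. Both produce the
    singular term th layer' c U, which cancels; the second also produces the
    initial value, because the primitive has derivative -1 at t = 0. All other
    terms tend to 0 by dominated convergence. *)
Lemma trace_identity (d : R) (th c : R -> R) : 0 < d ->
  Ck 2 [set t | - d < t] th -> Ck 2 [set r | 2 * M < r] c ->
  (forall t, T' <= t -> th t = 0) ->
  pairing fieldU (fun t r => 'D_1 th t * c r) =
  - pairing fieldut (fun t r => th t * c r * h t r)
  - eps * (sphere_area n * (th 0 * trace (fun r => u0 r * c r))).
Proof.
move=> d0 Hth Hc th0.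
have d0' : - d < 0 by rewrite oppr_lt0.
have o2 : open [set r : R | 2 * M < r] by exact: open_gt.
pose cF r := c r * F_S M r.
have HcF : Ck 2 [set r | 2 * M < r] cF := CkM o2 Hc (Ck_F_S M0 2).
pose L r := radial_laplacian n M cF r.
have cth : bmeas2 (fun t _ => th t).
  by apply: bmeas2_time d0 _ => t td; exact: Ck_continuous Hth td.
have cD1 : bmeas2 (fun t _ => 'D_1 th t).
  by apply: bmeas2_time d0 _ => t td; exact: Ck_continuous (Ck_D1 Hth) td.
have cD2 : bmeas2 (fun t _ => 'D_1 ('D_1 th) t).
  by apply: bmeas2_time d0 _ => t td; exact: Ck_continuous (Ck_D1 (Ck_D1 Hth)) td.
have cont_c r : 2 * M < r -> {for r, continuous c}.
  by move=> r2; exact: Ck_continuous Hc r2.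
have cont_cF r : 2 * M < r -> {for r, continuous cF}.
  by move=> r2; exact: Ck_continuous HcF r2.
have cc : bmeas2 (fun _ r => c r) by exact: bmeas2_radius.
have ccF : bmeas2 (fun _ r => cF r) by exact: bmeas2_radius.
have cL : bmeas2 (fun _ r => L r).
  by apply: bmeas2_radius => r r2; exact: continuous_radial_laplacian.
have cDD : bmeas2 (fun _ r => D r) by exact: bmeas2_radius.
have cVV : bmeas2 (fun _ r => V r) by exact: bmeas2_radius.
have clay j : bmeas2 (fun t _ => layer j t).
  by apply: bmeas2_time ltr01 _ => t _; exact: (Ck_continuous (Ck_layer j) I).
have jinv j : 0 < j.+1%:R^-1 :> R by rewrite invr_gt0 ltr0n.
have cprim j : bmeas2 (fun t _ => layer_primitive j t).
  by apply: bmeas2_time (jinv j) _ => t td; exact: Ck_continuous (Ck_layer_primitive j) td.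
pose q0 t r := th t * cF r * h t r.
pose q1 t r := 'D_1 ('D_1 th) t * c r - th t * L r - D r * ('D_1 th t * cF r)
  + V r * (th t * cF r).
pose q2 t r := D r * (th t * cF r) - 2 * ('D_1 th t * c r).
pose q3 t r := th t * c r * h t r.
have cq0 : bmeas2 q0 := bmeas2M (bmeas2M cth ccF) bmeas2_lightcut.
have cq3 : bmeas2 q3 := bmeas2M (bmeas2M cth cc) bmeas2_lightcut.
have cq1 : bmeas2 q1.
  apply: bmeas2D (bmeas2M cVV (bmeas2M cth ccF)).
  apply: bmeas2D (bmeas2N (bmeas2M cDD (bmeas2M cD1 ccF))).
  exact: bmeas2D (bmeas2M cD2 cc) (bmeas2N (bmeas2M cth cL)).
have c2 : bmeas2 (fun _ _ => 2) by exact: bmeas_cst.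
have cq2 : bmeas2 q2.
  exact: bmeas2D (bmeas2M cDD (bmeas2M cth ccF)) (bmeas2N (bmeas2M c2 (bmeas2M cD1 cc))).
pose A := trace (fun r => (u1 r * th 0 - u0 r * 'D_1 th 0) * c r
  + D r * u0 r * (th 0 * cF r)).
pose B := trace (fun r => u0 r * c r).
pose E (j : nat) (t : R) : R := layer_primitive j t.
(* The weak derivative tested with th (1 - layer j) c. *)
have I1 j : pairing fieldU (fun t r => 'D_1 th t * c r)
    - pairing fieldU (fun t r => layer j t * ('D_1 th t * c r))
    - pairing fieldU (fun t r => th t * 'D_1 (layer j) t * c r) =
    - pairing fieldut q3 + pairing fieldut (fun t r => layer j t * q3 t r).
  have od : open [set t : R | - d < t] by exact: open_gt.
  have Hlay : Ck 2 [set t | - d < t] (layer j).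
    exact: Ck_sub (@subsetT _ _) (Ck_le (leqnSn 2) (Ck_layer j)).
  have H1 : Ck 2 [set t | - d < t] (fun t => th t * (1 - layer j t)).
    exact: (CkM od Hth (CkD od (Ck_cst 2 _ 1) (CkN od Hlay))).
  have := @dt_identity d j.+1%:R^-1 _ c d0 (jinv j) H1 Hc _ _.
  rewrite (@pairing_eqU (fun t r => 'D_1 (fun t => th t * (1 - layer j t)) t * c r)
    (fun t r => 1 * ('D_1 th t * c r) + (- 1) * (layer j t * ('D_1 th t * c r)
      + th t * 'D_1 (layer j) t * c r))); last first.
    move=> t r /andP[t0 _] _ _; have td : - d < t by rewrite (lt_trans d0').
    rewrite (derD1 (derM (Ck_is_derive Hth td) (derD (derC t 1)
      (derN (Ck_is_derive Hlay td))))); ring.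
  have cDl : bmeas2 (fun t _ => 'D_1 (layer j) t).
    by apply: bmeas2_time d0 _ => t td; exact: Ck_continuous (Ck_D1 Hlay) td.
  have b1 := bmeas2M cD1 cc; have b2 := bmeas2M (clay j) b1.
  have b3 := bmeas2M (bmeas2M cth cDl) cc.
  rewrite (pairing_lin 1 (-1) integrable_U b1 (bmeas2D b2 b3)).
  have -> : pairing fieldU (fun t r => layer j t * ('D_1 th t * c r)
      + th t * 'D_1 (layer j) t * c r) =
    pairing fieldU (fun t r => 1 * (layer j t * ('D_1 th t * c r))
      + 1 * (th t * 'D_1 (layer j) t * c r)).
    by apply: pairing_eq => t r w _ _; rewrite !mul1r.
  rewrite (pairing_lin 1 1 integrable_U b2 b3).
  rewrite (@pairing_eq fieldut _ (fun t r => 1 * q3 t r + (-1) * (layer j t * q3 t r)));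
    last by move=> t r w _ _; rewrite /q3; ring.
  rewrite (pairing_lin 1 (-1) integrable_ut cq3 (bmeas2M (clay j) cq3)).
  move=> H; have {}H := H _ _; rewrite !mul1r !mulN1r in H.
  transitivity (- (pairing fieldut q3 - pairing fieldut (fun t r => layer j t * q3 t r))).
    rewrite -H; first by ring.
    - by move=> t tT; rewrite th0// mul0r.
    - by move=> t tj; rewrite layer_near0 ?ltW// subrr mulr0.
  by ring.
(* The equation tested with th E c F; the factor F cancels the weight 1/F of
   the second time derivative. *)
have I2 j : pairing source (fun t r => E j t * q0 t r)
    + eps * (sphere_area n * (E j 0 * A + th 0 * B)) =
    pairing fieldU (fun t r => E j t * q1 t r)
    + pairing fieldU (fun t r => layer j t * q2 t r)
    - pairing fieldU (fun t r => th t * 'D_1 (layer j) t * c r).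
  pose dj : R := Num.min d j.+1%:R^-1.
  have dj0 : 0 < dj by rewrite lt_min d0 jinv.
  have odj : open [set t : R | - dj < t] by exact: open_gt.
  have sd (t : R) : - dj < t -> - d < t.
    by apply: le_lt_trans; rewrite lerN2 ge_min lexx.
  have sj (t : R) : - dj < t -> - j.+1%:R^-1 < t.
    by apply: le_lt_trans; rewrite lerN2 ge_min lexx orbT.
  have Hth' := Ck_sub sd Hth.
  have HE : Ck 2 [set t | - dj < t] (E j).
    exact: Ck_sub sj (Ck_le (leqnSn 2) (Ck_layer_primitive j)).
  have HthE := CkM odj Hth' HE.
  have dE t : - dj < t -> is_derive t 1 (E j) (- layer j t).
    by move=> td; exact: is_derive_layer_primitive (sj _ td).
  have D1E t : - dj < t -> 'D_1 (fun t => th t * E j t) t =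
      'D_1 th t * E j t - th t * layer j t.
    move=> td; rewrite (derD1 (derM (Ck_is_derive Hth' td) (dE t td))).
    by rewrite mulrN.
  have D2E t : - dj < t -> 'D_1 ('D_1 (fun t => th t * E j t)) t =
      'D_1 ('D_1 th) t * E j t - 2 * 'D_1 th t * layer j t
      - th t * 'D_1 (layer j) t.
    move=> td; apply: derD1.
    have Hl := Ck_is_derive (Ck_layer j) (I : setT t).
    have H := derD (derM (Ck_is_derive (Ck_D1 Hth') td) (dE t td))
      (derN (derM (Ck_is_derive Hth' td) Hl)).
    apply: (@der_near R t _ (fun t => 'D_1 th t * E j t + - (th t * layer j t))).
      near=> x; apply: D1E; near: x; exact: lt_nbhsr.
    by apply: is_derive_eq H _; ring.
  have dj0' : - dj < 0 by rewrite oppr_lt0.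
  have E0 : layer j (0 : R) = 1 by apply: layer_near0; exact: ltW (jinv j).
  have := @weak_identity dj _ cF dj0 HthE HcF _.
  rewrite D1E// E0 mulr1.
  rewrite (@pairing_eq source _ (fun t r => E j t * q0 t r)); last first.
    by move=> t r w _ _; rewrite /q0; ring.
  have F0 r : 2 * M < r -> F_S M r != 0 by move=> r2; rewrite gt_eqF// F_S_gt0.
  have -> : trace (fun r => (u1 r * (th 0 * E j 0 * cF r)
      - u0 r * (('D_1 th 0 * E j 0 - th 0) * cF r)) / F_S M r
      + D r * u0 r * (th 0 * E j 0 * cF r)) =
    trace (fun r => E j 0 * ((u1 r * th 0 - u0 r * 'D_1 th 0) * c r
      + D r * u0 r * (th 0 * cF r)) + th 0 * (u0 r * c r)).
    apply: Rintegral_eq => r; rewrite /= in_itv/= => /andP[ar _]; congr (_ * _).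
    have r2 := lt_le_trans a2M ar; rewrite /cF; field; exact: F0.
  rewrite trace_lin; last 2 first.
  - have i1 := @integrable_trace u1 (fun r => th 0 * c r) lu1 _.
    have i2 := @integrable_trace u0
      (fun r => D r * (th 0 * cF r) - 'D_1 th 0 * c r) lu0 _.
    have mab : measurable (`[a, b] : set TR) by [].
    apply: (integrable_on_eq mab _ (integrable_onD mab (i1 _) (i2 _))).
    + by move=> r _; ring.
    + by move=> r r2; apply: continuousM; [exact: cvg_cst|exact: cont_c].
    + move=> r r2; apply: continuousB.
        apply: continuousM; first exact: cD.
        by apply: continuousM; [exact: cvg_cst|exact: cont_cF].
      by apply: continuousM; [exact: cvg_cst|exact: cont_c].
  - exact: integrable_trace.
  rewrite -/A -/B => H; rewrite H; last by move=> t tT; rewrite th0// mul0r.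
  have cDl : bmeas2 (fun t _ => 'D_1 (layer j) t).
    by apply: bmeas2_time ltr01 _ => t _; exact: (Ck_continuous (Ck_D1 (Ck_layer j)) I).
  have b1 := bmeas2M (cprim j) cq1; have b2 := bmeas2M (clay j) cq2.
  have b3 := bmeas2M (bmeas2M cth cDl) cc.
  rewrite (@pairing_eqU _ (fun t r => 1 * (1 * (E j t * q1 t r) + 1 * (layer j t * q2 t r))
    + (-1) * (th t * 'D_1 (layer j) t * c r))); last first.
    move=> t r /andP[t0 _] /andP[ar _] _; have r2 := lt_le_trans a2M ar.
    have td : - dj < t by rewrite (lt_trans dj0').
    rewrite D1E// D2E// -/(L r) /q1 /q2 /cF; field; exact: F0.
  have b12 : bmeas2 (fun t r => 1 * (E j t * q1 t r) + 1 * (layer j t * q2 t r)).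
    have c1 : bmeas2 (fun _ _ => 1) by exact: bmeas_cst.
    exact: bmeas2D (bmeas2M c1 b1) (bmeas2M c1 b2).
  rewrite (pairing_lin 1 (-1) integrable_U b12 b3).
  by rewrite (pairing_lin 1 1 integrable_U b1 b2) !mul1r mulN1r.
(* S collects the terms that tend to 0; by I1 and I2 it does not depend on j. *)
pose S j := pairing fieldU (fun t r => layer j t * ('D_1 th t * c r))
  + pairing fieldU (fun t r => E j t * q1 t r)
  + pairing fieldU (fun t r => layer j t * q2 t r)
  - pairing source (fun t r => E j t * q0 t r)
  - eps * (sphere_area n * (E j 0 * A))
  + pairing fieldut (fun t r => layer j t * q3 t r).
have Sj j : S j = pairing fieldU (fun t r => 'D_1 th t * c r)
    + pairing fieldut q3 + eps * (sphere_area n * (th 0 * B)).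
  by rewrite /S; have := I1 j; have := I2 j; rewrite mulrDr mulrDr; lra.
have S0 : S @ \oo --> (0 : R).
  have l0 f q := @pairing_layer_cvg f (fun j => @layer R j) q 1.
  have e0 f q := @pairing_layer_cvg f E q 2.
  have lb j t : 0 < t -> `|@layer R j t| <= 1 by move=> _; exact: layer_norm.
  have eb j t : 0 < t -> `|E j t| <= 2.
    move=> t0; rewrite (le_trans (layer_primitive_norm j (ltW t0)))//.
    by rewrite ler_pdivrMr// ler_peMr// ler1n.
  have lc t : 0 < t -> (@layer R) ^~ t @ \oo --> (0 : R) by exact: layer_cvg.
  have ec t : 0 < t -> E ^~ t @ \oo --> (0 : R).
    by move=> /ltW; exact: layer_primitive_cvg.
  have -> : (0 : R) = 0 + 0 + 0 - 0 - eps * (sphere_area n * (0 * A)) + 0 by ring.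
  apply: cvgD; last exact: l0 integrable_ut cq3 clay lb lc.
  apply: cvgB; last first.
    apply: cvgM; first exact: cvg_cst.
    apply: cvgM; first exact: cvg_cst.
    by apply: cvgM; [exact: layer_primitive_cvg|exact: cvg_cst].
  apply: cvgB; last exact: e0 integrable_source cq0 cprim eb ec.
  apply: cvgD; last exact: l0 integrable_U cq2 clay lb lc.
  apply: cvgD; last exact: e0 integrable_U cq1 cprim eb ec.
  exact: l0 integrable_U (bmeas2M cD1 cc) clay lb lc.
have Sc : S = cst (S 0%N) by apply/funext => j; rewrite /cst !Sj.
have : S @ \oo --> S 0%N by rewrite {1}Sc; exact: cvg_cst.
move=> /(cvg_unique (@Rhausdorff R) S0) H; rewrite Sj in H.
by rewrite /q3 /B in H; lra.
Unshelve. all: by end_near. Qed.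

Lemma pairing_radius_cvg f (q : R -> R -> R) (c_ : nat -> R -> R) (c : R -> R) (C : R) :
  integrable_on m K f -> bmeas2 q ->
  (forall j r, 2 * M < r -> {for r, continuous (c_ j)}) ->
  (forall r, 2 * M < r -> {for r, continuous c}) ->
  (forall j r, 2 * M < r -> `|c_ j r| <= C) ->
  (forall r, a <= r <= b -> c_ ^~ r @ \oo --> c r) ->
  (fun j => pairing f (fun t r => q t r * c_ j r)) @ \oo -->
  pairing f (fun t r => q t r * c r).
Proof.
move=> fi cq cc_ cc bc cvc.
have fq := integrable_onM mK fi (bmeas2_weight cq).
have mc : measurable_fun K (fun z : X => c z.1.2) := (bmeas2_radius cc).1.
have mc_ j : measurable_fun K (fun z : X => c_ j z.1.2) := (bmeas2_radius (cc_ j)).1.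
have -> : (fun j => pairing f (fun t r => q t r * c_ j r)) = (fun j => \int[m]_(z in K)
    (f z * (q z.1.1 z.1.2 * z.1.2 ^+ n.-1) * c_ j z.1.2))%R.
  by apply/funext => j; apply: Rintegral_eq => z _; ring.
have -> : pairing f (fun t r => q t r * c r) = (\int[m]_(z in K)
    (f z * (q z.1.1 z.1.2 * z.1.2 ^+ n.-1) * c z.1.2))%R.
  by apply: Rintegral_eq => z _; ring.
apply: (Rintegral_bounded_cvg mK fq mc_ mc (C := C)).
- by move=> j [[t r] w] /slabP[_ /andP[ar _] _]; apply: bc; exact: lt_le_trans ar.
- by move=> [[t r] w] /slabP[_ rab _]; exact: cvc.
Qed.

(** The identity passes to the limit along [smooth_approximation]. The damping D
    is merely continuous, and the weight profile * D occurs below. *)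
Lemma continuous_trace_identity (d : R) (th c : R -> R) : 0 < d ->
  Ck 2 [set t | - d < t] th -> (forall r, 2 * M < r -> {for r, continuous c}) ->
  (forall t, T' <= t -> th t = 0) ->
  pairing fieldU (fun t r => 'D_1 th t * c r) =
  - pairing fieldut (fun t r => th t * c r * h t r)
  - eps * (sphere_area n * (th 0 * trace (fun r => u0 r * c r))).
Proof.
move=> d0 Hth cc th0.
have [c_ [C [Cc_ bc cvc]]] := smooth_approximation M0 a2M ab cc.
have cc_ j r : 2 * M < r -> {for r, continuous (c_ j)}.
  by move=> r2; exact: Ck_continuous (Cc_ j) r2.
have cth : bmeas2 (fun t _ => th t).
  by apply: bmeas2_time d0 _ => t td; exact: Ck_continuous Hth td.
have cD1 : bmeas2 (fun t _ => 'D_1 th t).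
  by apply: bmeas2_time d0 _ => t td; exact: Ck_continuous (Ck_D1 Hth) td.
have L1 := pairing_radius_cvg integrable_U cD1 cc_ cc bc cvc.
have L2 := pairing_radius_cvg integrable_ut (bmeas2M cth bmeas2_lightcut) cc_ cc bc cvc.
have L3 : (fun j => trace (fun r => u0 r * c_ j r)) @ \oo --> trace (fun r => u0 r * c r).
  have mab : measurable (`[a, b] : set TR) by [].
  have i0 : integrable_on mu `[a, b] (fun r => u0 r * 1 * r ^+ n.-1).
    by apply: (@integrable_trace u0 (fun=> 1) lu0) => r _; exact: cvg_cst.
  have -> : (fun j => trace (fun r => u0 r * c_ j r)) = (fun j => \int[mu]_(r in `[a, b])
      (u0 r * 1 * r ^+ n.-1 * c_ j r))%R.
    by apply/funext => j; apply: Rintegral_eq => r _; ring.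
  have -> : trace (fun r => u0 r * c r) = (\int[mu]_(r in `[a, b])
      (u0 r * 1 * r ^+ n.-1 * c r))%R.
    by apply: Rintegral_eq => r _; ring.
  have H := @Rintegral_bounded_cvg _ _ R _ _ mab _ c_ c C i0; apply: H.
  - by move=> j; exact: (bmeas_segment b a2M (cc_ j)).1.
  - exact: (bmeas_segment b a2M cc).1.
  - move=> j r; rewrite /= in_itv/= => /andP[ar _]; apply: bc; exact: lt_le_trans ar.
  - by move=> r; rewrite /= in_itv/=; exact: cvc.
have E j := trace_identity d0 Hth (Cc_ j) th0.
have L4 : (fun j => pairing fieldU (fun t r => 'D_1 th t * c_ j r)) @ \oo -->
    - pairing fieldut (fun t r => th t * h t r * c r)
    - eps * (sphere_area n * (th 0 * trace (fun r => u0 r * c r))).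
  have -> : (fun j => pairing fieldU (fun t r => 'D_1 th t * c_ j r)) =
    (fun j => - pairing fieldut (fun t r => th t * h t r * c_ j r)
    - eps * (sphere_area n * (th 0 * trace (fun r => u0 r * c_ j r)))).
    apply/funext => j; rewrite E; congr (- _ - _).
    by apply: pairing_eq => t r w _ _; ring.
  apply: cvgB; first exact: cvgN.
  apply: cvgM; first exact: cvg_cst.
  apply: cvgM; first exact: cvg_cst.
  by apply: cvgM; [exact: cvg_cst|exact: L3].
rewrite (cvg_unique (@Rhausdorff R) L1 L4); congr (- _ - _).
by apply: pairing_eq => t r w _ _; ring.
Qed.

(** * The energy identity *)

Section energy.
Variables (lam : R) (phi : R -> R) (CD : R) (d : R) (chi : R -> R).
Hypotheses (n0 : (0 < n)%N) (eps0 : 0 < eps) (lam0 : 0 < lam) (d0 : 0 < d).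
Hypothesis hphi : eigenfunction n M D V lam phi.
Hypothesis D_bound : forall r, 2 * M < r -> 0 <= D r <= CD.
Hypothesis u0_ge0 : forall r, 2 * M < r -> 0 <= u0 r.
Hypotheses (Hchi : Ck 3 [set t | - d < t] chi)
  (chi0 : forall t, T' <= t -> chi t = 0)
  (dchi_le0 : forall t, 0 <= t <= T' -> 'D_1 chi t <= 0)
  (ddchi_ge0 : forall t, 0 <= t <= T' -> 0 <= 'D_1 ('D_1 chi) t).

Local Notation bp := (profile n M phi).

Definition damped (f : R -> R) (t : R) : R := expR (- lam * t) * f t.

Let od : open [set t : R | - d < t]. Proof. exact: open_gt. Qed.
(* With eta = e^(-lam t) chi and th = e^(-lam t) chi' one has
   eta' + lam eta = th and eta'' - lam^2 eta = th' - lam th. *)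
Let th := damped ('D_1 chi).
Let eta := damped chi.

Let dexp (t : R) : is_derive t 1 (fun t => expR (- lam * t)) (- lam * expR (- lam * t)).
Proof.
have H := @derComp R t expR (fun t => - lam * t) _ _ (is_derive_expR _)
  (derM (derC t (- lam)) (derI t)).
by apply: is_derive_eq H _; ring.
Qed.

Lemma Ck_damped k (f : R -> R) : Ck k [set t | - d < t] f ->
  Ck k [set t | - d < t] (damped f).
Proof.
move=> Hf; have A := CkM od (Ck_cst k _ (- lam)) (Ck_id k od).
exact: (CkM od (Ck_comp od openT (fun _ _ => I) (Ck_expR k openT) A) Hf).
Qed.

Let Hth : Ck 2 [set t | - d < t] th. Proof. exact: Ck_damped (Ck_D1 Hchi). Qed.
Let Heta : Ck 2 [set t | - d < t] eta.
Proof. exact: Ck_damped (Ck_le (leqnSn 2) Hchi). Qed.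

Let dchi (t : R) : - d < t -> is_derive t 1 chi ('D_1 chi t).
Proof. exact: Ck_is_derive Hchi. Qed.

Let ddchi (t : R) : - d < t -> is_derive t 1 ('D_1 chi) ('D_1 ('D_1 chi) t).
Proof. exact: Ck_is_derive (Ck_D1 Hchi). Qed.

Let Dchi0 (t : R) : T' < t -> 'D_1 chi t = 0.
Proof.
move=> tT; apply: derD1; apply: (der_near _ (derC t 0)).
near=> y; apply: chi0; apply: ltW; near: y; exact: lt_nbhsr.
Unshelve. all: by end_near. Qed.

Let nd (t : R) : 0 <= t -> - d < t.
Proof. by apply: lt_le_trans; rewrite oppr_lt0. Qed.

Let DchiT' : 'D_1 chi T' = 0.
Proof.
have c1 : {for T', continuous ('D_1 chi)}.
  exact: (Ck_continuous (Ck_D1 Hchi) (nd (ltW T'0))).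
have : 'D_1 chi x @[x --> T'^'+] --> 'D_1 chi T' by exact: cvg_at_right_filter.
have : 'D_1 chi x @[x --> T'^'+] --> (0 : R).
  apply: cvg_near_cst; near=> x; apply: Dchi0; near: x; exact: nbhs_right_gt.
by move=> H /(cvg_unique (@Rhausdorff R) H) ->.
Unshelve. all: by end_near. Qed.

Let th0 t : T' <= t -> th t = 0.
Proof.
rewrite le_eqVlt /th /damped => /predU1P[<-|/Dchi0->]; last by rewrite mulr0.
by rewrite DchiT' mulr0.
Qed.

Let eta0 t : T' <= t -> eta t = 0.
Proof. by rewrite /eta /damped => /chi0 ->; rewrite mulr0. Qed.

(* Th is the primitive of th that vanishes from T' on. It makes every
   coefficient of U a time derivative, so that U can be traded for u_t. To
   have Th on both sides of t = 0, th is frozen below - d/2. *)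
Let d2 : R := d / 2.
Let d20 : 0 < d2. Proof. by rewrite divr_gt0. Qed.

Let thc (t : R) : R := th (Num.max t (- d2)).

Let cthc : continuous thc.
Proof.
move=> x; have c1 : {for x, continuous (fun y : R => Num.max y (- d2))}.
  by apply: continuous_max; [exact: cvg_id|exact: cvg_cst].
apply: (continuous_comp c1); apply: (Ck_continuous Hth).
rewrite /= lt_max; apply/orP; right; rewrite /d2; have := d0; lra.
Qed.

Let Th (t : R) : R := (\int[mu]_(x in `[- d2, t]) thc x
  - \int[mu]_(x in `[- d2, T']) thc x)%R.

Let dTh (t : R) : - d2 < t -> is_derive t 1 Th (th t).
Proof.
move=> td; have H := derD (antiderivative cthc td)
  (derC t (- \int[mu]_(x in `[- d2, T']) thc x)%R).
by apply: is_derive_eq H _; rewrite addr0 /thc max_l// ltW.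
Qed.

Let nd2 (t : R) : 0 <= t -> - d2 < t.
Proof. by apply: lt_le_trans; rewrite oppr_lt0. Qed.

Let sub2 (t : R) : - d2 < t -> - d < t.
Proof. by move=> H; apply: lt_trans H; rewrite /d2; have := d0; lra. Qed.

Let od2 : open [set t : R | - d2 < t]. Proof. exact: open_gt. Qed.

Let HTh : Ck 2 [set t | - d2 < t] Th.
Proof.
apply: (Ck_deriv od2 dTh); exact: (Ck_sub sub2 (Ck_le (leqnSn 1) Hth)).
Qed.

Let ThT' : Th T' = 0. Proof. by rewrite /Th subrr. Qed.

Let Th0 (t : R) : T' <= t -> Th t = 0.
Proof.
move=> tT; have dT z : T' <= z <= t -> is_derive z 1 Th (th z).
  by move=> /andP[zT _]; apply/dTh/nd2; rewrite (le_trans (ltW T'0)).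
apply/eqP; rewrite eq_le -{1}ThT'; apply/andP; split.
  by apply: derive_le0_le dT _ => // z /andP[/ltW/th0 -> _].
rewrite -ThT' -lerN2.
apply: (@derive_le0_le R (fun t => - Th t) (fun t => - th t)) => //.
  by move=> z /dT; exact: derN.
by move=> z /andP[/ltW/th0 -> _]; rewrite oppr0.
Qed.

Let th_le0 (t : R) : 0 <= t <= T' -> th t <= 0.
Proof. by move=> tT; rewrite pmulr_rle0 ?expR_gt0// dchi_le0. Qed.

Let Th_ge0 (t : R) : 0 <= t <= T' -> 0 <= Th t.
Proof.
move=> /andP[t0 tT]; rewrite -ThT'; apply: (@derive_le0_le R Th th) => //.
  by move=> z /andP[tz _]; apply/dTh/nd2/(le_trans t0).
by move=> z /andP[/ltW tz /ltW zT]; apply: th_le0; rewrite zT (le_trans t0).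
Qed.

(* -th - lam Th has derivative - e^(-lam t) chi'' <= 0 and vanishes at T'. *)
Let Th_le (t : R) : 0 <= t <= T' -> lam * Th t <= - th t.
Proof.
move=> /andP[t0 tT]; rewrite -subr_ge0.
pose f x := - th x - lam * Th x.
have fT : f T' = 0 by rewrite /f ThT' th0// oppr0 mulr0 subr0.
suff : f T' <= f t by rewrite fT.
apply: (@derive_le0_le R f (fun x => - (expR (- lam * x) * 'D_1 ('D_1 chi) x))) => //.
  move=> z /andP[tz _]; have z0 := le_trans t0 tz.
  have H := derD (derN (derM (dexp z) (ddchi (nd z0))))
    (derN (derM (derC z lam) (dTh (nd2 z0)))).
  by apply: is_derive_eq H _; rewrite /th /damped; ring.
move=> z /andP[/ltW tz /ltW zT]; rewrite oppr_le0 mulr_ge0 ?expR_ge0//.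
by apply: ddchi_ge0; rewrite zT (le_trans t0).
Qed.

(* chi - Th has derivative (1 - e^(-lam t)) chi' <= 0 and vanishes at T'. *)
Let Th_chi : Th 0 <= chi 0.
Proof.
rewrite -subr_ge0; pose f x := chi x - Th x.
have fT : f T' = 0 by rewrite /f ThT' chi0// subr0.
suff : f T' <= f 0 by rewrite fT.
apply: (@derive_le0_le R f (fun x => (1 - expR (- lam * x)) * 'D_1 chi x)).
- exact: ltW T'0.
- move=> z /andP[z0 _].
  apply: is_derive_eq (derD (dchi (nd z0)) (derN (dTh (nd2 z0)))) _.
  by rewrite /th /damped; ring.
- move=> z /andP[/ltW z0 /ltW zT].
  rewrite mulr_ge0_le0 ?dchi_le0 ?z0// subr_ge0 -[leRHS]expR0 ler_expR.
  by rewrite mulNr oppr_le0 mulr_ge0// ltW.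
Qed.

(** The equation is tested with eta times [profile]. By
    [radial_laplacian_profile] the coefficient of U is
    (th' - lam th) profile / F - D th profile, that is, a time derivative: with
    Th' = th, integration by parts replaces U by u_t and releases the initial
    data, which enter with a favourable sign when chi decreases. *)
Lemma energy_identity :
  pairing source (fun t r => eta t * bp r * h t r)
  + eps * (sphere_area n * (chi 0 * trace (fun r => u1 r * (bp r / F_S M r))
     + (chi 0 - Th 0) * (lam * trace (fun r => u0 r * (bp r / F_S M r))
        + trace (fun r => u0 r * (bp r * D r))))) =
  pairing fieldut (fun t r =>
    (- th t + lam * Th t + Th t * (D r * F_S M r)) * (bp r / F_S M r) * h t r).
Proof.
have Hb := Ck_profile M0 hphi.
have F0 (r : R) : 2 * M < r -> F_S M r != 0 by move=> r2; rewrite gt_eqF// F_S_gt0.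
have o2 : open [set r : R | 2 * M < r] by exact: open_gt.
have HbF : Ck 2 [set r | 2 * M < r] (fun r => bp r / F_S M r).
  exact: (CkM o2 Hb (Ck_F_S_inv M0 2)).
have cb r : 2 * M < r -> {for r, continuous bp}.
  by move=> r2; exact: Ck_continuous Hb r2.
have cbF r : 2 * M < r -> {for r, continuous (fun r => bp r / F_S M r)}.
  by move=> r2; exact: Ck_continuous HbF r2.
have cbD r : 2 * M < r -> {for r, continuous (fun r => bp r * D r)}.
  by move=> r2; apply: continuousM; [exact: cb|exact: cD].
have De t : - d < t -> 'D_1 eta t = th t - lam * eta t.
  move=> td; rewrite (derD1 (derM (dexp t) (dchi td))) /th /eta /damped; ring.
have DDe t : - d < t -> 'D_1 ('D_1 eta) t = 'D_1 th t - lam * 'D_1 eta t.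
  move=> td; rewrite (De _ td); apply: derD1.
  apply: (@der_near R t _ (fun t => th t - lam * eta t)).
    near=> x; apply: De; near: x; exact: lt_nbhsr.
  have H := derD (Ck_is_derive Hth td) (derN (derM (derC t lam) (Ck_is_derive Heta td))).
  by apply: is_derive_eq H _; rewrite De//; ring.
have E1 := weak_identity d0 Heta Hb eta0.
have E2 := trace_identity d0 Hth HbF th0.
have E3 := trace_identity d20 HTh HbF Th0.
have E4 := continuous_trace_identity d20 HTh cbD Th0.
have bTh : bmeas2 (fun t _ => Th t).
  by apply: bmeas2_time d20 _ => t td; exact: Ck_continuous HTh td.
have bth : bmeas2 (fun t _ => th t).
  by apply: bmeas2_time d0 _ => t td; exact: Ck_continuous Hth td.
have bDTh : bmeas2 (fun t _ => 'D_1 Th t).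
  by apply: bmeas2_time d20 _ => t td; exact: Ck_continuous (Ck_D1 HTh) td.
have bDth : bmeas2 (fun t _ => 'D_1 th t).
  by apply: bmeas2_time d0 _ => t td; exact: Ck_continuous (Ck_D1 Hth) td.
have bbF : bmeas2 (fun _ r => bp r / F_S M r) by exact: bmeas2_radius.
have bbD : bmeas2 (fun _ r => bp r * D r) by exact: bmeas2_radius.
have A1 := bmeas2M bDth bbF; have A2 := bmeas2M bDTh bbF.
have A3 := bmeas2M bDTh bbD.
have c1 (k : R) : bmeas2 (fun _ _ => k) by exact: bmeas_cst.
have RHS1 : pairing fieldU (fun t r => 'D_1 ('D_1 eta) t * bp r / F_S M r
    - eta t * radial_laplacian n M bp r - D r * ('D_1 eta t * bp r)
    + V r * (eta t * bp r)) =
    pairing fieldU (fun t r => 'D_1 th t * (bp r / F_S M r))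
    - lam * pairing fieldU (fun t r => 'D_1 Th t * (bp r / F_S M r))
    - pairing fieldU (fun t r => 'D_1 Th t * (bp r * D r)).
  rewrite (@pairing_eqU _ (fun t r => 1 * (1 * ('D_1 th t * (bp r / F_S M r))
    + (- lam) * ('D_1 Th t * (bp r / F_S M r))) + (-1) * ('D_1 Th t * (bp r * D r)))).
    have B := bmeas2D (bmeas2M (c1 1) A1) (bmeas2M (c1 (- lam)) A2).
    rewrite (pairing_lin 1 (-1) integrable_U B A3).
    by rewrite (pairing_lin 1 (- lam) integrable_U A1 A2) !mul1r mulN1r mulNr.
  move=> t r /andP[/ltW t0 _] /andP[ar _] _; have r2 := lt_le_trans a2M ar.
  have td := nd t0; rewrite DDe// De// (radial_laplacian_profile M0 n0 hphi r2).
  rewrite (derD1 (dTh (nd2 t0))); field; exact: F0.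
rewrite RHS1 E2 E3 E4 in E1.
have De0 : 'D_1 eta 0 = 'D_1 chi 0 - lam * chi 0.
  by rewrite De ?nd// /th /eta /damped mulr0 expR0 !mul1r.
have th00 : th 0 = 'D_1 chi 0 by rewrite /th /damped mulr0 expR0 mul1r.
have eta00 : eta 0 = chi 0 by rewrite /eta /damped mulr0 expR0 mul1r.
have T1 : trace (fun r => (u1 r * (eta 0 * bp r) - u0 r * ('D_1 eta 0 * bp r)) / F_S M r
    + D r * u0 r * (eta 0 * bp r)) =
    chi 0 * trace (fun r => u1 r * (bp r / F_S M r))
    + (lam * chi 0 - 'D_1 chi 0) * trace (fun r => u0 r * (bp r / F_S M r))
    + chi 0 * trace (fun r => u0 r * (bp r * D r)).
  have I1 := integrable_trace lu1 cbF; have I0 := integrable_trace lu0 cbF.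
  have ID := integrable_trace lu0 cbD.
  have mab : measurable (`[a, b] : set TR) by [].
  transitivity (trace (fun r => 1 * (chi 0 * (u1 r * (bp r / F_S M r))
      + (lam * chi 0 - 'D_1 chi 0) * (u0 r * (bp r / F_S M r)))
      + chi 0 * (u0 r * (bp r * D r)))).
    apply: Rintegral_eq => r; rewrite /= in_itv/= => /andP[ar _].
    rewrite De0 eta00; congr (_ * _); field; exact/F0/(lt_le_trans a2M ar).
  rewrite trace_lin//; last first.
    have H := integrable_onD mab (integrable_onZ mab (chi 0) I1)
      (integrable_onZ mab (lam * chi 0 - 'D_1 chi 0) I0).
    by apply: (integrable_on_eq mab _ H) => r _; ring.
  by rewrite trace_lin// mul1r.
rewrite T1 th00 in E1.
have B1 : bmeas2 (fun t r => th t * (bp r / F_S M r) * h t r).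
  exact: bmeas2M (bmeas2M bth bbF) bmeas2_lightcut.
have B2 : bmeas2 (fun t r => Th t * (bp r / F_S M r) * h t r).
  exact: bmeas2M (bmeas2M bTh bbF) bmeas2_lightcut.
have B3 : bmeas2 (fun t r => Th t * (bp r * D r) * h t r).
  exact: bmeas2M (bmeas2M bTh bbD) bmeas2_lightcut.
rewrite (@pairing_eq fieldut _ (fun t r => 1 * ((-1) * (th t * (bp r / F_S M r) * h t r)
    + lam * (Th t * (bp r / F_S M r) * h t r)) + 1 * (Th t * (bp r * D r) * h t r)));
  last first.
  move=> t r w _ /andP[ar _]; congr (_ * _); field; exact/F0/(lt_le_trans a2M ar).
have B := bmeas2D (bmeas2M (c1 (-1)) B1) (bmeas2M (c1 lam) B2).
rewrite (pairing_lin 1 1 integrable_ut B B3) (pairing_lin (-1) lam integrable_ut B1 B2).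
(* From here on a linear identity between reals: the integrals are generalized
   to variables before normalization. *)
rewrite -[LHS]addr0 -(subrr (pairing fieldU (fun t r => 'D_1 th t * (bp r / F_S M r)))).
move: E1; set S1 := pairing source _.
move: (trace _) (trace _) (trace _) (pairing fieldut _) (pairing fieldut _)
  (pairing fieldut _) => X1 X2 X3 P1 P2 P3 E1.
rewrite subrr addr0; apply/eqP; rewrite -subr_eq0; apply/eqP.
move/eqP: E1; rewrite -subr_eq0 => /eqP E1.
by rewrite -[RHS]E1; ring.
Unshelve. all: by end_near. Qed.

(** Convexity of chi gives 0 <= lam Th <= - th, hence the factor of u_t in
    [energy_identity] is at most (2 + CD / lam) |th| times a positive weight.
    A pointwise Young inequality, supplied as a hypothesis with remainder G,
    then absorbs u_t into |u_t|^p. *)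
Lemma energy_inequality (G : R -> R -> R) : bmeas2 G ->
  (forall t r x, 0 < t <= T' -> a <= r <= b -> 0 <= x ->
    x * ((2 + CD / lam) * - th t * (bp r / F_S M r) * h t r) <=
    x `^ p * (eta t * bp r * h t r) + G t r) ->
  eps * (sphere_area n * (chi 0 * trace (fun r => u1 r * (bp r / F_S M r)))) <=
  pairing (fun=> 1) G.
Proof.
move=> bG HG.
have Hb := Ck_profile M0 hphi.
have bF_ge0 r : 2 * M < r -> 0 <= bp r / F_S M r.
  move=> r2; rewrite divr_ge0// ltW ?F_S_gt0//.
  exact: (profile_gt0 M0 hphi r2).
have tr_ge0 (f : R -> R) : (forall r, 2 * M < r -> 0 <= f r) -> 0 <= trace f.
  move=> f0; apply: Rintegral_ge0 => r; rewrite /= in_itv/= => /andP[ar _].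
  have r2 := lt_le_trans a2M ar.
  by rewrite mulr_ge0 ?f0// exprn_ge0// ltW// (radius_gt0 M0).
have extra : 0 <= (chi 0 - Th 0) * (lam * trace (fun r => u0 r * (bp r / F_S M r))
        + trace (fun r => u0 r * (bp r * D r))).
  rewrite mulr_ge0 ?subr_ge0// addr_ge0 ?mulr_ge0 ?(ltW lam0)//.
    by apply: tr_ge0 => r r2; rewrite mulr_ge0 ?u0_ge0 ?bF_ge0.
  apply: tr_ge0 => r r2; have /andP[Dr0 _] := D_bound r2.
  apply: (mulr_ge0 (u0_ge0 r2)).
  exact: (mulr_ge0 (ltW (profile_gt0 M0 hphi r2)) Dr0).
have cb r : 2 * M < r -> {for r, continuous bp}.
  by move=> r2; exact: Ck_continuous Hb r2.
have o2 : open [set r : R | 2 * M < r] by exact: open_gt.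
have cbF r : 2 * M < r -> {for r, continuous (fun r => bp r / F_S M r)}.
  by move=> r2; exact: Ck_continuous (CkM o2 Hb (Ck_F_S_inv M0 2)) r2.
have cF r : 2 * M < r -> {for r, continuous (F_S M)}.
  by move=> r2; exact: Ck_continuous (Ck_F_S M0 0) r2.
have bTh : bmeas2 (fun t _ => Th t).
  by apply: bmeas2_time d20 _ => t td; exact: Ck_continuous HTh td.
have bth : bmeas2 (fun t _ => th t).
  by apply: bmeas2_time d0 _ => t td; exact: Ck_continuous Hth td.
have beta : bmeas2 (fun t _ => eta t).
  by apply: bmeas2_time d0 _ => t td; exact: Ck_continuous Heta td.
have c1 (k : R) : bmeas2 (fun _ _ => k) by exact: bmeas_cst.
pose q t r := (- th t + lam * Th t + Th t * (D r * F_S M r)) * (bp r / F_S M r) * h t r.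
have bq : bmeas2 q.
  have X1 := bmeas2D (bmeas2N bth) (bmeas2M (c1 lam) bTh).
  have X2 := bmeas2M bTh (bmeas2M (bmeas2_radius cD) (bmeas2_radius cF)).
  exact: (bmeas2M (bmeas2M (bmeas2D X1 X2) (bmeas2_radius cbF)) bmeas2_lightcut).
have be : bmeas2 (fun t r => eta t * bp r * h t r).
  exact: bmeas2M (bmeas2M beta (bmeas2_radius cb)) bmeas2_lightcut.
have main : pairing fieldut q <=
    pairing source (fun t r => eta t * bp r * h t r) + pairing (fun=> 1) G.
  have i1 : integrable_on m K (fun=> 1).
    exact: (bmeas_integrable mK Kfin (bmeas_cst K 1)).
  have j1 := integrable_onM mK integrable_ut (bmeas2_weight bq).
  have j2 := integrable_onM mK integrable_source (bmeas2_weight be).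
  have j3 := integrable_onM mK i1 (bmeas2_weight bG).
  rewrite /pairing -RintegralD//.
  apply: le_Rintegral => //; first exact: (integrable_onD mK j2 j3).
  move=> [[t r] w] /slabP[tT rab ws] /=.
  have r2 : 2 * M < r by have /andP[ar _] := rab; exact: lt_le_trans ar.
  have tT' : 0 <= t <= T' by have /andP[/ltW -> ->] := tT.
  rewrite mul1r /fieldut /source /= (mulrA (ut t r w)) (mulrA (_ `^ p)) -mulrDl.
  apply: ler_wpM2r; first by rewrite exprn_ge0// ltW// (radius_gt0 M0).
  apply: le_trans (HG t r `|ut t r w| tT rab (normr_ge0 _)); rewrite /q.
  have hq : 0 <= (bp r / F_S M r) * h t r by rewrite mulr_ge0 ?bF_ge0// lightcut_ge0.
  have Ft := F_S_gt0 M0 r2; have F1 := F_S_le1 M0 r2.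
  have /andP[D0 DC] := D_bound r2.
  have Th_0 := Th_ge0 tT'; have Th_l := Th_le tT'.
  have DF : D r * F_S M r <= CD.
    by rewrite (le_trans _ DC)// ler_piMr.
  have DF0 : 0 <= D r * F_S M r by rewrite mulr_ge0// ltW.
  have CD0 : 0 <= CD by exact: le_trans DC.
  have nth : 0 <= - th t by rewrite oppr_ge0 th_le0.
  have S0 : 0 <= - th t + lam * Th t + Th t * (D r * F_S M r).
    by rewrite !addr_ge0 ?mulr_ge0// ltW.
  have S1 : - th t + lam * Th t + Th t * (D r * F_S M r) <= (2 + CD / lam) * - th t.
    have : Th t * (D r * F_S M r) <= (- th t / lam) * CD.
      by rewrite ler_pM// ler_pdivlMr// mulrC.
    have -> : (2 + CD / lam) * - th t = - th t + - th t + (- th t / lam) * CD by ring.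
    by move=> ?; rewrite lerD// lerD.
  apply: (@le_trans _ _ (`|ut t r w| * ((- th t + lam * Th t + Th t * (D r * F_S M r))
      * (bp r / F_S M r * h t r)))).
    by rewrite -mulrA; apply: ler_wpM2r (ler_norm _); exact: (mulr_ge0 S0 hq).
  by apply: ler_wpM2l => //; rewrite -[leRHS]mulrA; exact: ler_wpM2r.
move: main; rewrite -energy_identity mulrDr mulrDr.
rewrite lerD2l => H; apply: le_trans H; rewrite lerDl mulr_ge0 ?(ltW eps0)//.
by rewrite mulr_ge0// ltW// sphere_area_gt0.
Qed.

End energy.

End weak_identities.

(** * Young's inequality with a vanishing weight *)

Section young.
Context {R : realType}.

Lemma powR_le1 (x e : R) : 0 <= x <= 1 -> 0 <= e -> x `^ e <= 1.
Proof.
move=> /andP[x0 x1] e0; rewrite -[leRHS](congr1 (fun f => f e) (powR1 R)).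
by apply: (ge0_ler_powR e0); rewrite ?nnegrE.
Qed.

(** Y is absorbed if it is smaller than x^(p-1) xi; otherwise
    x < (Y / xi)^(1/(p-1)), and the lost power of xi is paid by xi^A, since
    A >= 1/(p-1). This is why the time cutoff is a high power. *)
Lemma weighted_young (p x Y xi : R) (A : nat) : 1 < p -> 0 <= x -> 0 <= Y ->
  0 <= xi <= 1 -> 1 <= (p - 1) * A%:R ->
  x * Y * xi ^+ A <= x `^ p * xi ^+ A.+1 + Y `^ (p / (p - 1)).
Proof.
move=> p1 x0 Y0 /andP[xi0 xi1] HA.
have p10 : 0 < p - 1 by rewrite subr_gt0.
have p0 : 0 < p by rewrite (lt_trans _ p1).
have A0 : (0 < A)%N.
  by rewrite lt0n; apply: contraTneq HA => ->; rewrite mulr0 -ltNge ltr01.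
move: xi0; rewrite le_eqVlt => /predU1P[<-|xi0].
  by rewrite !expr0n/= eqn0Ngt A0 !mulr0 add0r powR_ge0.
have xp : x * x `^ (p - 1) = x `^ p.
  move: x0; rewrite le_eqVlt => /predU1P[<-|x0].
    by rewrite mul0r powR0// gt_eqF.
  rewrite -{1}[x]powRr1 ?ltW// -powRD; last by apply/implyP => _; rewrite gt_eqF.
  by congr (_ `^ _); ring.
have [H|H] := leP Y (x `^ (p - 1) * xi).
  rewrite (@le_trans _ _ (x `^ p * xi ^+ A.+1))//; last by rewrite lerDl powR_ge0.
  rewrite -xp exprS -!mulrA ler_wpM2l// mulrA ler_wpM2r//.
  by rewrite exprn_ge0// ltW.
have Ypos : 0 < Y by apply: le_lt_trans H; rewrite mulr_ge0 ?powR_ge0// ltW.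
set q := (p - 1)^-1.
have q0 : 0 < q by rewrite invr_gt0.
have xle : x <= (Y / xi) `^ q.
  rewrite -[leLHS]powRr1// -(mulfV (lt0r_neq0 p10)) powRrM.
  rewrite ge0_ler_powR ?nnegrE ?powR_ge0 ?divr_ge0 ?ltW//.
  by rewrite ltr_pdivlMr.
have qA : q <= A%:R by rewrite /q -div1r ler_pdivrMr// mulrC.
rewrite (@le_trans _ _ (Y `^ (p / (p - 1))))//; last first.
  by rewrite lerDr mulr_ge0 ?powR_ge0// exprn_ge0// ltW.
have -> : p / (p - 1) = q + 1 by rewrite /q; field; rewrite gt_eqF.
rewrite powRD; last by apply/implyP => _; rewrite gt_eqF.
rewrite powRr1 ?(ltW Ypos)//.
have -> : x * Y * xi ^+ A = x * xi ^+ A * Y by ring.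
apply: ler_wpM2r; first exact: ltW.
rewrite (@le_trans _ _ ((Y / xi) `^ q * xi ^+ A))//.
  by rewrite ler_wpM2r// exprn_ge0// ltW.
rewrite powRM ?invr_ge0 ?(ltW Ypos) ?(ltW xi0)//.
rewrite -mulrA ler_piMr ?powR_ge0//.
rewrite -powR_inv1 ?(ltW xi0)// -powRrM -powR_mulrn ?(ltW xi0)//.
rewrite -powRD; last by apply/implyP => _; rewrite gt_eqF.
apply: powR_le1; first by rewrite ltW.
lra.
Qed.

End young.

(** * The spatial integral of the remainder *)

Section spatial_bound.
Context {R : realType} (n : nat) (M R0 lam pp c2 : R) (phi : R -> R).
Hypotheses (M0 : 0 < M) (n0 : (0 < n)%N) (R0_gt0 : 0 < R0) (lam0 : 0 < lam)
  (pp0 : 0 < pp) (pp_lam : pp <= 2 * M * lam) (c20 : 0 < c2).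
Hypothesis phi_ge0 : forall s, 0 <= phi s.
Hypothesis phi_le : forall s, phi s <= c2 * expR (lam * s).
Local Notation k := ((n%:R - 1) / 2 : R).

Let k0 : 0 <= k.
Proof. by rewrite divr_ge0// subr_ge0 ler1n. Qed.

(** [front] is a logistic profile across the light cone: it decreases from 1 to
    0 as s increases through t + R0 + 2. Its r-derivative has modulus
    [front_density], which therefore has integral at most 1, and behaves like
    lam e^(lam (s - t)) / F inside the cone. *)
Definition phase (t r : R) : R := lam * (tortoise M r - (t + R0 + 2)).

Definition front (t r : R) : R := (1 + expR (phase t r))^-1.

Definition front_density (t r : R) : R :=
  lam / F_S M r * expR (phase t r) * front t r ^+ 2.

(** The first term takes care of bounded r, the second of the wave zone. Both
    have explicit primitives. *)
Definition majorant (t r : R) : R := expR (- r) + (1 + t) `^ k * front_density t r.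

Let pos1 (t r : R) : 0 < 1 + expR (phase t r).
Proof. by rewrite addr_gt0// expR_gt0. Qed.

Lemma is_derive_majorant_primitive (t r : R) : 2 * M < r ->
  is_derive r 1 (fun r => - expR (- r) - (1 + t) `^ k * front t r) (majorant t r).
Proof.
move=> r2; have F0 := F_S_gt0 M0 r2.
have dX : is_derive r 1 (phase t) (lam / F_S M r).
  have H := derM (derC r lam) (derD (is_derive_tortoise M0 r2) (derC r (- (t + R0 + 2)))).
  by apply: is_derive_eq H _; ring.
have dE := @derComp R r expR (phase t) _ _ (is_derive_expR _) dX.
have dN := @derComp R r expR (fun r => - r) _ _ (is_derive_expR _) (derN (derI r)).
have d1 := derD (derC r 1) dE.
have dI : is_derive r 1 (front t) (- front_density t r).
  apply: is_derive_eq (is_deriveV _ d1) _; first by rewrite gt_eqF.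
  rewrite /front_density /front /GRing.scale/= exprVn; ring.
have H := derD (derN dN) (derN (derM (derC r ((1 + t) `^ k)) dI)).
by apply: is_derive_eq H _; rewrite /majorant; ring.
Qed.

Lemma majorant_ge0 (t r : R) : 2 * M < r -> 0 <= majorant t r.
Proof.
move=> r2; rewrite addr_ge0 ?expR_ge0// mulr_ge0 ?powR_ge0//.
rewrite /front_density mulr_ge0 ?exprn_ge0 ?invr_ge0 ?ltW//.
by rewrite mulr_gt0 ?expR_gt0// divr_gt0// F_S_gt0.
Qed.

Lemma continuous_majorant (t r : R) : 2 * M < r -> {for r, continuous (majorant t)}.
Proof.
move=> r2; have o2 : open [set r : R | 2 * M < r] by exact: open_gt.
have o0 : open [set r : R | 0 < r] by exact: open_gt.
have HX : Ck 0 [set r | 2 * M < r] (phase t).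
  exact: (CkM o2 (Ck_cst 0 _ lam) (CkD o2 (Ck_tortoise M 0) (Ck_cst 0 _ _))).
have HE := Ck_comp o2 openT (fun _ _ => I) (Ck_expR 0 openT) HX.
have H1 := CkD o2 (Ck_cst 0 _ 1) HE.
have Hf : Ck 0 [set r | 2 * M < r] (front t).
  exact: (Ck_comp o2 o0 (fun x _ => pos1 t x) (Ck_inv 0) H1).
have Hd : Ck 0 [set r | 2 * M < r] (front_density t).
  exact: (CkM o2 (CkM o2 (CkM o2 (Ck_cst 0 _ lam) (Ck_F_S_inv M0 0)) HE)
    (CkX 2 o2 Hf)).
have HN := Ck_comp o2 openT (fun _ _ => I) (Ck_expR 0 openT) (CkN o2 (Ck_id 0 o2)).
exact: (Ck_continuous (CkD o2 HN (CkM o2 (Ck_cst 0 _ ((1 + t) `^ k)) Hd)) r2).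
Qed.

Lemma integral_majorant (t a b : R) : 0 <= t -> 2 * M < a -> a < b ->
  (\int[@lebesgue_measure R]_(r in `[a, b]) (majorant t r)%:E <=
   (2 * (1 + t) `^ k)%:E)%E.
Proof.
move=> t0 a2 ab.
pose P r := - expR (- r) - (1 + t) `^ k * front t r.
have dP r : a <= r -> is_derive r 1 P (majorant t r).
  by move=> ar; apply: is_derive_majorant_primitive; exact: lt_le_trans ar.
rewrite (@continuous_FTC2 R (majorant t) P a b ab); last 3 first.
- apply: continuous_in_subspaceT => r; rewrite inE/= in_itv/= => /andP[ar _].
  by apply: continuous_majorant; exact: lt_le_trans ar.
- split.
  + move=> r; rewrite in_itv/= => /andP[/ltW ar _]; by have [] := dP r ar.
  + exact: cvg_at_right_filter (der_continuous (dP a (lexx _))).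
  + exact: cvg_at_left_filter (der_continuous (dP b (ltW ab))).
- by move=> r; rewrite in_itv/= => /andP[/ltW ar _]; exact: derE (dP r ar).
rewrite -EFinB lee_fin /P.
have f1 r : 0 <= front t r <= 1.
  by rewrite invr_ge0 ltW//= invf_le1// lerDl expR_ge0.
have /andP[fa0 fa1] := f1 a; have /andP[fb0 fb1] := f1 b.
have e1 : expR (- a) <= 1.
  rewrite -[leRHS]expR0 ler_expR oppr_le0 ltW// (lt_trans _ a2)// mulr_gt0//.
have e2 : 0 <= expR (- b) by exact: expR_ge0.
have T1 : 1 <= (1 + t) `^ k.
  rewrite -[leLHS](congr1 (fun f => f k) (powR1 R)).
  by apply: (ge0_ler_powR k0); rewrite ?nnegrE// ?addr_ge0// lerDl.
have T2 : (1 + t) `^ k * front t a <= (1 + t) `^ k * 1.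
  by rewrite ler_wpM2l// powR_ge0.
have T3 : 0 <= (1 + t) `^ k * front t b by rewrite mulr_ge0// powR_ge0.
lra.
Qed.

(** With s the tortoise coordinate, the left side is at most a constant times
    e^(lam (s - t)) F^(-pp) r^((n-1)/2). Near the horizon
    e^(lam s) = e^(lam r) (r - 2M)^(2 M lam) beats F^(-pp), because
    pp <= 2 M lam: this is where a large lam is used. For r >= 3M the factor
    F^(-1) is bounded, r is at most C (1 + t) by finite speed, and
    e^(lam (s - t)) is comparable with the density of the front. *)
Lemma spatial_bound : exists2 C, 0 < C & forall t r, 0 <= t -> 2 * M < r ->
  expR (- lam * t) * profile n M phi r * lightcut M R0 t r * (F_S M r)^-1 `^ pp
    * r ^+ n.-1 <= C * majorant t r.
Proof.
have kE : n.-1%:R = 2 * k :> R.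
  by rewrite -[in RHS](prednK n0) -natr1; field.
set sg := 2 * M * lam - pp.
have sg0 : 0 <= sg by rewrite subr_ge0.
pose C1 := c2 * (expR (lam * (3 * M)) * M `^ sg * (3 * M) `^ pp) * (3 * M) `^ k
  * expR (3 * M).
pose C3 := 1 + R0 + 2 + `|2 * M * ln M|.
have C30 : 0 < C3.
  by have := normr_ge0 (2 * M * ln M); have := R0_gt0; rewrite /C3; lra.
pose C4 := c2 * C3 `^ k * (3 `^ pp * expR (lam * (R0 + 2))) * (4 / lam).
have M3 : 0 < 3 * M by rewrite mulr_gt0.
have C10 : 0 < C1 by rewrite !mulr_gt0 ?expR_gt0 ?powR_gt0.
have C40 : 0 < C4 by rewrite !mulr_gt0 ?expR_gt0 ?powR_gt0 ?invr_gt0.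
exists (C1 + C4) => [|t r t0 r2]; first exact: addr_gt0.
have r0 := radius_gt0 M0 r2; have F0 := F_S_gt0 M0 r2.
have J0 := majorant_ge0 t r2.
have [->|h0] := eqVneq (lightcut M R0 t r) 0.
  by rewrite mulr0 !mul0r mulr_ge0// addr_ge0// ltW.
have /ler_normlP[_ sS] := lightcut_supp h0.
have prE : profile n M phi r * r ^+ n.-1 = phi (tortoise M r) * r `^ k.
  rewrite /profile -mulrA; congr (_ * _).
  rewrite -powR_mulrn ?(ltW r0)// kE -powRD; last by apply/implyP => _; rewrite gt_eqF.
  by congr (_ `^ _); field.
set S := tortoise M r.
have L1 : expR (- lam * t) * profile n M phi r * lightcut M R0 t r * (F_S M r)^-1 `^ pp
    * r ^+ n.-1 <= expR (- lam * t) * (c2 * expR (lam * S)) * (F_S M r)^-1 `^ pp * r `^ k.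
  have -> : expR (- lam * t) * profile n M phi r * lightcut M R0 t r
      * (F_S M r)^-1 `^ pp * r ^+ n.-1 =
    lightcut M R0 t r * (expR (- lam * t) * phi S * (F_S M r)^-1 `^ pp * r `^ k).
    transitivity (expR (- lam * t) * lightcut M R0 t r * (F_S M r)^-1 `^ pp
      * (profile n M phi r * r ^+ n.-1)); first by ring.
    by rewrite prE; ring.
  have X0 : 0 <= expR (- lam * t) * phi S * (F_S M r)^-1 `^ pp * r `^ k.
    by rewrite !mulr_ge0 ?expR_ge0 ?powR_ge0.
  rewrite (@le_trans _ _ (expR (- lam * t) * phi S * (F_S M r)^-1 `^ pp * r `^ k))//.
    by rewrite ler_piMl// lightcut_le1.
  rewrite ler_wpM2r ?powR_ge0// ler_wpM2r ?powR_ge0// ler_wpM2l ?expR_ge0//.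
apply: (le_trans L1).
have expS : expR (lam * S) = expR (lam * r) * (r - 2 * M) `^ (2 * M * lam).
  rewrite /S /tortoise mulrDr expRD; congr (_ * _).
  rewrite /powR gt_eqF ?subr_gt0//; congr expR; ring.
have FppE : (F_S M r)^-1 `^ pp = r `^ pp * (r - 2 * M) `^ (- pp).
  rewrite F_SE// invf_div powRM ?(ltW r0) ?invr_ge0 ?subr_ge0 ?(ltW r2)//.
  rewrite -[(r - 2 * M)^-1]powR_inv1 ?subr_ge0 ?(ltW r2)// -powRrM.
  by rewrite mulN1r.
have [r3|r3] := leP r (3 * M).
  have e1 : expR (- lam * t) <= 1.
    by rewrite -[leRHS]expR0 ler_expR mulNr oppr_le0 mulr_ge0// ltW.
  have key : expR (lam * S) * (F_S M r)^-1 `^ pp <=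
      expR (lam * (3 * M)) * M `^ sg * (3 * M) `^ pp.
    rewrite expS FppE.
    have -> : expR (lam * r) * (r - 2 * M) `^ (2 * M * lam)
        * (r `^ pp * (r - 2 * M) `^ (- pp)) =
      expR (lam * r) * (r - 2 * M) `^ sg * r `^ pp.
      rewrite /sg powRD; last by apply/implyP => _; rewrite gt_eqF// subr_gt0.
      ring.
    rewrite ler_pM ?mulr_ge0 ?expR_ge0 ?powR_ge0//.
      rewrite ler_pM ?expR_ge0 ?powR_ge0//.
        by rewrite ler_expR ler_wpM2l// ltW.
      apply: (ge0_ler_powR sg0); rewrite ?nnegrE ?subr_ge0 ?(ltW r2) ?(ltW M0)//; lra.
    by apply: (ge0_ler_powR (ltW pp0)); rewrite ?nnegrE ?(ltW r0) ?(ltW M3).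
  have rk : r `^ k <= (3 * M) `^ k.
    by apply: (ge0_ler_powR k0); rewrite ?nnegrE ?(ltW r0) ?(ltW M3).
  have er : 1 <= expR (3 * M) * expR (- r).
    by rewrite -expRD -[leLHS]expR0 ler_expR; lra.
  rewrite (@le_trans _ _ (C1 * expR (- r)))//; last first.
    have : C1 * expR (- r) <= C1 * majorant t r.
      rewrite ler_wpM2l ?(ltW C10)// /majorant lerDl mulr_ge0 ?powR_ge0//.
      rewrite /front_density mulr_ge0 ?exprn_ge0 ?invr_ge0 ?ltW//.
      by rewrite mulr_gt0 ?expR_gt0// divr_gt0.
    have : 0 <= C4 * majorant t r by rewrite mulr_ge0// ltW.
    by rewrite mulrDl; lra.
  rewrite (@le_trans _ _ (c2 * (expR (lam * (3 * M)) * M `^ sg * (3 * M) `^ pp)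
      * (3 * M) `^ k))//; last first.
    rewrite /C1 -[leRHS]mulrA ler_peMr// !mulr_ge0 ?expR_ge0 ?powR_ge0 ?(ltW c20)//.
  rewrite ler_pM ?powR_ge0 ?mulr_ge0 ?expR_ge0 ?powR_ge0 ?(ltW c20)//.
  rewrite -mulrA (@le_trans _ _ (1 * (c2 * expR (lam * S) * (F_S M r)^-1 `^ pp)))//.
    by rewrite ler_wpM2r// !mulr_ge0 ?expR_ge0 ?powR_ge0 ?(ltW c20).
  by rewrite mul1r -mulrA ler_wpM2l// ltW.
have F3 : (F_S M r)^-1 <= 3.
  rewrite F_SE// invf_div ler_pdivrMr ?subr_gt0//; lra.
have Fp : (F_S M r)^-1 `^ pp <= 3 `^ pp.
  by apply: (ge0_ler_powR (ltW pp0)); rewrite ?nnegrE ?invr_ge0 ?(ltW F0).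
have rC : r <= C3 * (1 + t).
  have lnM : ln M <= ln (r - 2 * M).
    rewrite ler_ln ?posrE ?subr_gt0//; lra.
  have H1 : r + 2 * M * ln M <= t + R0 + 2.
    rewrite (le_trans _ sS)// /tortoise lerD2l ler_wpM2l//.
    by rewrite mulr_ge0// ltW.
  have H2 := ler_norm (- (2 * M * ln M)); rewrite normrN in H2.
  have H3 : 0 <= `|2 * M * ln M| by [].
  have H4 : C3 * (1 + t) = C3 + t + (R0 + 2 + `|2 * M * ln M|) * t by rewrite /C3; ring.
  have H5 : 0 <= (R0 + 2 + `|2 * M * ln M|) * t.
    by rewrite mulr_ge0// !addr_ge0// ltW.
  rewrite H4 /C3; lra.
have rk : r `^ k <= C3 `^ k * (1 + t) `^ k.
  rewrite -powRM ?(ltW C30) ?addr_ge0//.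
  by apply: (ge0_ler_powR k0); rewrite ?nnegrE ?(ltW r0)// mulr_ge0 ?(ltW C30) ?addr_ge0.
have Xle : phase t r <= 0.
  by rewrite /phase pmulr_rle0// subr_le0.
have eX : expR (- lam * t) * expR (lam * S) = expR (lam * (R0 + 2)) * expR (phase t r).
  rewrite -!expRD; congr expR; rewrite /phase /S; ring.
have fd : expR (phase t r) <= 4 / lam * front_density t r.
  have eX1 : expR (phase t r) <= 1 by rewrite -[leRHS]expR0 ler_expR.
  have f2 : 4^-1 <= front t r ^+ 2.
    have h2 : 2^-1 <= front t r.
      rewrite /front lef_pV2 ?posrE// -[leRHS]/(1 + 1) lerD2l//.
    have -> : (4^-1 : R) = 2^-1 ^+ 2 by field.
    by rewrite ler_sqr ?nnegrE ?invr_ge0// (le_trans _ h2)// invr_ge0.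
  have F1 : 1 <= (F_S M r)^-1 by rewrite invf_ge1// F_S_le1.
  have -> : 4 / lam * front_density t r =
    expR (phase t r) * (4 * (F_S M r)^-1 * front t r ^+ 2).
    by rewrite /front_density; field; rewrite !gt_eqF.
  rewrite ler_peMr ?expR_ge0//.
  have H : 1 * 4^-1 <= (F_S M r)^-1 * front t r ^+ 2 by rewrite ler_pM.
  lra.
rewrite (@le_trans _ _ (C4 * majorant t r))//; last first.
  have : 0 <= C1 * majorant t r by rewrite mulr_ge0// ltW.
  by rewrite mulrDl; lra.
rewrite (@le_trans _ _ (C4 * ((1 + t) `^ k * front_density t r)))//; last first.
  by rewrite ler_wpM2l ?(ltW C40)// /majorant lerDr expR_ge0.
have -> : expR (- lam * t) * (c2 * expR (lam * S)) * (F_S M r)^-1 `^ pp * r `^ k =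
  c2 * (expR (- lam * t) * expR (lam * S)) * (F_S M r)^-1 `^ pp * r `^ k by ring.
rewrite eX.
have -> : C4 * ((1 + t) `^ k * front_density t r) =
  c2 * (expR (lam * (R0 + 2)) * (4 / lam * front_density t r)) * 3 `^ pp
  * (C3 `^ k * (1 + t) `^ k) by rewrite /C4; ring.
have cE : 0 <= c2 * (expR (lam * (R0 + 2)) * expR (phase t r)).
  by rewrite !mulr_ge0 ?expR_ge0 ?(ltW c20).
apply: ler_pM; [exact: (mulr_ge0 cE (powR_ge0 _ _))|exact: powR_ge0| |exact: rk].
apply: ler_pM; [exact: cE|exact: powR_ge0| |exact: Fp].
by rewrite ler_wpM2l ?(ltW c20)// ler_wpM2l ?expR_ge0.
Qed.

End spatial_bound.

(** * Slab integrals and the size of the data *)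

Section slab_bound.
Context {R : realType} (n : nat) (T' a b : R).
Local Notation TR := (measurableTypeR R).
Local Notation X := (TR * TR * 'rV[R]_n)%type.
Local Notation mu := (@lebesgue_measure R).
Local Notation m := (product_sf mu mu \x @sphere_measure R n)%E.
Local Notation K := (@slab R n T' a b).

Lemma slab_integral_le (g : R -> R -> R) (H : R -> R) :
  measurable_fun K (fun z : X => g z.1.1 z.1.2) ->
  (forall t r, 0 < t <= T' -> a <= r <= b -> 0 <= g t r) ->
  (forall t, 0 < t <= T' -> (\int[mu]_(r in `[a, b]) (g t r)%:E <= (H t)%:E)%E) ->
  (forall t, 0 < t <= T' -> 0 <= H t) ->
  measurable_fun `]0, T'] H ->
  (forall t, 0 < t <= T' -> measurable_fun `[a, b] (g t)) ->
  (\int[m]_(z in K) (g z.1.1 z.1.2)%:E <=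
   (sphere_area n)%:E * \int[mu]_(t in `]0%R, T']) (H t)%:E)%E.
Proof.
move=> mg g0 gH H0 mH mgt.
have mK : measurable K := @measurable_slab R n T' a b.
have s0 : (0 <= (sphere_area n : R)%:E)%E.
  by rewrite -sphere_areaE.
pose G : X -> \bar R := (fun z => (g z.1.1 z.1.2)%:E) \_ K.
have mG : measurable_fun setT G.
  by apply: (measurable_restrictT _ mK).1; exact/measurable_EFinP.
have G0 z : (0 <= G z)%E.
  rewrite /G patchE; case: ifPn => //; rewrite inE; case: z => [[t r] w] /slabP[? ? _].
  by rewrite lee_fin g0.
pose Phi t := (\int[mu]_r \int[@sphere_measure R n]_w G (t, r, w))%E.
have mPhi : measurable_fun setT Phi.
  apply: (measurable_fun_fubini_tonelli_F
    (fun tr => \int[@sphere_measure R n]_w G (tr, w))%E).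
    exact: (measurable_fun_fubini_tonelli_F G mG G0).
  by move=> tr; exact: integral_ge0.
have PhiE t : 0 < t <= T' ->
    Phi t = ((\int[mu]_(r in `[a, b]) (g t r)%:E) * (sphere_area n)%:E)%E.
  move=> tT; rewrite -ge0_integralZr//; last 2 first.
  - by apply/measurable_EFinP; exact: mgt tT.
  - by move=> r; rewrite /= in_itv/= => rab; rewrite lee_fin g0.
  rewrite [RHS]integral_mkcond; apply: eq_integral => r _; rewrite [RHS]patchE.
  case: ifPn => [|/negP]; rewrite inE/= in_itv/= => rab.
    transitivity (\int[@sphere_measure R n]_(w in @sphere R n) (g t r)%:E)%E.
      rewrite [RHS]integral_mkcond; apply: eq_integral => w _.
      rewrite /G !patchE; case: ifPn => [|/negP]; rewrite inE => Kw.
        by case: ifPn => // /negP; rewrite inE; move/slabP : Kw => [].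
      case: ifPn => //; rewrite inE => ws; case: Kw; exact/slabP.
    rewrite integral_cst; last exact: measurable_sphere.
    by rewrite [X in (_ * X)%E]sphere_areaE.
  rewrite integral0_eq// => w _; rewrite /G patchE; case: ifPn => //.
  by rewrite inE => /slabP[].
have Phi0 t : ~ (0 < t <= T') -> Phi t = 0%E.
  move=> nt; rewrite /Phi integral0_eq// => r _; rewrite integral0_eq// => w _.
  by rewrite /G patchE; case: ifPn => //; rewrite inE => /slabP[].
have -> : (\int[m]_(z in K) (g z.1.1 z.1.2)%:E = \int[mu]_(t in `]0%R, T']) Phi t)%E.
  rewrite integral_mkcond -[LHS](@ge0_triple_integral _ _ _ _ _ _ R mu mu _ G mG G0).
  rewrite [RHS]integral_mkcond; apply: eq_integral => t _; rewrite patchE.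
  case: ifPn => // /negP; rewrite inE/= in_itv/=; exact: Phi0.
rewrite -ge0_integralZl//; last by apply/measurable_EFinP.
apply: ge0_le_integral => //.
- by move=> t _; apply: integral_ge0 => r _; exact: integral_ge0.
- exact: measurable_funTS.
- by apply/measurable_EFinP; exact: measurable_funM.
- move=> t; rewrite /= in_itv/= => tT; rewrite PhiE// muleC.
  by apply: lee_wpmul2l => //; exact: gH.
Qed.

End slab_bound.

Section data_positivity.
Context {R : realType} (n : nat) (M R0 : R) (u w : R -> R).
Local Notation mu := (@lebesgue_measure R).
Hypothesis M0 : 0 < M.
Hypothesis hu : radial_datum M R0 u.
Hypothesis cw : forall r, 2 * M < r -> {for r, continuous w}.
Hypothesis w_gt0 : forall r, 2 * M < r -> 0 < w r.

(** The data term depends on the slab only through its containing the support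
    of u, and it is positive because u is nonnegative and not almost everywhere
    zero. *)
Lemma trace_constant : exists2 c0, 0 < c0 & forall a b, 2 * M < a -> a < b ->
  (forall r, 2 * M < r -> `|tortoise M r| <= R0 -> a <= r <= b) ->
  trace n a b (fun r => u r * w r) = c0.
Proof.
have [lu u0 unz su] := hu.
pose g r := u r * w r * r ^+ n.-1.
pose J := (\int[mu]_(r in `](2 * M)%R, +oo[) (g r)%:E)%E.
have gpos r : 2 * M < r -> 0 <= g r.
  move=> r2; rewrite /g !mulr_ge0 ?u0//; first exact: ltW (w_gt0 r2).
  by rewrite exprn_ge0// ltW// (radius_gt0 M0).
have mab a b : measurable (`[a, b] : set (measurableTypeR R)) by [].
have IE a b : 2 * M < a -> a < b ->
    (forall r, 2 * M < r -> `|tortoise M r| <= R0 -> a <= r <= b) ->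
    (trace n a b (fun r => u r * w r))%:E = J.
  move=> a2 ab win; rewrite /trace /Rintegral fineK; last first.
    apply: integrable_fin_num => //.
    exact: (@integrable_trace R n M a b a2 u w lu cw).
  rewrite /J [LHS]integral_mkcond [RHS]integral_mkcond; apply: eq_integral => r _.
  rewrite !patchE; case: ifPn => [|/negP]; rewrite inE/= in_itv/= => rab.
    case: ifPn => // /negP; rewrite inE/= in_itv/= andbT; case.
    by have /andP[ar _] := rab; exact: lt_le_trans ar.
  case: ifPn => //; rewrite inE/= in_itv/= andbT => r2; rewrite /g.
  have [->|U] := eqVneq (u r) 0; first by rewrite !mul0r.
  by case: rab; apply: win => //; exact: su.
have [a1 [b1 [a12 ab1 win1]]] := tortoise_window M0 R0.
exists (trace n a1 b1 (fun r => u r * w r)); last first.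
  move=> a b a2 ab win; apply: EFin_inj; rewrite IE//; exact/esym/IE.
rewrite -lte_fin IE// lt_neqAle; apply/andP; split; last first.
  by apply: integral_ge0 => r; rewrite /= in_itv/= andbT => r2; rewrite lee_fin gpos.
apply/eqP => J0; apply: unz.
have mI : measurable (`]2 * M, +oo[ : set (measurableTypeR R)) by [].
have mg : measurable_fun (`]2 * M, +oo[ : set (measurableTypeR R)) (EFin \o g).
  apply/measurable_EFinP.
  have mu' : measurable_fun `]2 * M, +oo[ u by have [] := lu.
  have mc (c : R -> R) : (forall r, 2 * M < r -> {for r, continuous c}) ->
      measurable_fun (`]2 * M, +oo[ : set (measurableTypeR R)) c.
    move=> cc; apply: open_continuous_measurable_fun => // r.
    by rewrite inE/= in_itv/= andbT; exact: cc.
  apply: measurable_funM; first by apply: measurable_funM => //; exact: mc.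
  apply: mc => r r2; exact: (Ck_continuous (CkX n.-1 openT (Ck_id 0 openT)) I).
have : (\int[mu]_(r in `](2 * M)%R, +oo[) `|(EFin \o g) r| = 0)%E.
  rewrite [RHS]J0; apply: eq_integral => r; rewrite inE/= in_itv/= andbT => r2.
  by rewrite /= ger0_norm ?gpos.
move=> /(ae_eq_integral_abs mu mI mg); apply: filterS => r H r2.
have /H : [set` `]2 * M, +oo[%R] r by rewrite /= in_itv/= r2.
move=> /= [] /eqP; rewrite /g !mulf_eq0 => /orP[/orP[/eqP//|]|].
  by rewrite gt_eqF// w_gt0.
by rewrite expf_eq0 => /andP[_]; rewrite gt_eqF// (radius_gt0 M0).
Qed.

End data_positivity.

(** * The cutoff in time *)

Section time_cutoff.
Context {R : realType} (kap T' : R) (ell : R -> R) (j : nat).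
Hypotheses (kap0 : 0 <= kap) (T'0 : 0 < T').
Hypothesis dell : forall t : R, -1 < t -> is_derive t 1 ell ((1 + t) `^ (- kap)).
Hypothesis ell0 : ell 0 = 0.

Local Notation w := (fun t : R => (1 + t) `^ (- kap)).
Local Notation L := (ell T').
Local Notation A := (3 + j)%N.

(** The cutoff is a high power of the affine function of ell that goes from 1 at
    t = 0 to 0 at T'. Measuring time with ell, whose derivative is
    (1 + t)^(-kap), spreads the transition evenly over the dyadic scales when
    kap = 1; this is what makes the critical exponent accessible. *)
Definition cutoff (t : R) : R := tpow A.+1 (1 - ell t / L).

Let o1 : open [set t : R | -1 < t]. Proof. exact: open_gt. Qed.
Let o0 : open [set x : R | 0 < x]. Proof. exact: open_gt. Qed.

Let nd (t : R) : 0 <= t -> -1 < t.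
Proof. by apply: lt_le_trans; rewrite ltrN10. Qed.

Let Ck_w k : Ck k [set t : R | -1 < t] w.
Proof.
have H := CkD o1 (Ck_cst k _ (1 : R)) (Ck_id k o1).
have pos (t : R) : -1 < t -> 0 < 1 + t by move=> ?; lra.
exact: (Ck_comp o1 o0 pos (Ck_powR k (- kap)) H).
Qed.

Let Ck_ell k : Ck k.+1 [set t : R | -1 < t] ell.
Proof. exact: (Ck_deriv o1 dell (Ck_w k)). Qed.

Lemma ell_mono (s t : R) : 0 <= s -> s <= t -> ell s <= ell t.
Proof.
move=> s0 st; rewrite -lerN2.
apply: (@derive_le0_le R (fun t => - ell t) (fun t => - w t)) => //.
  by move=> z /andP[sz _]; apply: derN; apply: dell; apply: nd; exact: le_trans sz.
by move=> z _; rewrite oppr_le0 powR_ge0.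
Qed.

Lemma ell_gt0 : 0 < L.
Proof.
have [||c] := @MVT R ell w 0 T' T'0.
- by move=> z; rewrite in_itv/= => /andP[z0 _]; apply: dell; apply: nd; exact: ltW.
- apply: derivable_within_continuous => z; rewrite in_itv/= => /andP[z0 _].
  by have [] := dell (nd z0).
rewrite in_itv/= => /andP[c0 _]; rewrite ell0 !subr0 => ->.
by rewrite mulr_gt0// powR_gt0// addr_gt0.
Qed.

Let dxi (t : R) : -1 < t -> is_derive t 1 (fun t => 1 - ell t / L) (- (w t / L)).
Proof.
move=> t1; have H := derD (derC t 1) (derN (derM (dell t1) (derC t L^-1))).
by apply: is_derive_eq H _; ring.
Qed.

Let dcut (t : R) : -1 < t ->
  is_derive t 1 cutoff (A.+1%:R * tpow A (1 - ell t / L) * - (w t / L)).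
Proof.
move=> t1; exact: (@derComp R t (tpow A.+1) _ _ _ (is_derive_tpow (2 + j) _) (dxi t1)).
Qed.

Lemma cutoff_derive (t : R) : 0 <= t ->
  'D_1 cutoff t = - (A.+1%:R * tpow A (1 - ell t / L) * (w t / L)).
Proof. by move=> /nd/dcut/derD1 ->; rewrite mulrN. Qed.

Lemma Ck_cutoff : Ck 3 [set t : R | -1 < t] cutoff.
Proof.
have H := CkD o1 (Ck_cst 3 _ 1) (CkN o1 (CkM o1 (Ck_ell 2) (Ck_cst 3 _ L^-1))).
exact: (Ck_comp o1 openT (fun _ _ => I) (Ck_tpow 3 j openT) H).
Qed.

Lemma cutoff0 : cutoff 0 = 1.
Proof. by rewrite /cutoff ell0 mul0r subr0 tpowE ?expr1n. Qed.

Lemma cutoff_supp t : T' <= t -> cutoff t = 0.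
Proof.
move=> tT; rewrite /cutoff tpow_le0// subr_le0 ler_pdivlMr ?ell_gt0// mul1r.
by apply: ell_mono => //; exact: ltW.
Qed.

Lemma xi_bounds t : 0 <= t <= T' -> 0 <= 1 - ell t / L <= 1.
Proof.
move=> /andP[t0 tT]; rewrite subr_ge0 ler_pdivrMr ?ell_gt0// mul1r ell_mono//=.
by rewrite gerBl divr_ge0 ?(ltW ell_gt0)// -ell0 ell_mono.
Qed.

Lemma cutoff_derive_le0 t : 0 <= t -> 'D_1 cutoff t <= 0.
Proof.
move=> t0; rewrite cutoff_derive// oppr_le0; apply: mulr_ge0.
  by apply: mulr_ge0 => //; exact: tpow_ge0.
by apply: divr_ge0; [exact: powR_ge0|exact: ltW ell_gt0].
Qed.

(** ell is concave and the outer function is convex and nonincreasing in ell. *)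
Lemma cutoff_convex t : 0 <= t -> 0 <= 'D_1 ('D_1 cutoff) t.
Proof.
move=> t0; have t1 := nd t0.
have dw : is_derive t 1 w (- kap * (1 + t) `^ (- kap - 1)).
  have pos : 0 < 1 + t by rewrite ltr_wpDr.
  have P : is_derive (1 + t) 1 (fun x : R => x `^ (- kap)) (- kap * (1 + t) `^ (- kap - 1)).
    exact: is_derive1_powR.
  have H := @derComp R t _ (fun t => 1 + t) _ _ P (derD (derC t 1) (derI t)).
  by apply: is_derive_eq H _; ring.
have dT := @derComp R t (tpow A) _ _ _ (is_derive_tpow (1 + j) _) (dxi t1).
have H := derM (derM (derC t (A.+1%:R : R)) dT) (derN (derM dw (derC t L^-1))).
rewrite (derD1 (df := _) (der_near _ H)); last first.
  near=> x; have x1 : -1 < x by near: x; exact: lt_nbhsr.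
  exact: derD1 (dcut x1).
set v := (X in 0 <= X).
have -> : v = A.+1%:R * ((2 + j).+1%:R * tpow (2 + j) (1 - ell t / L)) * (w t / L) * (w t / L)
    + A.+1%:R * tpow A (1 - ell t / L) * (kap * (1 + t) `^ (- kap - 1) / L).
  by rewrite /v; ring.
have wL : 0 <= w t / L by apply: divr_ge0; [exact: powR_ge0|exact: ltW ell_gt0].
have kL : 0 <= kap * (1 + t) `^ (- kap - 1) / L.
  apply: divr_ge0; last exact: ltW ell_gt0.
  by apply: mulr_ge0 => //; exact: powR_ge0.
apply: addr_ge0; apply: mulr_ge0 => //; last by apply: mulr_ge0 => //; exact: tpow_ge0.
apply: mulr_ge0 => //; apply: mulr_ge0 => //; apply: mulr_ge0 => //.
exact: tpow_ge0.
Unshelve. all: by end_near. Qed.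

End time_cutoff.

(** * The lifespan estimate *)

Section core_estimate.
Context {R : realType} (n : nat) (M p : R) (D V u0 u1 : R -> R)
  (R0 lam CD : R) (phi : R -> R).
Hypotheses (n0 : (0 < n)%N) (M0 : 0 < M) (p1 : 1 < p) (R0_gt0 : 0 < R0)
  (lam0 : 0 < lam).
Hypotheses (cD : forall r, 2 * M < r -> {for r, continuous D})
  (cV : forall r, 2 * M < r -> {for r, continuous V})
  (D_bound : forall r, 2 * M < r -> 0 <= D r <= CD).
Hypotheses (hu0 : radial_datum M R0 u0) (hu1 : radial_datum M R0 u1).
Hypothesis hphi : eigenfunction n M D V lam phi.
Local Notation pp := (p / (p - 1)).
Hypothesis pp_lam : pp <= 2 * M * lam.
Local Notation k := ((n%:R - 1) / 2 : R).
Local Notation kap := (k * (p - 1)).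
Local Notation mu := (@lebesgue_measure R).
Local Notation TR := (measurableTypeR R).

(** [energy_inequality] is applied to the cutoff in time, with Young's
    inequality [weighted_young]. With k = (n-1)/2 and pp = p/(p-1) the
    remainder is bounded by the integral of (w / L)^pp (1 + t)^k, where
    w = (1 + t)^(-kap) = ell' and L = ell T'. The exponent kap = k (p-1) is
    chosen so that w^pp (1 + t)^k = w; the remainder is then at most
    C L^(1 - pp) = C L^(-1/(p-1)), while the data contribute a fixed multiple
    of eps. *)
Lemma core_estimate (ell : R -> R) :
  (forall t : R, -1 < t -> is_derive t 1 ell ((1 + t) `^ (- kap))) -> ell 0 = 0 ->
  exists2 C, 0 < C & forall eps T U T', 0 < eps -> 0 < T' < T ->
    radial_solution n M p D V u0 u1 R0 eps T U ->
    ell T' <= C * eps `^ (- (p - 1)).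
Proof.
move=> dell ell0.
have p10 : 0 < p - 1 by rewrite subr_gt0.
have p0 : 0 < p by exact: lt_trans p1.
have pp0 : 0 < pp by rewrite divr_gt0.
have k0 : 0 <= k by rewrite divr_ge0// subr_ge0 ler1n.
have kap0 : 0 <= kap by rewrite mulr_ge0// ltW.
have CD0 : 0 <= CD.
  have H : 2 * M < 2 * M + 1 by rewrite ltrDl.
  by have /andP[D0 D1] := D_bound H; exact: le_trans D1.
have [lu0 u0_ge0 _ su0] := hu0; have [lu1 u1_ge0 _ su1] := hu1.
have [_ _ _ [c1 [c2 [c10 c12 phi_b]]]] := hphi.
have c20 : 0 < c2 by exact: lt_le_trans c12.
have phi_ge0 s : 0 <= phi s.
  have /andP[+ _] := phi_b s; apply: le_trans.
  by apply: mulr_ge0; [exact: ltW|exact: expR_ge0].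
have phi_le s : phi s <= c2 * expR (lam * s) by have /andP[] := phi_b s.
have o2 : open [set r : R | 2 * M < r] by exact: open_gt.
have Hb := Ck_profile M0 hphi.
have HbF := CkM o2 Hb (Ck_F_S_inv M0 2).
have cbF r : 2 * M < r -> {for r, continuous (fun r => profile n M phi r / F_S M r)}.
  by move=> r2; exact: Ck_continuous HbF r2.
have bF0 r : 2 * M < r -> 0 < profile n M phi r / F_S M r.
  by move=> r2; exact: (divr_gt0 (profile_gt0 M0 hphi r2) (F_S_gt0 M0 r2)).
have [c0 c00 trE] := trace_constant n M0 hu1 cbF bF0.
have [Cs Cs0 spat] := spatial_bound M0 n0 R0_gt0 lam0 pp0 pp_lam c20 phi_ge0 phi_le.
(* The power of the cutoff: at least 3 for regularity, and large enough for
   Young's inequality. *)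
have [j Hj] : exists j : nat, 1 <= (p - 1) * (3 + j)%N%:R.
  exists (Num.bound (p - 1)^-1).
  have := archi_boundP (ltW (_ : 0 < (p - 1)^-1)); rewrite invr_gt0 => /(_ p10) H.
  rewrite mulrC -ler_pdivrMr// div1r natrD (le_trans (ltW H))//.
  by rewrite lerDr.
set A := (3 + j)%N in Hj.
(* The factor of u_t in the energy identity, with the exponent that
   differentiating the cutoff releases. *)
pose B1 := (2 + CD / lam) * A.+1%:R.
have K0 : 0 < 2 + CD / lam by rewrite ltr_wpDr// divr_ge0// ltW.
have B10 : 0 < B1 by rewrite mulr_gt0.
pose C1 := B1 `^ pp * Cs * 2 / c0.
have C10 : 0 < C1 by rewrite !mulr_gt0 ?invr_gt0 ?powR_gt0.
exists (C1 `^ (p - 1)) => [|eps T U T' eps0 T'T [[lU [ut [lut Udt Uw]]] Us]].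
  by rewrite powR_gt0.
have T'0 : 0 < T' by have /andP[] := T'T.
have [a [b [a2 ab win]]] := tortoise_window M0 (T' + R0 + 2).
set L := ell T'.
have L0 : 0 < L := ell_gt0 T'0 dell ell0.
pose w (t : R) : R := (1 + t) `^ (- kap).
pose chi := cutoff T' ell j.
have dom_1 t : 0 <= t <= T' -> 0 <= t by case/andP.
pose G t r := (B1 / L * w t) `^ pp * (expR (- lam * t) * profile n M phi r
  * lightcut M R0 t r * (F_S M r)^-1 `^ pp).
have bw : bmeas2 n T' a b (fun t _ => (B1 / L * w t) `^ pp * expR (- lam * t)).
  apply: bmeas2_time ltr01 _ => t t1.
  have o1 : open [set t : R | -1 < t] by exact: open_gt.
  have o0 : open [set x : R | 0 < x] by exact: open_gt.
  have t1' : 0 < 1 + t by lra.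
  have Hw : Ck 0 [set t : R | -1 < t] w.
    have H := CkD o1 (Ck_cst 0 _ (1 : R)) (Ck_id 0 o1).
    have pos (s : R) : -1 < s -> 0 < 1 + s by move=> ?; lra.
    exact: (Ck_comp o1 o0 pos (Ck_powR 0 (- kap)) H).
  have wpos (s : R) : -1 < s -> 0 < B1 / L * w s.
    by move=> ?; rewrite mulr_gt0 ?divr_gt0// powR_gt0//; lra.
  have H1 := Ck_comp o1 o0 wpos (Ck_powR 0 pp) (CkM o1 (Ck_cst 0 _ (B1 / L)) Hw).
  have H2 := Ck_comp o1 openT (fun _ _ => I) (Ck_expR 0 openT)
    (CkM o1 (Ck_cst 0 _ (- lam)) (Ck_id 0 o1)).
  exact: (Ck_continuous (CkM o1 H1 H2) t1).
have HFp : Ck 0 [set r | 2 * M < r] (fun r => (F_S M r)^-1 `^ pp).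
  have pos (r : R) : 2 * M < r -> 0 < (F_S M r)^-1.
    by move=> r2; rewrite invr_gt0 F_S_gt0.
  exact: (Ck_comp o2 (@open_gt R 0) pos (Ck_powR 0 pp) (Ck_F_S_inv M0 0)).
have HbFp := CkM o2 (Ck_le (leq0n 2) Hb) HFp.
have bG : bmeas2 n T' a b G.
  have brad : bmeas2 n T' a b (fun _ r => profile n M phi r * (F_S M r)^-1 `^ pp).
    apply: (bmeas2_radius n T' b a2) => r r2; exact: (Ck_continuous HbFp r2).
  have H := bmeas2M (bmeas2M bw brad) (bmeas2_lightcut n R0 T' b M0 a2).
  rewrite (_ : G = (fun t r => (B1 / L * w t) `^ pp * expR (- lam * t)
    * (profile n M phi r * (F_S M r)^-1 `^ pp) * lightcut M R0 t r))//.
  by apply/funext => t; apply/funext => r; rewrite /G; ring.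
have win' r : 2 * M < r -> `|tortoise M r| <= R0 -> a <= r <= b.
  by move=> r2 H; apply: win => //; rewrite (le_trans H)//; lra.
have dle t : 0 <= t <= T' -> 'D_1 chi t <= 0.
  by move=> /dom_1; exact: cutoff_derive_le0.
have ddge t : 0 <= t <= T' -> 0 <= 'D_1 ('D_1 chi) t.
  by move=> /dom_1; exact: (cutoff_convex j kap0 T'0 dell ell0).
have young t r x : 0 < t <= T' -> a <= r <= b -> 0 <= x ->
    x * ((2 + CD / lam) * - damped lam ('D_1 chi) t
      * (profile n M phi r / F_S M r) * lightcut M R0 t r) <=
    x `^ p * (damped lam chi t * profile n M phi r * lightcut M R0 t r) + G t r.
  move=> /andP[t0 tT] /andP[ar _] x0; have r2 := lt_le_trans a2 ar.
  have t0' := ltW t0; have F0 := F_S_gt0 M0 r2.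
  have tT' : 0 <= t <= T' by rewrite t0'.
  have xi := xi_bounds T'0 dell ell0 tT'.
  have w0 : 0 < w t by apply: powR_gt0; rewrite addr_gt0.
  have BLw : 0 <= B1 / L * w t by rewrite !mulr_ge0 ?invr_ge0 ?ltW.
  have Y0 : 0 <= B1 / L * w t / F_S M r by rewrite divr_ge0// ltW.
  have om : 0 <= expR (- lam * t) * profile n M phi r * lightcut M R0 t r.
    apply: mulr_ge0; last exact: lightcut_ge0.
    by apply: mulr_ge0; [exact: expR_ge0|exact: ltW (profile_gt0 M0 hphi r2)].
  have Y := weighted_young p1 x0 Y0 xi Hj.
  have := ler_wpM2r om Y.
  have -> : x * (B1 / L * w t / F_S M r) * (1 - ell t / ell T') ^+ A
      * (expR (- lam * t) * profile n M phi r * lightcut M R0 t r) =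
    x * ((2 + CD / lam) * - damped lam ('D_1 chi) t
      * (profile n M phi r / F_S M r) * lightcut M R0 t r).
    rewrite /damped (cutoff_derive T' j dell)// tpowE; last by case/andP: xi.
    by rewrite /B1 -/A -/L /w; field; rewrite !gt_eqF.
  have -> : (x `^ p * (1 - ell t / ell T') ^+ A.+1 + (B1 / L * w t / F_S M r) `^ pp)
      * (expR (- lam * t) * profile n M phi r * lightcut M R0 t r) =
    x `^ p * (damped lam chi t * profile n M phi r * lightcut M R0 t r) + G t r.
    rewrite /damped /chi /cutoff tpowE; last by case/andP: xi.
    rewrite powRM// ?invr_ge0 ?(ltW F0)// /G -/A.
    by ring.
  by [].
have E := @energy_inequality R n M p D V u0 u1 R0 eps T T' a b U ut M0 p1 T'T a2 ab win
  cD cV lU lut Udt Uw Us lu0 lu1 su0 su1 lam phi CD 1 chi n0 eps0 lam0 ltr01 hphi D_bound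
  u0_ge0 (Ck_cutoff T' j dell) (cutoff_supp j T'0 dell ell0) dle ddge G bG young.
rewrite (trE a b a2 ab win') /chi (cutoff0 T' j ell0) mul1r in E.
have mK : measurable (@slab R n T' a b) := @measurable_slab R n T' a b.
have g_ge0 t r : 0 < t <= T' -> a <= r <= b -> 0 <= G t r * r ^+ n.-1.
  move=> /andP[t0 tT] /andP[ar _]; have r2 := lt_le_trans a2 ar.
  apply: mulr_ge0; last by rewrite exprn_ge0// ltW// (radius_gt0 M0).
  apply: mulr_ge0; first exact: powR_ge0.
  apply: mulr_ge0; last exact: powR_ge0.
  apply: mulr_ge0; last exact: lightcut_ge0.
  by apply: mulr_ge0; [exact: expR_ge0|exact: ltW (profile_gt0 M0 hphi r2)].
have cont_G t r : 2 * M < r -> {for r, continuous (fun r => G t r * r ^+ n.-1)}.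
  move=> r2; have HT := Ck_tortoise M 0.
  have Hl : Ck 0 [set r | 2 * M < r] (lightcut M R0 t).
    have oT : open [set: R] := openT.
    have St := Ck_le (leq0n 3) (@Ck_step R).
    have X1 := CkD o2 (CkD o2 HT (Ck_cst 0 _ (- t))) (Ck_cst 0 _ (- R0)).
    have X2 := CkD o2 (CkD o2 (CkN o2 HT) (Ck_cst 0 _ (- t))) (Ck_cst 0 _ (- R0)).
    exact: (CkM o2 (Ck_comp o2 oT (fun _ _ => I) St X1) (Ck_comp o2 oT (fun _ _ => I) St X2)).
  have H1 := CkM o2 (CkM o2 (CkM o2 (Ck_cst 0 _ (expR (- lam * t))) (Ck_le (leq0n 2) Hb)) Hl) HFp.
  have H2 := CkM o2 (CkM o2 (Ck_cst 0 _ ((B1 / L * w t) `^ pp)) H1) (CkX n.-1 o2 (Ck_id 0 o2)).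
  exact: (Ck_continuous H2 r2).
pose Q := (B1 / L) `^ pp * Cs.
have Q0 : 0 <= Q by apply: mulr_ge0; [exact: powR_ge0|exact: ltW].
pose H t := Q * 2 * w t.
have radial t : 0 < t <= T' ->
    (\int[mu]_(r in `[a, b]) (G t r * r ^+ n.-1)%:E <= (H t)%:E)%E.
  move=> /andP[t0 tT]; have t0' := ltW t0.
  have t1 : 0 < 1 + t by rewrite addr_gt0.
  have w0 : 0 <= w t by exact: powR_ge0.
  have wk : w t `^ pp * (1 + t) `^ k = w t.
    rewrite /w -powRrM -powRD; last by apply/implyP => _; rewrite gt_eqF.
    by congr (_ `^ _); field; rewrite gt_eqF.
  have cM r : 2 * M < r -> {for r, continuous (majorant n M R0 lam t)}.
    by move=> r2; exact: continuous_majorant.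
  have W0 : 0 <= Q * w t `^ pp by apply: mulr_ge0 => //; exact: powR_ge0.
  have mab : measurable (`[a, b] : set TR) by [].
  have mM := (bmeas_segment b a2 cM).1.
  apply: (@le_trans _ _ (\int[mu]_(r in `[a, b])
      ((Q * w t `^ pp)%:E * (majorant n M R0 lam t r)%:E))%E).
    apply: ge0_le_integral => //.
    - by move=> r; rewrite /= in_itv/= => rab; rewrite lee_fin g_ge0// t0.
    - by apply/measurable_EFinP; exact: (bmeas_segment b a2 (cont_G t)).1.
    - apply/measurable_EFinP; apply: measurable_funM => //.
    - move=> r; rewrite /= in_itv/= => /andP[ar _]; have r2 := lt_le_trans a2 ar.
      rewrite -EFinM lee_fin /G powRM// ?divr_ge0 ?(ltW B10) ?(ltW L0)//.
      have := ler_wpM2l (mulr_ge0 (powR_ge0 (B1 / L) pp) (powR_ge0 (w t) pp))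
        (spat t r t0' r2).
      by rewrite /Q => HH; apply: (le_trans _ (le_trans HH _));
        rewrite le_eqVlt; apply/orP; left; apply/eqP; ring.
  rewrite ge0_integralZl//; last 2 first.
  - exact/measurable_EFinP.
  - move=> r; rewrite /= in_itv/= => /andP[ar _]; rewrite lee_fin.
    by apply: majorant_ge0 => //; exact: lt_le_trans ar.
  have HM := integral_majorant R0 lam M0 n0 t0' a2 ab.
  apply: (le_trans (lee_wpmul2l _ HM)); first by rewrite lee_fin.
  rewrite -EFinM lee_fin le_eqVlt; apply/orP; left; apply/eqP.
  by rewrite /H -[in RHS]wk; ring.
have H_ge0 t : 0 < t <= T' -> 0 <= H t.
  by move=> _; apply: mulr_ge0; [exact: mulr_ge0|exact: powR_ge0].
have cw t : 0 <= t -> {for t, continuous w}.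
  move=> t0; have t1 : 0 < 1 + t by rewrite ltr_wpDr.
  have o1 : open [set t : R | -1 < t] by exact: open_gt.
  have H1 := CkD o1 (Ck_cst 0 _ (1 : R)) (Ck_id 0 o1).
  have pos (s : R) : -1 < s -> 0 < 1 + s by move=> ?; lra.
  have Hw := Ck_comp o1 (@open_gt R 0) pos (Ck_powR 0 (- kap)) H1.
  by apply: (Ck_continuous Hw); rewrite /=; lra.
have mw : measurable_fun (`[0, T'] : set TR) w.
  apply: subspace_continuous_measurable_fun => //.
  by apply: continuous_in_subspaceT => t; rewrite inE/= in_itv/= => /andP[/cw].
have mH : measurable_fun (`]0, T'] : set TR) H.
  apply: measurable_funM => //.
  by apply: measurable_funS mw => //; exact: subset_itv_oc_cc.
have mgt t : 0 < t <= T' -> measurable_fun (`[a, b] : set TR) (fun r => G t r * r ^+ n.-1).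
  by move=> _; exact: (bmeas_segment b a2 (cont_G t)).1.
have mG : measurable_fun (@slab R n T' a b) (fun z => G z.1.1 z.1.2 * z.1.2 ^+ n.-1) :=
  (bmeas2_weight a2 bG).1.
have S := slab_integral_le mG g_ge0 radial H_ge0 mH mgt.
have intw : (\int[mu]_(t in `]0%R, T']) (w t)%:E = L%:E)%E.
  have mw' : measurable_fun (`]0, T'] : set TR) (EFin \o w).
    by apply/measurable_EFinP; apply: measurable_funS mw => //; exact: subset_itv_oc_cc.
  rewrite (integral_itv_obnd_cbnd mw') (@continuous_FTC2 R w ell 0 T' T'0); last 3 first.
  - by apply: continuous_in_subspaceT => t; rewrite inE/= in_itv/= => /andP[/cw].
  - have d (t : R) : 0 <= t -> is_derive t 1 ell (w t) by move=> t0; apply: dell; lra.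
    split.
    + by move=> t; rewrite in_itv/= => /andP[/ltW/d[]].
    + exact: cvg_at_right_filter (der_continuous (d 0 (lexx _))).
    + exact: cvg_at_left_filter (der_continuous (d T' (ltW T'0))).
  - move=> t; rewrite in_itv/= => /andP[t0 _]; apply: derE; apply: dell.
    by apply: lt_trans t0; rewrite ltrN10.
  by rewrite ell0 sube0.
have pairE : (pairing T' a b (fun (_ : TR * TR * 'rV[R]_n) => 1) G)%:E =
    (\int[product_sf mu mu \x @sphere_measure R n]_(z in slab T' a b)
      (G z.1.1 z.1.2 * z.1.2 ^+ n.-1)%:E)%E.
  rewrite /pairing /Rintegral fineK; first by apply: eq_integral => z _; rewrite mul1r.
  apply: integrable_fin_num => //.
  have bm := bmeas_integrable mK (slab_fin n T' a b) (bmeas2_weight a2 bG).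
  by apply: (integrable_on_eq mK _ bm) => z _; rewrite mul1r.
have sg := sphere_area_gt0 (R := R) n0.
have main : eps * c0 <= Q * 2 * L.
  rewrite -(ler_pM2l sg) mulrCA -lee_fin (le_trans (_ : _ <= (pairing T' a b (fun (_ : TR * TR * 'rV[R]_n) => 1) G)%:E)%E)//.
  rewrite pairE (le_trans S)// EFinM lee_wpmul2l ?lee_fin ?(ltW sg)//.
  have -> : (\int[mu]_(t in `]0%R, T']) (H t)%:E =
      \int[mu]_(t in `]0%R, T']) ((Q * 2)%:E * (w t)%:E))%E by [].
  rewrite ge0_integralZl//.
  - by rewrite intw.
  - by apply/measurable_EFinP; apply: measurable_funS mw => //; exact: subset_itv_oc_cc.
  - by move=> t _; rewrite lee_fin powR_ge0.
  - by rewrite lee_fin mulr_ge0.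
set q := (p - 1)^-1.
have Lq : eps <= C1 * L `^ (- q).
  rewrite -ler_pdivlMr// in main; apply: (le_trans main).
  rewrite le_eqVlt; apply/orP; left; apply/eqP.
  rewrite /Q powRM ?(ltW B10) ?invr_ge0 ?(ltW L0)// /C1.
  have -> : L `^ (- q) = L^-1 `^ pp * L.
    transitivity (L `^ (-1 * pp) * L `^ 1); last first.
      by rewrite (powRrM L (-1)) powR_inv1 ?(ltW L0)// powRr1 ?(ltW L0).
    rewrite -powRD; last by apply/implyP => _; rewrite gt_eqF.
    by congr (_ `^ _); rewrite /q; field; rewrite gt_eqF.
  by ring.
have Lq' : L `^ q <= C1 * eps^-1.
  rewrite powRN in Lq; rewrite ler_pdivlMr// mulrC.
  by rewrite -ler_pdivlMr ?powR_gt0.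
have -> : L = (L `^ q) `^ (p - 1).
  by rewrite -powRrM /q mulVf ?gt_eqF// powRr1// ltW.
apply: (@le_trans _ _ ((C1 * eps^-1) `^ (p - 1))).
  apply: (ge0_ler_powR (ltW p10)) => //; rewrite nnegrE ?powR_ge0//.
  by rewrite mulr_ge0 ?invr_ge0 ?(ltW C10) ?(ltW eps0).
rewrite powRM ?invr_ge0 ?(ltW C10) ?(ltW eps0)//.
by rewrite -[eps^-1]powR_inv1 ?(ltW eps0)// -powRrM mulN1r.
Qed.

End core_estimate.

(** A bound on all T' < T is a bound on T. *)
Lemma lifespan_le {R : realType} (n : nat) (M p : R) (D V u0 u1 : R -> R)
    (R0 eps B : R) :
  (forall T U T', 0 < T' < T -> radial_solution n M p D V u0 u1 R0 eps T U ->
    T' <= B) ->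
  (lifespan n M p D V u0 u1 R0 eps <= B%:E)%E.
Proof.
move=> H; apply: ge_ereal_sup => _ [T [T0 [U HU]] <-].
rewrite lee_fin leNgt; apply/negP => BT.
have mT : Num.max 0 B < T by rewrite gt_max T0.
have [mx xT] := midf_lt mT; set x := (_ / _) in mx xT.
have /andP[x0 Bx] : (0 < x) && (B < x) by rewrite -gt_max.
have x0T : 0 < x < T by rewrite x0.
by have := H _ _ _ x0T HU; rewrite leNgt Bx.
Qed.

Lemma is_derive_ln1 {R : realType} (t : R) : -1 < t ->
  is_derive t 1 (fun t : R => ln (1 + t)) ((1 + t) `^ (-1)).
Proof.
move=> t1; have pos : 0 < 1 + t by lra.
have H := @derComp R t (@ln R) (fun t => 1 + t) _ _ (is_derive1_ln pos)
  (derD (derC t 1) (derI t)).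
by apply: is_derive_eq H _; rewrite powR_inv1 ?ltW//; ring.
Qed.

Lemma is_derive_power1 {R : realType} (q t : R) : 0 < q -> -1 < t ->
  is_derive t 1 (fun t : R => q^-1 * ((1 + t) `^ q - 1)) ((1 + t) `^ (q - 1)).
Proof.
move=> q0 t1; have pos : 0 < 1 + t by lra.
have H := @derComp R t (fun x : R => x `^ q) (fun t => 1 + t) _ _
  (is_derive1_powR q pos) (derD (derC t 1) (derI t)).
have H1 := derM (derC t q^-1) (derD H (derC t (-1))).
by apply: is_derive_eq H1 _; field; rewrite gt_eqF.
Qed.

Theorem theorem1p2 (R : realType) (n : nat) (M p : R) (D V : R -> R)
    (mu1 mu2 beta gamma : R) (u0 u1 : R -> R) (R0 lam0 : R) (phi : R -> R)
    (hn : (3 <= n)%N) (hM : 0 < M)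
    (hp : 1 < p <= (n%:R + 1) / (n%:R - 1))
    (hmu1 : 0 <= mu1) (hmu2 : 0 <= mu2) (hbeta : 1 < beta) (hgamma : 2 < gamma)
    (hDc : forall r, 2 * M < r -> {for r, continuous D})
    (hVc : forall r, 2 * M < r -> {for r, continuous V})
    (hD : forall r, 2 * M < r -> 0 <= D r <= mu1 * r `^ (- beta))
    (hV : forall r, 2 * M < r -> 0 <= V r <= mu2 * r `^ (- gamma))
    (hR0 : 0 < R0)
    (hu0 : radial_datum M R0 u0) (hu1 : radial_datum M R0 u1)
    (hlam0 : 4 / (M * (p - 1) * p) < lam0)
    (hphi : eigenfunction n M D V lam0 phi)
    (hdata : (0 < data_integral n M D V u0 u1 lam0 phi)%E) :
  (forall eps : R, 0 < eps ->
    (lifespan n M p D V u0 u1 R0 eps < +oo)%E) /\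
  exists C eps0 : R, [/\ 0 < C, 0 < eps0 &
    forall eps : R, 0 < eps <= eps0 ->
      (p < (n%:R + 1) / (n%:R - 1) ->
        (lifespan n M p D V u0 u1 R0 eps <=
          (C * eps `^ (- ((p - 1)^-1 - (n%:R - 1) / 2)^-1))%:E)%E) /\
      (p = (n%:R + 1) / (n%:R - 1) ->
        (lifespan n M p D V u0 u1 R0 eps <=
          (expR (C * eps `^ (- (p - 1))))%:E)%E)].
Proof.
have /andP[p1 pG] := hp.
have n3 : 3 <= n%:R :> R by rewrite (ler_nat R 3).
have n10 : 0 < n%:R - 1 :> R by lra.
have p10 : 0 < p - 1 by rewrite subr_gt0.
have p0 : 0 < p by lra.
have kapE : (n%:R - 1) / 2 * (p - 1) <= 1 /\
    ((n%:R - 1) / 2 * (p - 1) < 1 <-> p < (n%:R + 1) / (n%:R - 1)).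
  split; last split; rewrite ?ltr_pdivlMr//; last by nra.
    by move: pG; rewrite ler_pdivlMr// => pG; nra.
  by move=> H; nra.
have p2 : p <= 2.
  apply: le_trans pG _; rewrite ler_pdivrMr//; lra.
have lam0_gt0 : 0 < lam0.
  by apply: lt_trans hlam0; rewrite divr_gt0// !mulr_gt0.
have pp_lam : p / (p - 1) <= 2 * M * lam0.
  have : 8 / (p * (p - 1)) < 2 * M * lam0.
    have M2 : 0 < 2 * M by rewrite mulr_gt0.
    rewrite -(ltr_pM2l M2) in hlam0; apply: le_lt_trans hlam0.
    by rewrite le_eqVlt; apply/orP; left; apply/eqP; field; rewrite !gt_eqF.
  move=> /ltW; apply: le_trans.
  rewrite ler_pdivrMr//.
  have -> : 8 / (p * (p - 1)) * (p - 1) = 8 / p by field; rewrite !gt_eqF.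
  by rewrite ler_pdivlMr//; nra.
have D_bound r : 2 * M < r -> 0 <= D r <= mu1 * (2 * M) `^ (- beta).
  move=> r2; have /andP[-> D1] := hD r r2; apply: le_trans D1 _.
  have M2 : 0 < 2 * M by rewrite mulr_gt0.
  rewrite ler_wpM2l// !powRN lef_pV2 ?posrE ?powR_gt0 ?(lt_trans M2 r2)//.
  apply: ge0_ler_powR; rewrite ?nnegrE; lra.
have n0 : (0 < n)%N by exact: leq_trans hn.
set kap := (n%:R - 1) / 2 * (p - 1) in kapE.
have core := core_estimate n0 hM p1 hR0 lam0_gt0 hDc hVc D_bound hu0 hu1 hphi pp_lam.
have [kap1 kap_lt] := kapE.
(* B eps bounds the lifespan for every eps; for eps <= 1 it has the announced
   form, with one constant C for both cases. *)
suff [C C0 [B HB]] : exists2 C, 0 < C & exists2 B : R -> R,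
    forall eps T U T', 0 < eps -> 0 < T' < T ->
      radial_solution n M p D V u0 u1 R0 eps T U -> T' <= B eps &
    forall eps, 0 < eps <= 1 -> (kap < 1 ->
        B eps <= C * eps `^ (- ((p - 1)^-1 - (n%:R - 1) / 2)^-1)) /\
      (kap = 1 -> B eps <= expR (C * eps `^ (- (p - 1)))).
  move=> BC; have life eps : 0 < eps ->
      (lifespan n M p D V u0 u1 R0 eps <= (B eps)%:E)%E.
    by move=> e0; apply: lifespan_le => T U T'; exact: HB.
  split; first by move=> eps e0; exact: le_lt_trans (life _ e0) (ltry _).
  exists C, 1; split=> // eps e01; have /andP[e0 _] := e01.
  have [B1 B2] := BC _ e01.
  split=> [/kap_lt k1|pE]; (apply: le_trans (life _ e0) _); rewrite lee_fin.
    exact: B1.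
  apply: B2; rewrite /kap pE; field.
  by rewrite gt_eqF.
(* The antiderivative of (1 + t)^(-kap) is a power or a logarithm: this is the
   dichotomy between the subcritical and the critical exponent. *)
case: (ltP kap 1) => [k1|k1].
  have q0 : 0 < 1 - kap by rewrite subr_gt0.
  set q := 1 - kap in q0.
  have [t t1||C C0 HC] := core (fun t => q^-1 * ((1 + t) `^ q - 1)).
  - have := is_derive_power1 q0 t1; rewrite /q -/kap.
    by rewrite (_ : 1 - kap - 1 = - kap)//; ring.
  - by rewrite addr0 powR1 subrr mulr0.
  have qC : 0 < 1 + q * C by rewrite addr_gt0// mulr_gt0.
  exists ((1 + q * C) `^ q^-1); first exact: powR_gt0.
  exists (fun eps => (1 + q * (C * eps `^ (- (p - 1)))) `^ q^-1).
    move=> eps T U T' e0 T'T /(HC _ _ _ _ e0 T'T) H.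
    have T'0 : 0 < T' by case/andP: T'T.
    have E : T' = (T' `^ q) `^ q^-1.
      by rewrite -powRrM mulfV ?gt_eqF// powRr1// ltW.
    rewrite {1}E; apply: ge0_ler_powR.
    - by rewrite invr_ge0 ltW.
    - by rewrite nnegrE powR_ge0.
    - by rewrite nnegrE addr_ge0// !mulr_ge0 ?powR_ge0// ltW.
    rewrite ler_pdivrMl// in H; rewrite -lerBlDl; apply: le_trans H.
    rewrite lerD2r; apply: ge0_ler_powR; rewrite ?nnegrE; lra.
  move=> eps /andP[e0 e1]; split=> [_|]; last by move=> K; rewrite K ltxx in k1.
  set X := eps `^ (- (p - 1)).
  have X1 : 1 <= X.
    rewrite /X powRN -[X in X <= _]invr1 lef_pV2 ?posrE ?powR_gt0//.
    apply: (@le_trans _ _ (1 `^ (p - 1))); last by rewrite powR1.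
    by apply: (ge0_ler_powR (ltW p10)); rewrite ?nnegrE// ltW.
  have XE : X `^ q^-1 = eps `^ (- ((p - 1)^-1 - (n%:R - 1) / 2)^-1).
    rewrite /X -powRrM; congr (_ `^ _).
    have -> : (p - 1)^-1 - (n%:R - 1) / 2 = q / (p - 1).
      by rewrite /q /kap; field; rewrite gt_eqF.
    by rewrite invf_div mulNr.
  rewrite -XE -powRM; [|exact: ltW|exact: powR_ge0].
  apply: ge0_ler_powR.
  - by rewrite invr_ge0 ltW.
  - by rewrite nnegrE addr_ge0// !mulr_ge0 ?powR_ge0// ltW.
  - by rewrite nnegrE mulr_ge0 ?powR_ge0// ltW.
  by rewrite -/X [leRHS](_ : _ = X + q * (C * X)) ?lerD2r//; ring.
have kE : kap = 1 by apply/eqP; rewrite eq_le kap1.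
have [t t1||C C0 HC] := core (fun t => ln (1 + t)).
- by rewrite -/kap kE; exact: is_derive_ln1.
- by rewrite addr0 ln1.
exists C => //; exists (fun eps => expR (C * eps `^ (- (p - 1)))).
  move=> eps T U T' e0 T'T /(HC _ _ _ _ e0 T'T) H.
  have T'0 : 0 < T' by case/andP: T'T.
  rewrite -ler_expR lnK in H; last by rewrite posrE addr_gt0.
  by apply: le_trans H; rewrite lerDr.
by move=> eps _; split=> // K; rewrite kE ltxx in K.
Qed.
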